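(* Let $m$ be a positive integer, let $I\subset\mathbb{R}$ be a closed bounded interval, let $\omega$ be a modulus of continuity, and let $\Gamma=(f,g,h):I\to\mathbb{H}$ be a horizontal curve such that $f'$ and $g'$ are $(m-1)$-times $L^{1,\omega}$ differentiable at almost every point of $I$. Then $\Gamma$ has the $(m,\omega)$-Lusin property; that is, for every $\varepsilon>0$ there exists a $C^{m,\omega}$ horizontal curve $\widetilde\Gamma:I\to\mathbb{H}$ such that $\mathcal{L}^1(\{x\in I:\widetilde\Gamma(x)\neq\Gamma(x)\})<\varepsilon$.
   Context: A modulus of continuity is a continuous, increasing, concave function $\omega:[0,\infty]\to[0,\infty]$ with $\omega(0)=0$. $\mathcal{L}^1$ is Lebesgue measure on $\mathbb{R}$. The Heisenberg group $\mathbb{H}$ is $\mathbb{R}^3$ with group law $(x,y,z)*(x',y',z')=(x+x',y+y',z+z'+2(yx'-xy'))$. With $X(p)=\partial_x+2y\,\partial_z$ and $Y(p)=\partial_y-2x\,\partial_z$ at $p=(x,y,z)$, a curve $(f,g,h):I\to\mathbb{R}^3$ is horizontal if it is absolutely continuous and its derivative lies in $\mathrm{span}\{X,Y\}$ at the corresponding point of the curve for a.e. $t\in I$; equivalently, it is absolutely continuous and $h'=2(f'g-fg')$ a.e. in $I$. $C^{m,\omega}(\mathbb{R})$ is the space of $C^m$ functions $f:\mathbb{R}\to\mathbb{R}$ with $\sup_{x\neq y}\frac{|D^mf(x)-D^mf(y)|}{\omega(|x-y|)}<\infty$. A curve on $I$ is of class $C^{m,\omega}$ if each of its three components is the restriction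 to $I$ of a function in $C^{m,\omega}(\mathbb{R})$. For an integer $n\geq 0$, a measurable map $u$ defined almost everywhere on $[a,b]$ is $n$-times $L^{1,\omega}$ differentiable at $x\in(a,b)$ if there exist a polynomial $P$ of degree at most $n$ and constants $C>0$, $\rho_0>0$ with $B(x,\rho_0)\subset(a,b)$ such that $\frac{1}{2\rho}\int_{B(x,\rho)}|u(y)-P(y)|\,dy\leq C\omega(\rho)\rho^n$ for all $0<\rho<\rho_0$, where $B(x,\rho)=(x-\rho,x+\rho)$. *)

(* Defs.v *)
From mathcomp Require Import all_boot all_order all_algebra.
From mathcomp Require Import all_classical all_reals all_analysis.
From mathcomp Require Import ring.
Set Implicit Arguments.
Unset Strict Implicit.
Unset Printing Implicit Defensive.
Import Order.TTheory GRing.Theory Num.Theory.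
Import numFieldNormedType.Exports.
Local Open Scope ring_scope.
Local Open Scope classical_set_scope.

(* "Increasing" is read as nondecreasing and positive away from 0 (positivity
   is what makes division by omega meaningful); every strictly increasing omega
   with omega 0 = 0 qualifies. The values of omega outside [0, +oo] are junk. *)
Definition modulus_of_continuity (R : realType) (omega : \bar R -> \bar R)
    : Prop :=
  [/\ omega 0%E = 0%E,
      forall x : \bar R, (0 < x)%E -> (0 < omega x)%E,
      forall x y : \bar R, (0 <= x)%E -> (x <= y)%E -> (omega x <= omega y)%E,
      forall (t : R) (x y : \bar R),
        0 <= t <= 1 -> (0 <= x)%E -> (0 <= y)%E ->
        (t%:E * omega x + (1 - t)%:E * omega y
           <= omega (t%:E * x + (1 - t)%:E * y))%E
    & {within [set x : \bar R | (0 <= x)%E], continuous omega}].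

Definition class_C (R : realType) (m : nat) (f : R -> R) : Prop :=
  (forall (k : nat) (x : R), (k < m)%N -> derivable (f^`(k)) x 1) /\
  continuous (f^`(m)).

Definition class_Cw (R : realType) (m : nat) (omega : \bar R -> \bar R)
    (f : R -> R) : Prop :=
  class_C m f /\
  (ereal_sup [set (`|derive1n m f xy.1 - derive1n m f xy.2|%:E
                     / omega `|xy.1 - xy.2|%:E)%E
             | xy in [set xy : R * R | xy.1 != xy.2]] < +oo)%E.

Definition abs_continuous_on (R : realType) (a b : R) (f : R -> R) : Prop :=
  forall eps : R, 0 < eps -> exists2 delta : R, 0 < delta &
    forall (n : nat) (u v : 'I_n -> R),
      (forall i, [/\ a <= u i, u i <= v i & v i <= b]) ->
      trivIset [set: 'I_n] (fun i => `]u i, v i[%classic) ->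
      \sum_(i < n) (v i - u i) < delta ->
      \sum_(i < n) `|f (v i) - f (u i)| < eps.

(* The map u is total here; changing it on a null set does not affect the
   integrals. Measurability of u is not part of the predicate: it is automatic
   for the derivative of a function that is continuous on [a, b]. *)
Definition L1w_differentiable (R : realType) (a b : R) (n : nat)
    (omega : \bar R -> \bar R) (u : R -> R) (x : R) : Prop :=
  exists (P : {poly R}) (C rho0 : R),
    [/\ (size P <= n.+1)%N, 0 < C, 0 < rho0,
        ball x rho0 `<=` `]a, b[%classic
      & forall rho : R, 0 < rho -> rho < rho0 ->
        ((2 * rho)^-1%:E
           * \int[@lebesgue_measure R]_(y in ball x rho) `|u y - P.[y]|%:E
         <= C%:E * omega rho%:E * (rho ^+ n)%:E)%E].

Definition heis (R : realType) : Type := (R^o * R^o * R^o)%type.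

Section Heisenberg.
Variable R : realType.
Implicit Types p q : heis R.

Definition heis_x p : R := p.1.1.
Definition heis_y p : R := p.1.2.
Definition heis_z p : R := p.2.

Definition heis_mul p q : heis R :=
  (heis_x p + heis_x q, heis_y p + heis_y q,
   heis_z p + heis_z q + 2 * (heis_y p * heis_x q - heis_x p * heis_y q)).

Definition heis_X p : R^o * R^o * R^o := (1, 0, 2 * heis_y p).
Definition heis_Y p : R^o * R^o * R^o := (0, 1, - (2 * heis_x p)).

(* The integral curves of X and Y are the left translates of the axes. *)
Lemma heis_mulX p (t : R) :
  heis_mul p (t, 0, 0) = (p : R^o * R^o * R^o) + t *: heis_X p.
Proof.
case: p => [[x y] z]; rewrite /heis_mul /heis_x /heis_y /heis_z /=.
have -> : ((x, y, z) : R^o * R^o * R^o) + t *: heis_X (x, y, z)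
        = (x + t * 1, y + t * 0, z + t * (2 * y)) by [].
by congr (_, _, _); ring.
Qed.

Lemma heis_mulY p (t : R) :
  heis_mul p (0, t, 0) = (p : R^o * R^o * R^o) + t *: heis_Y p.
Proof.
case: p => [[x y] z]; rewrite /heis_mul /heis_x /heis_y /heis_z /=.
have -> : ((x, y, z) : R^o * R^o * R^o) + t *: heis_Y (x, y, z)
        = (x + t * 0, y + t * 1, z + t * - (2 * x)) by [].
by congr (_, _, _); ring.
Qed.

End Heisenberg.

Arguments heis_x {R} p.
Arguments heis_y {R} p.
Arguments heis_z {R} p.
Arguments heis_mul {R} p q.
Arguments heis_X {R} p.
Arguments heis_Y {R} p.

(* A curve on [a, b] is a total map of which only the restriction to [a, b]
   matters; derivatives are taken at interior points only, so that they do not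
   depend on the values outside [a, b]. *)
Definition horizontal (R : realType) (a b : R) (G : R -> heis R) : Prop :=
  [/\ abs_continuous_on a b (heis_x \o G),
      abs_continuous_on a b (heis_y \o G),
      abs_continuous_on a b (heis_z \o G)
    & {ae @lebesgue_measure R, forall t, t \in `]a, b[%R ->
        [/\ derivable (heis_x \o G) t 1,
            derivable (heis_y \o G) t 1,
            derivable (heis_z \o G) t 1
          & exists c d : R,
              (((heis_x \o G)^`() t, (heis_y \o G)^`() t, (heis_z \o G)^`() t)
                 : R^o * R^o * R^o)
              = c *: heis_X (G t) + d *: heis_Y (G t)]}].

Definition curve_Cw (R : realType) (a b : R) (m : nat)
    (omega : \bar R -> \bar R) (G : R -> heis R) : Prop :=
  exists F : R -> heis R,
    [/\ class_Cw m omega (heis_x \o F), class_Cw m omega (heis_y \o F),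
        class_Cw m omega (heis_z \o F) & {in `[a, b]%R, F =1 G}].

Definition lusin_property (R : realType) (a b : R) (m : nat)
    (omega : \bar R -> \bar R) (G : R -> heis R) : Prop :=
  forall eps : R, 0 < eps -> exists G' : R -> heis R,
    [/\ curve_Cw a b m omega G', horizontal a b G'
      & (@lebesgue_measure R [set t | t \in `[a, b]%R /\ G' t <> G t]
           < eps%:E)%E].

(* Main.v *)
(* At almost every x, absolute continuity turns the L^1 expansion of f' into
   |f - p| <= K w(|. - x|) |. - x|^m with p a polynomial of degree at most m,
   likewise for g with a polynomial q, and, through h' = 2 (f' g - f g'), into
   an estimate of the increments of h by the area swept by (p, q). Let E_K be
   the set of points where this holds with the constant K.

   Over finitely many points of E_K the jets are interpolated by piecewise
   polynomials. On a gap of length l, put eta = w(l) l^m. A Hermite interpolant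
   of (f, g) misses the increment of h by O(eta^2) if p and q are constant at
   the left node or if l is bounded below, and by O(eta l) otherwise. Bumps of
   size O(eta) repair this: a pair of bumps sweeps an area of order eta^2, and
   a single bump moving transversally to a nonzero velocity sweeps an area of
   order eta l. The resulting C^{m,w} bounds do not depend on the finite set,
   so a limit along an ultrafilter of finite subsets of E_K is a horizontal
   C^{m,w} curve equal to the given one on all of E_K; neither closedness nor
   measurability of E_K is needed.

   For each K, the points where p' or q' vanishes at x but not identically are
   isolated, hence negligible, so the sets E_K exhaust almost all of [a, b] and
   the sets of disagreement, which are measurable, have measure tending to 0. *)

Require Import Defs.
From mathcomp Require Import all_boot all_order all_algebra.
From mathcomp Require Import all_classical all_reals all_analysis.
From mathcomp Require Import measurable_realfun zify ring lra.
Set Implicit Arguments.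
Unset Strict Implicit.
Unset Printing Implicit Defensive.
Import Order.TTheory GRing.Theory Num.Theory.
Import numFieldNormedType.Exports.
Local Open Scope ring_scope.
Local Open Scope classical_set_scope.

(** * Derivatives relative to a set *)

(** What shapes the proof is the size of the defect in the height. At a node with nonzero velocity
    the Hermite interpolant may miss the increment of h by order eta l. A pair of bumps sweeping
    that area would have size sqrt(eta l), which is far more than eta when l is small, and the
    oscillation of its derivative of order m would not be controlled by w(l). Only a bump moving
    across a definite velocity corrects the area at first order. Hence the reciprocal of the speed
    is part of the constant K, and points with vanishing velocity but nonconstant polynomials are
    discarded.

    Only the values of h are prescribed, never its jets: on each gap the height is the lift of the
    plane curve, and its C^{m,w} regularity is read off from h' = 2 (f' g - f g').

    Derivatives are stated as inequalities. Taking them relative to a set allows pieces to be glued;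
    in the passage to the limit they are replaced by first-order expansions with a fixed constant,
    because these survive pointwise convergence and differentiability does not. *)

Definition slope_on (R : realType) (A : set R) (f : R -> R) (x l : R) : Prop :=
  forall e : R, 0 < e -> exists2 d : R, 0 < d &
    forall y, A y -> `|y - x| < d -> `|f y - f x - l * (y - x)| <= e * `|y - x|.

Section Slopes.
Variable R : realType.
Implicit Types (f : R -> R) (A B : set R).

Lemma slope_onW A B f x l : A `<=` B -> slope_on B f x l -> slope_on A f x l.
Proof.
by move=> AB fB e /fB[d d0 fd]; exists d => // y /AB; exact: fd.
Qed.

(** The gluing principle behind all piecewise definitions below: at a junction it combines the
    derivatives from the left and from the right. The point [x] need not belong to either set. *)
Lemma slope_onU A B f x l :
  slope_on A f x l -> slope_on B f x l -> slope_on (A `|` B) f x l.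
Proof.
move=> fA fB e e0; have [d d0 Hd] := fA e e0; have [d' d'0 Hd'] := fB e e0.
exists (Num.min d d'); first by rewrite lt_min d0.
by move=> y + ; rewrite lt_min => -[Ay|By] /andP[? ?]; [exact: Hd|exact: Hd'].
Qed.

Lemma derivable_slope f (x : R) :
  derivable f x 1 -> slope_on setT f x (derive1 f x).
Proof.
move=> fx e e0.
have /cvg_ex[l hl] := fx.
have El : derive1 f x = l.
  rewrite derive1E /derive; apply: cvg_lim => //; exact: hl.
rewrite El.
move/cvgrPdist_le: hl => /(_ _ e0).
move=> /nbhs_ballP[d /= d0 Hd].
exists d => // y _ yxd.
have [->|yx] := eqVneq y x; first by rewrite !subrr mulr0 subrr normr0 mulr0.
have := Hd (y - x).
rewrite /ball /= sub0r normrN => /(_ yxd).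
rewrite subr_eq0 /GRing.scale/= mulr1 subrK => /(_ yx) H.
have yx0 : y - x != 0 by rewrite subr_eq0.
have -> : f y - f x - l * (y - x) = - (l - (y-x)^-1 * (f y - f x)) * (y - x).
  by field.
by rewrite normrM normrN ler_wpM2r.
Qed.

Lemma slope_derive f (x l : R) : slope_on setT f x l -> is_derive x 1 f l.
Proof.
move=> H.
suff hl : h^-1 *: (f (h *: (1:R) + x) - f x) @[h --> 0^'] --> l.
  apply: DeriveDef; first by apply/cvg_ex; exists l.
  by rewrite /derive; apply: cvg_lim.
apply/cvgrPdist_le => e e0; have [d d0 Hd] := H e e0.
near=> h.
have h0 : h != 0 by near: h; exact: nbhs_dnbhs_neq.
have hd : `|h| < d.
  near: h; apply: dnbhs0_lt; exact: d0.
have := Hd (h + x) I; rewrite addrK => /(_ hd).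
rewrite /GRing.scale/= mulr1 => HH.
have -> : l - h^-1 * (f (h + x) - f x) = - (f (h + x) - f x - l * h) / h by field.
by rewrite normrM normrN normfV ler_pdivrMr ?normr_gt0.
Unshelve. all: by end_near. Qed.

Lemma slope_derive1 f (x l : R) :
  slope_on setT f x l -> derivable f x 1 /\ derive1 f x = l.
Proof.
by move=> /slope_derive H; split; [exact: ex_derive|rewrite derive1E derive_val].
Qed.

(** Cousin's lemma as an induction principle on intervals. The supremum of the endpoints reachable
    from [c] must be [d], since the local hypothesis at the supremum carries any nearby reachable
    point beyond it. *)
Lemma cousin (Q : R -> R -> Prop) (c d : R) : c <= d ->
  (forall u v w, c <= u -> u <= v -> v <= w -> w <= d ->
    Q u v -> Q v w -> Q u w) ->
  (forall x, c <= x -> x <= d -> exists2 del : R, 0 < del &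
    forall u v, c <= u -> u <= x -> x <= v -> v <= d -> v - u < del -> Q u v) ->
  Q c d.
Proof.
move=> cd Qadd Qloc.
pose S := [set x : R | c <= x <= d /\ Q c x].
have Sc : S c.
  split; first by rewrite lexx.
  have [del d0] := Qloc c (lexx _) cd; apply => //.
  by rewrite subrr.
have ubS : ubound S d by move=> x [/andP[]].
have hS : has_sup S by split; [exists c|exists d].
set s := sup S.
have cs : c <= s by apply: ub_le_sup => //; exists d.
have sd : s <= d by apply: ge_sup => //; exists c.
have [del del0 Hdel] := Qloc s cs sd.
have del2 : 0 < del / 2 by rewrite divr_gt0.
have [y [/andP[cy yd] Qy] sy] := sup_adherent del2 hS.
rewrite -/s in sy.
have ys : y <= s by apply: ub_le_sup; [exists d|split => //; rewrite cy].
(* As [y > s - del / 2], the interval from [y] to [z] is shorter than [del] and contains [s], so the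
   local hypothesis at [s] applies to it. *)
set z := Num.min d (s + del / 3).
have sz : s <= z by rewrite le_min sd lerDl divr_ge0 // ltW.
have zd : z <= d by rewrite ge_min lexx.
have Qcz : Q c z.
  apply: (Qadd _ y) => //; first exact: le_trans ys sz.
  apply: Hdel => //.
  have : z <= s + del / 3 by rewrite ge_min lexx orbT.
  lra.
have zs : z <= s.
  by apply: ub_le_sup; [exists d|split => //; rewrite zd (le_trans cs)].
have zE : z = d.
  have [//|zl] := leP d (s + del / 3); last first.
  - rewrite /z in zs *; move: zs; rewrite min_r; last exact: ltW.
    lra.
  by move=> le1; rewrite /z min_l.
by rewrite -zE.
Qed.

End Slopes.

(** * Absolutely continuous functions *)

Section AbsoluteContinuity.
Variable R : realType.
Implicit Types (f F v : R -> R) (s : seq (R * R)).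
Notation mu := (@lebesgue_measure R).

(** Ordered lists replace the indexed families of [abs_continuous_on], because they can be
    concatenated when adjacent intervals are merged in [cousin]. *)
Fixpoint chain s (u w : R) : Prop :=
  if s is p :: s' then [/\ u <= p.1, p.1 <= p.2 & chain s' p.2 w] else u <= w.

Lemma chain_le s u w : chain s u w -> u <= w.
Proof.
elim: s u => [//|p s IH] u /= [up pp /IH]; exact/le_trans/(le_trans up).
Qed.

Lemma chain_cat s t u w z : chain s u w -> chain t w z -> chain (s ++ t) u z.
Proof.
elim: s u => [|p s IH] u /=; last by move=> [up pp H] H'; split => //; apply: IH.
case: t => [|p t] /=; first exact: le_trans.
by move=> uw [wp pp H]; split => //; apply: le_trans wp.
Qed.

Lemma chain_nth s u w i : chain s u w -> (i < size s)%N ->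
  let p := nth (0, 0) s i in [/\ u <= p.1, p.1 <= p.2 & p.2 <= w].
Proof.
elim: s u i => [//|p s IH] u [|i] /= [up pp H]; first by split => //; exact: chain_le H.
rewrite ltnS => /(IH _ _ H)[H1 H2 H3]; split => //.
exact: le_trans up (le_trans pp H1).
Qed.

Lemma chain_nth_lt s u w i j : chain s u w -> (i < j)%N -> (j < size s)%N ->
  (nth (0, 0) s i).2 <= (nth (0, 0) s j).1.
Proof.
elim: s u i j => [//|p s IH] u [|i] [|j] //= [up pp H].
  by move=> _; rewrite ltnS => /(chain_nth H)[].
by rewrite !ltnS; exact: IH H.
Qed.

Lemma abs_continuous_chain (a b : R) f : abs_continuous_on a b f ->
  forall eps, 0 < eps -> exists2 del : R, 0 < del &
    forall s, chain s a b -> \sum_(p <- s) (p.2 - p.1) < del ->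
      \sum_(p <- s) `|f p.2 - f p.1| < eps.
Proof.
move=> fAC eps e0; have [del d0 H] := fAC eps e0; exists del => // s sab.
rewrite !(big_nth (0, 0)) !big_mkord => sdel.
apply: (H _ (fun i => (nth (0,0) s i).1) (fun i => (nth (0,0) s i).2)) => //.
  by move=> i; exact: chain_nth sab (ltn_ord i).
suff K (i j : 'I_(size s)) t : (i < j)%N ->
    t < (nth (0, 0) s i).2 -> (nth (0, 0) s j).1 < t -> False.
  move=> i j _ _ [t []]; rewrite /= !in_itv/= => /andP[i1 i2] /andP[j1 j2].
  apply/val_inj; case: (ltngtP i j) => // ij.
    by have := K _ _ _ ij i2 j1.
  by have := K _ _ _ ij j2 i1.
move=> ij ti tj; have := chain_nth_lt sab ij (ltn_ord j).
by rewrite leNgt (lt_trans tj ti).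
Qed.

(** Induction on the leftmost interval. Half-open intervals keep the pieces disjoint even when two
    successive intervals share an endpoint. *)
Lemma chain_measure (U : set R) s u w : measurable U -> chain s u w ->
  (forall p, p \in s -> `[p.1, p.2] `<=` U) ->
  ((\sum_(p <- s) (p.2 - p.1))%:E <= mu (U `&` `]u, w]))%E.
Proof.
move=> mU; elim: s u => [|p s IH] u; first by rewrite big_nil measure_ge0.
move=> /= [up pp sw] sU; rewrite big_cons EFinD.
have Hs : forall q, q \in s -> `[q.1, q.2] `<=` U.
  by move=> q qs; apply: sU; rewrite inE qs orbT.
have pw := chain_le sw.
have mI (x y : R) : measurable (U `&` `]x, y]) by exact: measurableI.
have -> : (p.2 - p.1)%:E = mu `]p.1, p.2].
  rewrite lebesgue_measure_itv /= lte_fin; case: ltgtP pp => // <-.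
  by rewrite subrr.
apply: (@le_trans _ _ (mu (`]p.1, p.2] `|` (U `&` `]p.2, w])))).
  rewrite measureU//; first by apply: leeD => //; exact: IH.
    exact: mI.
  rewrite -subset0 => t [] /=; rewrite !in_itv/= => /andP[_ tp] [_].
  by rewrite ltNge tp.
apply: le_measure; rewrite ?inE//=; [|exact: mI|].
  by apply: measurableU => //; exact: mI.
move=> t [/=|[Ut]]; rewrite /= !in_itv/= => /andP[t1 t2]; split => //.
- by apply: (sU p); rewrite ?mem_head//= in_itv/= (ltW t1) t2.
- by rewrite (le_lt_trans up t1) (le_trans t2 pw).
- by rewrite t2 andbT (le_lt_trans up)// (le_lt_trans pp).
Qed.

Lemma negligible_open_cover (Z : set R) (e : R) : mu.-negligible Z -> 0 < e ->
  exists U : set R, [/\ open U, Z `<=` U & (mu U < e%:E)%E].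
Proof.
move=> [N [mN N0 ZN]] e0.
have [|U [oU NU Ue]] := lebesgue_regularity_outer mN _ e0.
  by rewrite [X in (X < _)%E]N0.
exists U; split => //; first exact: subset_trans NU.
have mU : measurable U by exact: open_measurable.
have -> : U = N `|` (U `\` N) by rewrite setDUK.
apply: (@le_lt_trans _ _ (mu N + mu (U `\` N))%E); first by apply: measureU2 => //; exact: measurableD.
by rewrite [X in (X + _)%E]N0 add0e.
Qed.

(* Cousin's lemma: an interval tagged at a point where the derivatives exist
   contributes an error proportional to its length; those tagged in the null set
   lie in an open set of small measure and are absorbed by absolute continuity. *)
Lemma abs_continuous_le (c d : R) v F : c <= d -> abs_continuous_on c d v ->
  (forall x y, c <= x -> x <= y -> y <= d -> F x <= F y) ->
  {ae mu, forall t, t \in `]c, d[%R ->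
     [/\ derivable v t 1, derivable F t 1 & derive1 v t <= derive1 F t]} ->
  v d - v c <= F d - F c.
Proof.
move=> cd vAC Fmono [Z [mZ Z0 ZH]].
apply/ler_addgt0Pr => e0 e0gt.
set e := e0 / (2 * (d - c) + 2).
have cd2 : 0 < 2 * (d - c) + 2 by lra.
have egt : 0 < e by rewrite divr_gt0.
have [del del0 Hdel] := abs_continuous_chain vAC egt.
(* The endpoints join the null set, since nothing is known about derivatives there. *)
have Zcd : mu.-negligible (Z `|` [set c] `|` [set d]).
  apply: negligibleU; first apply: negligibleU.
  - by exists Z; split.
  - by exists [set c]; split => //; exact: lebesgue_measure_set1.
  - by exists [set d]; split => //; exact: lebesgue_measure_set1.
have [U [oU ZU Udel]] := negligible_open_cover Zcd del0.
pose Q u w := exists s, [/\ chain s u w,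
  (forall p, p \in s -> `[p.1, p.2] `<=` U) &
  v w - v u <= F w - F u + 2 * e * (w - u) + \sum_(p <- s) `|v p.2 - v p.1|].
have : Q c d.
  apply: cousin => //.
    move=> x y z _ _ _ _ [s [s1 s2 s3]] [t [t1 t2 t3]]; exists (s ++ t).
    split; first exact: chain_cat s1 t1.
      by move=> p; rewrite mem_cat => /orP[/s2|/t2].
    rewrite big_cat/=; lra.
  move=> x cx xd; have [Ux|NUx] := pselect (U x).
    have /nbhs_ballP[r /= r0 rU] : nbhs x U by exact: open_nbhs_nbhs.
    exists r => // u w cu ux xw wd wur; exists [:: (u, w)].
    split => /=; first by split => //; exact: le_trans xw.
      move=> p; rewrite inE => /eqP -> /= t; rewrite /= in_itv/= => /andP[ut tw].
      apply: rU; rewrite /ball/= ltr_norml; apply/andP; split; lra.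
    rewrite big_seq1/=.
    have := Fmono _ _ cu (le_trans ux xw) wd.
    have : 0 <= 2 * e * (w - u) by apply: mulr_ge0; lra.
    have := ler_norm (v w - v u); lra.
  have [Zx xc xd'] : [/\ ~ Z x, x <> c & x <> d].
    by split => H; apply/NUx/ZU; [left; left|left; right|right].
  have xcd : x \in `]c, d[%R.
    by rewrite in_itv/= !lt_def cx xd !andbT; apply/andP; split; apply/eqP => // /esym.
  have [vx Fx vF] : [/\ derivable v x 1, derivable F x 1 & derive1 v x <= derive1 F x].
    have [//|nH] := pselect [/\ derivable v x 1, derivable F x 1 & derive1 v x <= derive1 F x].
    by exfalso; apply: Zx; apply: ZH => /= /(_ xcd).
  have [r1 r10 H1] := derivable_slope vx egt.
  have [r2 r20 H2] := derivable_slope Fx egt.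
  exists (Num.min r1 r2); first by rewrite lt_min r10.
  move=> u w cu ux xw wd; rewrite lt_min => /andP[wu1 wu2].
  exists [::]; split => //=; first exact: le_trans xw.
  rewrite big_nil addr0.
  have uxn : `|u - x| = x - u by rewrite distrC ger0_norm// subr_ge0.
  have wxn : `|w - x| = w - x by rewrite ger0_norm// subr_ge0.
  have := H1 u I; have := H1 w I; have := H2 u I; have := H2 w I.
  rewrite uxn wxn !ler_norml.
  move=> /(_ ltac:(lra))/andP[A1 A2] /(_ ltac:(lra))/andP[B1 B2].
  move=> /(_ ltac:(lra))/andP[C1 C2] /(_ ltac:(lra))/andP[D1 D2].
  have : 0 <= (derive1 F x - derive1 v x) * (w - u) by apply: mulr_ge0; lra.
  nra.
move=> [s [s1 s2 s3]].
have : \sum_(p <- s) `|v p.2 - v p.1| < e.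
  apply: Hdel => //; rewrite -lte_fin; apply: le_lt_trans Udel.
  have mU : measurable U by exact: open_measurable.
  apply: le_trans (chain_measure mU s1 s2) _.
  by apply: le_measure; rewrite ?inE//; exact: measurableI.
have : e * (2 * (d - c) + 2) = e0 by rewrite /e divfK// gt_eqF.
nra.
Qed.

End AbsoluteContinuity.

Section AbsoluteContinuityAlgebra.
Variables (R : realType) (a b : R).
Implicit Types (f g : R -> R).

Lemma abs_continuous_sub c d f : a <= c -> d <= b ->
  abs_continuous_on a b f -> abs_continuous_on c d f.
Proof.
move=> ac db fAC e e0; have [del del0 H] := fAC e e0; exists del => // n u v uv.
apply: H => i; have [cu uv' vd] := uv i; split => //; first exact: le_trans cu.
exact: le_trans vd db.
Qed.

Lemma abs_continuous_pt f : abs_continuous_on a b f ->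
  forall e, 0 < e -> exists2 del : R, 0 < del &
    forall x y, a <= x -> x <= b -> a <= y -> y <= b -> `|x - y| < del ->
      `|f x - f y| < e.
Proof.
move=> fAC e e0; have [del del0 H] := abs_continuous_chain fAC e0.
exists del => // x y; wlog xy : x y / x <= y.
  move=> W ax xb ay yb xy; case: (lerP x y) => [xley|/ltW yx]; first exact: W.
  by rewrite distrC; apply: W => //; rewrite distrC.
move=> ax xb ay yb; rewrite distrC ger0_norm ?subr_ge0// => xyd.
by have := H [:: (x, y)]; rewrite !big_seq1/= distrC; apply => //; split.
Qed.

Lemma abs_continuous_bounded f : abs_continuous_on a b f ->
  exists2 B, 0 <= B & forall x, a <= x -> x <= b -> `|f x| <= B.
Proof.
move=> fAC; have [ba|ab] := ltP b a.
  exists 0 => // x ax xb; have := le_trans ax xb; lra.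
have [del del0 H] := abs_continuous_pt fAC ltr01.
suff [B HB] : exists B, forall x, a <= x -> x <= b -> `|f x| <= B.
  exists `|B| => // x ax xb; exact: le_trans (HB _ ax xb) (ler_norm _).
pose Q u v := exists B, forall x, u <= x -> x <= v -> `|f x| <= B.
apply: (@cousin R Q) => //.
  move=> u v w _ _ _ _ [B HB] [C HC]; exists (Num.max B C) => x ux xw.
  rewrite le_max; apply/orP; have [xv|/ltW vx] := leP x v.
    by left; exact: HB.
  by right; exact: HC.
move=> x ax xb; exists del => // u v au ux xv vb vu; exists (`|f x| + 1) => y uy yv.
have : `|f y - f x| < 1.
  apply: H => //; [exact: le_trans uy|exact: le_trans yv vb|].
  rewrite ltr_norml; apply/andP; split; lra.
have := ler_normD (f y - f x) (f x); rewrite subrK; lra.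
Qed.

Lemma abs_continuous_cst k : abs_continuous_on a b (fun=> k).
Proof.
move=> e e0; exists 1 => // n u v _ _ _.
by rewrite big1// => i _; rewrite subrr normr0.
Qed.

Lemma abs_continuous_id : abs_continuous_on a b id.
Proof.
move=> e e0; exists e => // n u v uv _.
rewrite (eq_bigr (fun i => `|v i - u i|)) => // i _.
by rewrite ger0_norm// subr_ge0; have [] := uv i.
Qed.

Lemma abs_continuousD f g : abs_continuous_on a b f -> abs_continuous_on a b g ->
  abs_continuous_on a b (fun x => f x + g x).
Proof.
move=> fAC gAC e e0; have e2 : 0 < e / 2 by rewrite divr_gt0.
have [d1 d10 H1] := fAC _ e2; have [d2 d20 H2] := gAC _ e2.
exists (Num.min d1 d2); first by rewrite lt_min d10.
move=> n u v uv tr; rewrite lt_min => /andP[/(H1 _ _ _ uv tr) s1 /(H2 _ _ _ uv tr) s2].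
apply: le_lt_trans (_ : _ <= \sum_(i < n) (`|f (v i) - f (u i)| + `|g (v i) - g (u i)|)) _.
  by apply: ler_sum => i _; apply: le_trans (ler_normD _ _); rewrite addrACA opprD.
by rewrite big_split/=; lra.
Qed.

Lemma abs_continuousM f g : abs_continuous_on a b f -> abs_continuous_on a b g ->
  abs_continuous_on a b (fun x => f x * g x).
Proof.
move=> fAC gAC e e0.
have [B B0 HB] := abs_continuous_bounded fAC.
have [C C0 HC] := abs_continuous_bounded gAC.
have e2 : 0 < e / (2 * (B + C + 1)) by rewrite divr_gt0//; lra.
have [d1 d10 H1] := fAC _ e2; have [d2 d20 H2] := gAC _ e2.
exists (Num.min d1 d2); first by rewrite lt_min d10.
move=> n u v uv tr; rewrite lt_min => /andP[/(H1 _ _ _ uv tr) s1 /(H2 _ _ _ uv tr) s2].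
apply: le_lt_trans (_ : _ <= \sum_(i < n) (C * `|f (v i) - f (u i)| + B * `|g (v i) - g (u i)|)) _.
  apply: ler_sum => i _; have [au uv' vb] := uv i.
  have -> : f (v i) * g (v i) - f (u i) * g (u i) =
    g (v i) * (f (v i) - f (u i)) + f (u i) * (g (v i) - g (u i)) by ring.
  apply: le_trans (ler_normD _ _) _; rewrite !normrM.
  apply: lerD; apply: ler_wpM2r => //.
    by apply: HC => //; exact: le_trans uv'.
  by apply: HB => //; exact: le_trans vb.
rewrite big_split/= -!mulr_sumr.
set S1 := \sum_(i < n) _ in s1 *; set S2 := \sum_(i < n) _ in s2 *.
set t := e / _ in s1 s2 e2.
have te : t * (2 * (B + C + 1)) = e by rewrite /t divfK// gt_eqF//; lra.
nra.
Qed.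

Lemma abs_continuous_horner (p : {poly R}) : abs_continuous_on a b (horner p).
Proof.
elim/poly_ind: p => [|p c IH].
  by rewrite (_ : horner 0 = fun=> 0); [exact: abs_continuous_cst|apply/funext => x; rewrite horner0].
rewrite (_ : horner _ = fun x => p.[x] * x + c); last by apply/funext => x; rewrite !hornerE.
apply: abs_continuousD; last exact: abs_continuous_cst.
exact: abs_continuousM abs_continuous_id.
Qed.

End AbsoluteContinuityAlgebra.

Section Clamp.
Variables (R : realType) (a b : R).
Hypothesis ab : a <= b.

(** The projection onto [[a, b]]: composing with it extends a function on [[a, b]] by constants,
    which preserves continuity and moduli of continuity. *)
Definition clamp (t : R) : R := Num.max a (Num.min t b).

Lemma clamp_itv t : a <= clamp t <= b.
Proof. by rewrite /clamp le_max lexx ge_max ab ge_min lexx orbT. Qed.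

Lemma clamp_id t : a <= t -> t <= b -> clamp t = t.
Proof. by move=> at_ tb; rewrite /clamp min_l// max_r. Qed.

Lemma clamp_cases t : [\/ clamp t = a /\ t <= a, clamp t = t /\ (a <= t /\ t <= b)
  | clamp t = b /\ b <= t].
Proof.
rewrite /clamp; have [tb|/ltW bt] := leP t b.
  by have [ta|/ltW at_] := leP t a; [constructor 1|constructor 2; split].
by constructor 3; rewrite max_r.
Qed.

Lemma clamp_dist s t : `|clamp s - clamp t| <= `|s - t|.
Proof.
have := ler_norm (s - t); have := ler_norm (t - s); rewrite (distrC t s) => H1 H2.
rewrite ler_norml; apply/andP.
have [] := clamp_cases s; have [] := clamp_cases t.
all: by move=> [-> ?] [-> ?]; split; move: ab; lra.
Qed.

Lemma abs_continuous_clamp (f : R -> R) : abs_continuous_on a b f ->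
  continuous (f \o clamp).
Proof.
move=> fAC x; apply/cvgrPdist_lt => e e0.
have [del del0 H] := abs_continuous_pt fAC e0.
apply/nbhs_ballP; exists del => //= y; rewrite /ball/= => xy.
have /andP[? ?] := clamp_itv x; have /andP[? ?] := clamp_itv y.
by apply: H => //; exact: le_lt_trans (clamp_dist _ _) xy.
Qed.

End Clamp.

(** * From bounds on integrals to monotone primitives *)

Section Domination.
Variable R : realType.
Implicit Types (f : R -> R).
Notation mu := (@lebesgue_measure R).

(* No measurability: the integral of a nonnegative function is a supremum over
   the simple functions below it. *)
Lemma ge0_le_integral_nonmeasurable (D : set R) (f g : R -> \bar R) :
  (forall x, D x -> (0 <= f x)%E) -> (forall x, D x -> (f x <= g x)%E) ->
  (\int[mu]_(x in D) f x <= \int[mu]_(x in D) g x)%E.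
Proof.
move=> f0 fg; have g0 x : D x -> (0 <= g x)%E by move=> Dx; apply: le_trans (fg _ Dx); exact: f0.
rewrite !ge0_integralE//; apply: le_ereal_sup => _ [h hf <-]; exists h => // x.
apply: le_trans (hf x) _; rewrite !patchE; case: ifPn => // /set_mem; exact: fg.
Qed.

(** The derivative is the pointwise limit of the difference quotients with step [n.+1%:R^-1]; these
    are continuous once [f] is composed with [clamp], and the composition is eventually invisible
    since [D] lies in the open interval. *)
Lemma measurable_derive1 (a b : R) f (D : set R) : a <= b -> measurable D ->
  abs_continuous_on a b f -> D `<=` `]a, b[ ->
  (forall t, D t -> derivable f t 1) -> measurable_fun D (derive1 f).
Proof.
move=> ab mD fAC Dab fD.
pose g := f \o clamp a b.
have gc : continuous g by exact: abs_continuous_clamp.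
pose h (n : nat) (t : R) := n.+1%:R * (g (t + n.+1%:R^-1) - g t).
apply: (@measurable_fun_cvg _ _ _ D h).
  move=> n; apply: measurable_funTS; apply: continuous_measurable_fun => t.
  apply: cvgM; first exact: cvg_cst.
  apply: cvgB; last exact: gc.
  apply: (@cvg_comp _ _ _ (fun t => t + n.+1%:R^-1) g _ (nbhs (t + n.+1%:R^-1))); last exact: gc.
  by apply: cvgD; [exact: cvg_id|exact: cvg_cst].
move=> t Dt; have := Dab _ Dt; rewrite /= in_itv/= => /andP[at_ tb].
apply/cvgrPdist_le => e e0.
have [d d0 Hd] := derivable_slope (fD _ Dt) e0.
have bt0 : 0 < b - t by rewrite subr_gt0.
near=> n.
have n0 : 0 < n.+1%:R^-1 :> R by rewrite invr_gt0.
have nd : n.+1%:R^-1 < d by near: n; exact: near_infty_natSinv_lt (PosNum d0).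
have nb : n.+1%:R^-1 < b - t by near: n; exact: near_infty_natSinv_lt (PosNum bt0).
have at1 : a <= t + n.+1%:R^-1 by rewrite (le_trans (ltW at_))// lerDl ltW.
have tb1 : t + n.+1%:R^-1 <= b by rewrite -lerBrDl ltW.
rewrite /h /g /= (clamp_id at1 tb1) (clamp_id (ltW at_) (ltW tb)).
have := Hd (t + n.+1%:R^-1) I.
rewrite addrAC subrr add0r gtr0_norm// => /(_ nd) H.
rewrite distrC.
set k := n.+1%:R^-1 in n0 nd nb H *.
have -> : n.+1%:R = k^-1 by rewrite /k invrK.
have k0 : k != 0 by rewrite gt_eqF.
have -> : k^-1 * (f (t + k) - f t) - derive1 f t = (f (t + k) - f t - derive1 f t * k) / k by field.
by rewrite normrM normfV (gtr0_norm n0) ler_pdivrMr.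
Unshelve. all: by end_near. Qed.

(** [F] is the integral of |f' - P| up to a variable endpoint, and Lebesgue differentiation gives
    its derivative almost everywhere. From here on an L^1 bound is used only through such a monotone
    function, compared with [f] by [abs_continuous_le]. *)
Lemma domination (a b x rho I : R) f (P : {poly R}) :
  abs_continuous_on a b f ->
  {ae mu, forall t, t \in `]a, b[%R -> derivable f t 1} ->
  0 < rho -> ball x rho `<=` `]a, b[ ->
  (\int[mu]_(y in ball x rho) `|derive1 f y - P.[y]|%:E <= I%:E)%E ->
  exists F : R -> R, [/\ forall s t, s <= t -> F s <= F t,
    forall s t, F t - F s <= I &
    {ae mu, forall t, ball x rho t -> [/\ derivable f t 1, derivable F t 1 &
       derive1 F t = `|derive1 f t - P.[t]| ]}].
Proof.
move=> fAC [Z [mZ Z0 ZH]] rho0 Bab HI.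
have ab : a <= b.
  have := Bab x; rewrite /= in_itv/= => /(_ (ballxx _ rho0))/andP[? ?]; lra.
pose D := ball x rho `\` Z.
have mB : measurable (ball x rho) by exact: measurable_ball.
have mD : measurable D by exact: measurableD.
have DfD t : D t -> derivable f t 1.
  move=> [Bt nZ]; have [//|nd] := pselect (derivable f t 1).
  by exfalso; apply: nZ; apply: ZH => /= H; apply/nd/H; exact: Bab.
have mf : measurable_fun D (derive1 f).
  by apply: measurable_derive1 ab mD fAC _ DfD => t [/Bab].
pose w t := `|derive1 f t - P.[t]|.
have mw : measurable_fun D w.
  apply: measurableT_comp => //; apply: measurable_funB => //.
  apply: measurable_funTS; apply: continuous_measurable_fun; exact: continuous_horner.
pose W := w \_ D.
have W0 t : 0 <= W t by rewrite /W patchE; case: ifP => _; rewrite /w ?normr_ge0.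
have mW : measurable_fun setT W by exact: (measurable_restrictT w mD).1 mw.
have mWE : measurable_fun setT (EFin \o W) by exact/measurable_EFinP.
have WI : (\int[mu]_t (W t)%:E <= I%:E)%E.
  apply: le_trans HI; rewrite [leRHS]integral_mkcond.
  apply: ge0_le_integral_nonmeasurable => t _; first by rewrite lee_fin.
  rewrite /W !patchE; case: ifPn => [/set_mem[Bt _]|_]; first by rewrite mem_set.
  by case: ifP => _; rewrite ?lee_fin ?normr_ge0.
have intW : mu.-integrable setT (EFin \o W).
  apply/integrableP; split => //=.
  under eq_integral do rewrite ger0_norm//.
  exact: le_lt_trans WI (ltry _).
pose F y := \int[mu]_(t in `]-oo, y]) W t.
have FE y : (F y)%:E = (\int[mu]_(t in `]-oo, y]) (W t)%:E)%E.
  rewrite /F /Rintegral fineK//.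
  apply: integrable_fin_num => //; exact: integrableS intW.
exists F; split.
- move=> s t st; rewrite -lee_fin !FE; apply: ge0_subset_integral => //.
  + by apply: measurable_funTS.
  + by move=> r _; rewrite lee_fin.
  + by move=> r; rewrite /= !in_itv/= => rs; exact: le_trans st.
- move=> s t.
  have Ft : F t <= I.
    rewrite -lee_fin FE; apply: le_trans WI; apply: ge0_subset_integral => //.
    by move=> r _; rewrite lee_fin.
  have Fs : 0 <= F s by rewrite -lee_fin FE; apply: integral_ge0 => r _; rewrite lee_fin.
  lra.
have /(_ _)[||N [mN N0 NH]] := @FTC1Ny R W.
- by move=> y; exact: integrableS intW.
- have := @integrable_locally R W setT measurableT intW.
  by rewrite patch_setT.
have ZN : mu.-negligible (Z `|` N).
  by apply: negligibleU; [exists Z|exists N]; split.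
case: ZN => M [mM M0 ZM]; exists M; split => // t /= nH.
apply: contrapT => Mt; apply: nH => Bt.
have Dt : D t by split => // Zt; apply/Mt/ZM; left.
have [Fd F'] : derivable F t 1 /\ derive1 F t = W t.
  by apply: contrapT => nF; apply/Mt/ZM; right; apply: NH.
split => //; first exact: DfD.
by rewrite F' /W patchE mem_set.
Qed.

End Domination.

Section SlopeCalculus.
Variables (R : realType) (A : set R).
Implicit Types (f g : R -> R).

Lemma slope_on_cst (k x : R) : slope_on A (fun=> k) x 0.
Proof. by move=> e e0; exists 1 => // y _ _; rewrite subrr mul0r subr0 normr0 mulr_ge0// ltW. Qed.

Lemma slope_onD f g x l k : slope_on A f x l -> slope_on A g x k ->
  slope_on A (fun y => f y + g y) x (l + k).
Proof.
move=> fl gk e e0; have e2 : 0 < e / 2 by rewrite divr_gt0.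
have [d d0 Hd] := fl _ e2; have [d' d'0 Hd'] := gk _ e2.
exists (Num.min d d'); first by rewrite lt_min d0.
move=> y Ay; rewrite lt_min => /andP[/(Hd _ Ay) H1 /(Hd' _ Ay) H2].
have -> : f y + g y - (f x + g x) - (l + k) * (y - x) =
  (f y - f x - l * (y - x)) + (g y - g x - k * (y - x)) by ring.
by apply: le_trans (ler_normD _ _) _; lra.
Qed.

Lemma slope_onM f g x l k : slope_on A f x l -> slope_on A g x k ->
  slope_on A (fun y => f y * g y) x (l * g x + f x * k).
Proof.
move=> fl gk e e0.
set F := `|f x|; set G := `|g x|; set L := `|l| + 1; set K := `|k| + 1.
have F0 : 0 <= F := normr_ge0 _. have G0 : 0 <= G := normr_ge0 _.
have L0 : 0 < L by rewrite ltr_wpDl. have K0 : 0 < K by rewrite ltr_wpDl.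
have FG : 0 < 2 * (F + G + 1) by lra.
set e1 := e / (2 * (F + G + 1)).
have e1E : e1 * (2 * (F + G + 1)) = e by rewrite /e1 divfK// gt_eqF.
have e10 : 0 < e1 by rewrite divr_gt0.
have LK : 0 < 2 * (L * K) by rewrite mulr_gt0// mulr_gt0.
set e3 := e / (2 * (L * K)).
have e3E : e3 * (2 * (L * K)) = e by rewrite /e3 divfK// gt_eqF.
have e30 : 0 < e3 by rewrite divr_gt0.
have [d1 d10 H1] := fl _ e10; have [d2 d20 H2] := gk _ e10.
have [d3 d30 H3] := fl _ ltr01; have [d4 d40 H4] := gk _ ltr01.
exists (Num.min (Num.min d1 d2) (Num.min (Num.min d3 d4) e3)).
  by rewrite !lt_min d10 d20 d30 d40 e30.
move=> y Ay; rewrite !lt_min => /andP[/andP[/(H1 _ Ay) h1 /(H2 _ Ay) h2]].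
move=> /andP[/andP[/(H3 _ Ay) h3 /(H4 _ Ay) h4] h5].
set D := `|y - x| in h1 h2 h3 h4 h5 *.
have D0 : 0 <= D := normr_ge0 _.
have fL : `|f y - f x| <= L * D.
  rewrite -[f y - f x](subrK (l * (y - x))); apply: le_trans (ler_normD _ _) _.
  by rewrite normrM -/D /L; lra.
have gK : `|g y - g x| <= K * D.
  rewrite -[g y - g x](subrK (k * (y - x))); apply: le_trans (ler_normD _ _) _.
  by rewrite normrM -/D /K; lra.
have -> : f y * g y - f x * g x - (l * g x + f x * k) * (y - x) =
  (f y - f x - l * (y - x)) * g x + f x * (g y - g x - k * (y - x)) +
  (f y - f x) * (g y - g x) by ring.
apply: le_trans (ler_normD _ _) _; apply: le_trans (lerD (ler_normD _ _) (lexx _)) _.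
rewrite !normrM -/F -/G.
have a1 : `|f y - f x - l * (y - x)| * G <= e1 * D * G by rewrite ler_wpM2r.
have a2 : F * `|g y - g x - k * (y - x)| <= F * (e1 * D) by rewrite ler_wpM2l.
have a3 : `|f y - f x| * `|g y - g x| <= L * D * (K * D) by rewrite ler_pM.
have a4 : L * D * (K * D) <= (L * K) * (e3 * D).
  have -> : L * D * (K * D) = (L * K) * (D * D) by ring.
  apply: ler_wpM2l; first by rewrite mulr_ge0// ltW.
  by apply: ler_wpM2r => //; exact: ltW.
have a5 : (L * K) * (e3 * D) = e / 2 * D by rewrite -e3E; field.
have a6 : e1 * D * G + F * (e1 * D) <= e / 2 * D.
  have -> : e / 2 * D = e1 * D * (F + G + 1) by rewrite -e1E; field.
  have : 0 <= e1 * D by rewrite mulr_ge0// ltW.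
  nra.
lra.
Qed.

Lemma slope_onZ c f x l : slope_on A f x l -> slope_on A (fun y => c * f y) x (c * l).
Proof.
by move=> /(slope_onM (slope_on_cst c x)); rewrite mul0r add0r.
Qed.

Lemma slope_onB f g x l k : slope_on A f x l -> slope_on A g x k ->
  slope_on A (fun y => f y - g y) x (l - k).
Proof.
move=> fl /(slope_onZ (-1)) gk.
rewrite (_ : (fun y => _) = fun y => f y + -1 * g y); last by apply/funext => y; rewrite mulN1r.
by rewrite (_ : l - k = l + -1 * k); [exact: slope_onD|rewrite mulN1r].
Qed.

Lemma slope_on_horner (p : {poly R}) x : slope_on A (horner p) x p^`().[x].
Proof.
apply: (@slope_onW _ _ setT) => //.
by rewrite derivE; apply: derivable_slope; exact: derivable_horner.
Qed.

Lemma slope_on_eq f g x l : A x -> (forall y, A y -> f y = g y) ->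
  slope_on A f x l -> slope_on A g x l.
Proof.
move=> Ax fg fl e e0; have [d d0 H] := fl e e0; exists d => // y Ay.
by rewrite -!fg//; exact: H.
Qed.

End SlopeCalculus.

(** * Polynomials *)

Section Polynomials.
Variable R : realType.
Implicit Types (p q r : {poly R}) (c s : R).

(** The primitive that vanishes at 0: its coefficient of index 0 is a quotient by 0, which is 0 by
    convention. *)
Definition prim p : {poly R} := \poly_(i < (size p).+1) (p`_i.-1 / i%:R).

Lemma coef_prim p i : (prim p)`_i = p`_i.-1 / i%:R.
Proof.
rewrite coef_poly ltnS; case: leqP => // pi.
case: i pi => [//|i /=]; rewrite ltnS => /leq_sizeP -> //; by rewrite mul0r.
Qed.

Lemma deriv_prim p : deriv (prim p) = p.
Proof.
apply/polyP => i; rewrite coef_deriv coef_prim /= -[LHS]mulr_natr divfK//.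
Qed.

Lemma prim0 p : (prim p).[0] = 0.
Proof. by rewrite horner_coef0 coef_prim invr0 mulr0. Qed.

Lemma primD p q : prim (p + q) = prim p + prim q.
Proof. by apply/polyP => i; rewrite coefD !coef_prim coefD mulrDl. Qed.

Lemma primZ c p : prim (c *: p) = c *: prim p.
Proof. by apply/polyP => i; rewrite coefZ !coef_prim coefZ mulrA. Qed.

(** The l^1 norm of the coefficients. It is submultiplicative and dominates the values on [[-1, 1]],
    so estimates on a gap become estimates of this norm once the gap is rescaled to [[0, 1]]. *)
Definition pnorm p : R := \sum_(i < size p) `|p`_i|.

Lemma pnormE n p : (size p <= n)%N -> pnorm p = \sum_(i < n) `|p`_i|.
Proof.
move=> pn; rewrite /pnorm (big_ord_widen n (fun i => `|p`_i|))//.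
rewrite big_mkcond; apply: eq_bigr => i _; case: ifPn => //.
by rewrite -leqNgt => /leq_sizeP -> //; rewrite normr0.
Qed.

Lemma pnorm_ge0 p : 0 <= pnorm p.
Proof. by apply: sumr_ge0. Qed.

Lemma pnorm0 : pnorm 0 = 0.
Proof. by rewrite (@pnormE 0%N) ?size_poly0// big_ord0. Qed.

Lemma pnormD p q : pnorm (p + q) <= pnorm p + pnorm q.
Proof.
set n := maxn (size p) (size q).
rewrite (@pnormE n) ?size_polyD// (@pnormE n p) ?leq_maxl// (@pnormE n q) ?leq_maxr//.
by rewrite -big_split; apply: ler_sum => i _; rewrite coefD ler_normD.
Qed.

Lemma pnormZ c p : pnorm (c *: p) = `|c| * pnorm p.
Proof.
rewrite (@pnormE (size p)) ?size_scale_leq// mulr_sumr.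
by apply: eq_bigr => i _; rewrite coefZ normrM.
Qed.

Lemma pnormB p q : pnorm (p - q) <= pnorm p + pnorm q.
Proof. by apply: le_trans (pnormD _ _) _; rewrite -scaleN1r pnormZ normrN1 mul1r. Qed.

Lemma pnorm_cons p c : pnorm (p * 'X + c%:P) = pnorm p + `|c|.
Proof.
rewrite (@pnormE (size p).+1); last by rewrite size_MXaddC; case: ifP.
rewrite big_ord_recl addrC coefD coefMX coefC /= add0r; congr (_ + _).
by apply: eq_bigr => i _; rewrite coefD coefMX coefC /= addr0.
Qed.

Lemma pnormM p q : pnorm (p * q) <= pnorm p * pnorm q.
Proof.
elim/poly_ind: p => [|p c IH]; first by rewrite mul0r pnorm0 mul0r.
have -> : (p * 'X + c%:P) * q = (p * q) * 'X + 0%:P + c *: q.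
  by rewrite addr0 -mul_polyC mulrDl -!mulrA (mulrC 'X).
apply: le_trans (pnormD _ _) _; rewrite !pnorm_cons normr0 addr0 pnormZ mulrDl.
by rewrite lerD2r.
Qed.

Lemma horner_pnorm p s : `|s| <= 1 -> `|p.[s]| <= pnorm p.
Proof.
move=> s1; rewrite horner_coef; apply: le_trans (ler_norm_sum _ _ _) _.
apply: ler_sum => i _; rewrite normrM normrX ler_piMr//.
exact: exprn_ile1.
Qed.

Lemma pnorm_deriv n p : (size p <= n)%N -> pnorm (deriv p) <= n%:R * pnorm p.
Proof.
move=> pn; rewrite (@pnormE n (deriv p)); last first.
  by rewrite (leq_trans _ pn)// (leq_trans (size_poly _ _))// leq_pred.
rewrite (@pnormE n.+1 p) ?(leqW pn)// big_ord_recl mulrDr.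
apply: ler_wpDl; first by rewrite mulr_ge0.
rewrite mulr_sumr; apply: ler_sum => i _; rewrite coef_deriv normrMn -[leLHS]mulr_natl.
by apply: ler_wpM2r => //; rewrite ler_nat.
Qed.

Lemma pnorm_derivn n k p : (size p <= n)%N -> pnorm (derivn k p) <= n%:R ^+ k * pnorm p.
Proof.
move=> pn; elim: k => [|k IH]; first by rewrite derivn0 expr0 mul1r.
rewrite derivnS exprS; apply: le_trans (@pnorm_deriv n _ _) _; last first.
  by rewrite -mulrA; apply: ler_wpM2l.
elim: k {IH} => [//|k IH]; rewrite derivnS (leq_trans _ IH)//.
by rewrite (leq_trans (size_poly _ _))// leq_pred.
Qed.

Lemma pnorm_prim p : `|(prim p).[1]| <= pnorm p.
Proof.
rewrite horner_coef; apply: le_trans (ler_norm_sum _ _ _) _.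
have -> : pnorm p = \sum_(i < (size p).+1) (if i == 0%N :> nat then 0 else `|p`_i.-1|).
  by rewrite big_ord_recl/= add0r; apply: eq_bigr.
rewrite (big_ord_widen (size p).+1 (fun i => `|(prim p)`_i * 1 ^+ i|)); last exact: size_poly.
rewrite big_mkcond; apply: ler_sum => -[[|i] ip] _ /=; rewrite coef_prim expr1n mulr1.
  by rewrite invr0 mulr0 normr0; case: ifP.
case: ifP => _; rewrite ?normr_ge0// normrM ler_piMr// normfV normr_nat invf_le1 ?ltr0n//.
by rewrite ler1n.
Qed.

Lemma prim_mvt p : exists2 c, 0 < c < 1 & (prim p).[1] = p.[c].
Proof.
have [| |c] := @MVT R (horner (prim p)) (horner p) 0 1 ltr01.
- move=> x _; apply: slope_derive; have := @slope_on_horner R setT (prim p) x.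
  by rewrite deriv_prim.
- by apply: continuous_subspaceT => x; exact: continuous_horner.
rewrite in_itv/= => c01; rewrite prim0 !subr0 mulr1 => ->.
by exists c.
Qed.

(** Equivalence of norms in finite dimension: the coefficients are recovered from the values at as
    many equally spaced nodes by the inverse of a Vandermonde matrix, whose entries give [C]. *)
Lemma pnorm_le_horner n : exists2 C : R, 0 < C & forall p e, (size p <= n)%N ->
  (forall s, 0 <= s <= 1 -> `|p.[s]| <= e) -> pnorm p <= C * e.
Proof.
case: n => [|n].
  exists 1 => // p e; rewrite leqn0 size_poly_eq0 => /eqP -> H.
  by rewrite pnorm0 mul1r; have := H 0; rewrite lexx ler01 horner0 normr0; apply.
pose x : 'rV[R]_n.+1 := \row_i (i%:R / n.+1%:R).
pose V := Vandermonde n.+1 x.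
have Vu : V \in unitmx.
  rewrite unitmxE det_Vandermonde unitfE; apply/prodf_neq0 => i _.
  apply/prodf_neq0 => j ij; rewrite !mxE subr_eq0.
  rewrite (can_eq (mulfVK _)) ?invr_eq0 ?pnatr_eq0//.
  by rewrite eqr_nat gtn_eqF.
pose C := \sum_(i < n.+1) \sum_(j < n.+1) `|(invmx V) j i|.
have C0 : 0 <= C by apply: sumr_ge0 => i _; apply: sumr_ge0.
exists (C + 1); first by rewrite ltr_wpDl.
move=> p e pn H.
have e0 : 0 <= e by apply: le_trans (H 0 _); rewrite ?lexx ?ler01.
apply: (@le_trans _ _ (C * e)); last by rewrite ler_wpM2r// lerDl.
pose c : 'rV[R]_n.+1 := \row_i p`_i.
pose y : 'rV[R]_n.+1 := \row_j p.[x 0 j].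
have cV : c *m V = y.
  apply/rowP => j; rewrite !mxE (@horner_coef_wide _ n.+1)//.
  by apply: eq_bigr => i _; rewrite !mxE.
have cE : c = y *m invmx V by rewrite -cV mulmxK.
rewrite (@pnormE n.+1)// mulr_suml; apply: ler_sum => i _.
have -> : p`_i = c 0 i by rewrite mxE.
rewrite cE mxE mulr_suml; apply: le_trans (ler_norm_sum _ _ _) _.
apply: ler_sum => j _; rewrite normrM mulrC ler_wpM2l// mxE; apply: H.
rewrite !mxE divr_ge0//= ler_pdivrMr ?ltr0n// mul1r ler_nat; exact: ltnW.
Qed.

End Polynomials.

(** * Moduli of continuity *)

(** Concavity survives only as the fourth clause, which says that [w s / s] is nonincreasing, and
    continuity only as smallness near 0. *)
Definition modulus (R : realType) (w : R -> R) : Prop :=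
  [/\ w 0 = 0, forall s, 0 < s -> 0 < w s,
      forall s t, 0 <= s -> s <= t -> w s <= w t,
      forall s t, 0 < s -> s <= t -> s * w t <= t * w s
    & forall e, 0 < e -> exists2 d, 0 < d & forall s, 0 <= s -> s < d -> w s < e].

Section Modulus.
Variable R : realType.

(** Finiteness has to be proved: by concavity between 0 and [s], an infinite value at [s] would make
    [omega] infinite at every smaller positive number, against continuity at 0. *)
Lemma modulus_of_continuity_fine (omega : \bar R -> \bar R)
    (w := fun s : R => fine (omega s%:E)) : modulus_of_continuity omega ->
  modulus w /\ (forall s, 0 <= s -> omega s%:E = (w s)%:E).
Proof.
move=> [ o0 opos omono oconc ocont].
have oge0 s : 0 <= s -> (0 <= omega s%:E)%E.
  by move=> s0; rewrite -o0; apply: omono => //; rewrite lee_fin.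
have osmall e : 0 < e -> exists2 d, 0 < d &
    forall s, 0 <= s -> s < d -> (omega s%:E < e%:E)%E.
  move=> e0.
  have H : omega x @[x --> within [set x | (0 <= x)%E] (nbhs (0%:E : \bar R))] --> (0%:E : \bar R).
    rewrite -[X in _ --> X]o0; apply: ((subspace_continuousP _ _).1 ocont).
    exact: lexx.
  have /H : nbhs (0%:E : \bar R) [set y | (y < e%:E)%E] by apply: open_ereal_lt'; rewrite lte_fin.
  rewrite /nbhs/= /within/= => /nbhs_EFin/nbhs_ballP[d /= d0 Hd].
  exists d => // s s0 sd; apply: Hd; last by rewrite lee_fin.
  by rewrite /ball/= sub0r normrN ger0_norm.
have oscale s t : 0 < s -> s <= t -> ((s / t)%:E * omega t%:E <= omega s%:E)%E.
  move=> s0 st; have t0 : 0 < t by exact: lt_le_trans st.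
  have := oconc (s / t) t%:E 0%:E; rewrite o0 !mule0 !adde0 -EFinM divfK ?gt_eqF//.
  apply; rewrite ?lee_fin ?(ltW t0)// divr_ge0 ?(ltW s0) ?(ltW t0)//=.
  by rewrite ler_pdivrMr// mul1r.
have ofin s : 0 <= s -> omega s%:E \is a fin_num.
  move=> s0; rewrite fin_numE; apply/andP; split.
    by apply/eqP => os; have := oge0 _ s0; rewrite os.
  apply/eqP => os.
  have [d d0 Hd] := osmall 1 ltr01.
  have sp : 0 < s.
    rewrite lt_neqAle s0 andbT; apply/eqP => s00; move: os.
    by rewrite -s00 [omega _]o0.
  pose t := Num.min (d / 2) s.
  have t0 : 0 < t by rewrite lt_min sp andbT divr_gt0.
  have td : t < d by rewrite gt_min; apply/orP; left; lra.
  have ts : t <= s by rewrite ge_min lexx orbT.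
  have := oscale _ _ t0 ts; rewrite os gt0_muley; last by rewrite lte_fin divr_gt0.
  by rewrite leye_eq => /eqP ot; have := Hd t (ltW t0) td; rewrite ot.
have oE s : 0 <= s -> omega s%:E = (w s)%:E.
  by move=> s0; rewrite /w fineK// ofin.
split => //; split.
- by rewrite /w [omega _]o0.
- by move=> s s0; rewrite -lte_fin -oE ?(ltW s0)//; apply: opos.
- move=> s t s0 st; rewrite -lee_fin -!oE//; last exact: le_trans st.
  by apply: omono; rewrite lee_fin.
- move=> s t s0 st; have t0 : 0 < t by exact: lt_le_trans st.
  have := oscale _ _ s0 st; rewrite (oE _ (ltW s0)) (oE _ (ltW t0)) -EFinM lee_fin.
  by rewrite mulrAC ler_pdivrMr// [t * _]mulrC.
- move=> e /osmall[d d0 Hd]; exists d => // s s0 sd.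
  by rewrite -lte_fin -oE//; exact: Hd.
Qed.

Variable w : R -> R.
Hypothesis wP : modulus w.

Lemma modulus0 : w 0 = 0. Proof. by case: wP. Qed.

Lemma modulus_gt0 s : 0 < s -> 0 < w s. Proof. by case: wP => _ H _ _ _; exact: H. Qed.

Lemma modulus_ge0 s : 0 <= s -> 0 <= w s.
Proof.
by rewrite le_eqVlt => /orP[/eqP <-|/modulus_gt0/ltW //]; rewrite modulus0.
Qed.

Lemma modulus_le s t : 0 <= s -> s <= t -> w s <= w t.
Proof. by case: wP => _ _ H _ _; exact: H. Qed.

Lemma modulus_scale s t : 0 < s -> s <= t -> s * w t <= t * w s.
Proof. by case: wP => _ _ _ H _; exact: H. Qed.

Lemma modulus_small e : 0 < e ->
  exists2 d, 0 < d & forall s, 0 <= s -> s < d -> w s < e.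
Proof. by case: wP => _ _ _ _; exact. Qed.

Lemma modulus_double s : 0 <= s -> w (2 * s) <= 2 * w s.
Proof.
rewrite le_eqVlt => /orP[/eqP <-|s0]; first by rewrite mulr0 modulus0 mulr0.
have : s * w (2 * s) <= (2 * s) * w s by apply: modulus_scale => //; lra.
by rewrite (mulrC 2) -mulrA ler_pM2l.
Qed.

Lemma modulus_lin s L : 0 < L -> 0 <= s -> s <= L -> s <= L / w L * w s.
Proof.
move=> L0; rewrite le_eqVlt => /orP[/eqP <-|s0] sL; first by rewrite modulus0 mulr0.
rewrite mulrAC ler_pdivlMr ?modulus_gt0//; exact: modulus_scale.
Qed.

End Modulus.

(** * Taylor expansions at almost every point *)

Section TaylorPoints.
Variables (R : realType) (a b : R) (m : nat) (w : R -> R).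
Hypotheses (m0 : (0 < m)%N) (wP : modulus w).
Implicit Types (f g h F : R -> R) (p q : {poly R}).
Notation mu := (@lebesgue_measure R).

Lemma ae_imp (P Q : R -> Prop) : (forall t, P t -> Q t) ->
  {ae mu, forall t, P t} -> {ae mu, forall t, Q t}.
Proof. by move=> PQ; apply: negligibleS => t /= nQ /PQ. Qed.

Lemma ae_and (P Q : R -> Prop) : {ae mu, forall t, P t} ->
  {ae mu, forall t, Q t} -> {ae mu, forall t, P t /\ Q t}.
Proof.
move=> HP HQ; apply: negligibleS (negligibleU HP HQ) => t /= /not_andP.
by case; [left|right].
Qed.

Lemma abs_continuous_dom (c d : R) v F : c <= d -> abs_continuous_on c d v ->
  (forall x y, c <= x -> x <= y -> y <= d -> F x <= F y) ->
  {ae mu, forall t, t \in `]c, d[%R ->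
     [/\ derivable v t 1, derivable F t 1 & `|derive1 v t| <= derive1 F t]} ->
  `|v d - v c| <= F d - F c.
Proof.
move=> cd vAC Fm H; rewrite ler_norml lerNl; apply/andP; split; last first.
  apply: abs_continuous_le => //; apply: ae_imp H => t Ht /Ht[? ? H]; split => //.
  by apply: le_trans H; exact: ler_norm.
have -> : - (v d - v c) = (-1 * v d) - (-1 * v c) by ring.
apply: (@abs_continuous_le R c d (fun x => -1 * v x)) => //.
  by apply: abs_continuousM => //; exact: abs_continuous_cst.
apply: ae_imp H => t Ht /Ht[vt Ft H].
have /slope_derive1[? ->] := slope_onZ (-1) (derivable_slope vt).
by split => //; apply: le_trans H; rewrite mulN1r -normrN ler_norm.
Qed.

(* F is meant to be a primitive of |f' - p'|, of total variation at most I. *)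
Definition osculates f p (x rho I : R) := exists F : R -> R,
  [/\ forall s t, s <= t -> F s <= F t, forall s t, F t - F s <= I &
    {ae mu, forall t, ball x rho t -> [/\ derivable f t 1, derivable F t 1 &
      derive1 F t = `|derive1 f t - (deriv p).[t]| ]}].

Lemma slope_on_Bhorner f p t : derivable f t 1 ->
  slope_on setT (fun y => f y - p.[y]) t (derive1 f t - (deriv p).[t]).
Proof.
by move=> ft; apply: slope_onB; [exact: derivable_slope|exact: slope_on_horner].
Qed.

Lemma abs_continuous_Bhorner c d f p : abs_continuous_on c d f ->
  abs_continuous_on c d (fun y => f y - p.[y]).
Proof.
move=> fAC; rewrite (_ : (fun y => _) = fun y => f y + (- p).[y]).
  by apply: abs_continuousD => //; exact: abs_continuous_horner.
by apply/funext => y; rewrite hornerN.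
Qed.

(** The difference f - p vanishes at [x], and its increments are dominated by those of [F], which
    never exceed [I]. *)
Lemma osculates_bound f p x rho I : abs_continuous_on a b f -> f x = p.[x] ->
  ball x rho `<=` `]a, b[ -> osculates f p x rho I ->
  forall z, ball x rho z -> `|f z - p.[z]| <= I.
Proof.
move=> fAC fx Bab [F [Fm FI FD]] z; rewrite /ball/= => xz.
have rho0 : 0 < rho by exact: le_lt_trans xz.
have alx : f x - p.[x] = 0 by rewrite fx subrr.
suff H c d : x - rho < c -> d < x + rho -> c <= d ->
    `|(f d - p.[d]) - (f c - p.[c])| <= I.
  move: xz; rewrite ltr_norml => /andP[z1 z2].
  have [xz|/ltW zx] := leP x z.
    by have := H x z; rewrite alx subr0; apply; lra.
  by have := H z x; rewrite alx sub0r normrN; apply; lra.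
move=> xc dx cd.
have inB t : c <= t -> t <= d -> ball x rho t.
  by move=> ct td; rewrite /ball/= ltr_norml; apply/andP; split; lra.
have /= := Bab _ (inB c (lexx _) cd); rewrite in_itv/= => /andP[ac _].
have /= := Bab _ (inB d cd (lexx _)); rewrite in_itv/= => /andP[_ db].
apply: le_trans (FI c d).
apply: (abs_continuous_dom (v := fun y => f y - p.[y])) => //.
- by apply: abs_continuous_Bhorner; exact: abs_continuous_sub (ltW ac) (ltW db) fAC.
- by move=> ? ? _ + _; exact: Fm.
apply: ae_imp FD => t Ht; rewrite in_itv/= => /andP[ct td].
have [ft Ft F'] := Ht (inB t (ltW ct) (ltW td)).
by have /slope_derive1[? ->] := slope_on_Bhorner p ft; rewrite F'.
Qed.

Lemma L1w_osculates (omega : \bar R -> \bar R) f x :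
  (forall s, 0 <= s -> omega s%:E = (w s)%:E) ->
  abs_continuous_on a b f ->
  {ae mu, forall t, t \in `]a, b[%R -> derivable f t 1} ->
  L1w_differentiable a b m.-1 omega (derive1 f) x ->
  exists p (K r : R), [/\ (size p <= m.+1)%N, p.[x] = f x, 0 < K &
    [/\ 0 < r, ball x r `<=` `]a, b[ & forall rho, 0 < rho -> rho < r ->
      osculates f p x rho (K * (w rho * rho ^+ m))]].
Proof.
move=> omegaE fAC fD [P [C [r [sP C0 r0 Bab H]]]].
rewrite prednK// in sP.
pose p := prim P + (f x - (prim P).[x])%:P.
have p' : deriv p = P by rewrite derivD derivC addr0 deriv_prim.
(* Passing from the mean over the ball to the integral multiplies by [2 * rho]: this doubles the
   constant and raises the exponent from [m.-1] to [m]. *)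
exists p, (2 * C), r; split => //.
- rewrite (leq_trans (size_polyD _ _))// geq_max (leq_trans (size_poly _ _))//=.
  by rewrite (leq_trans (size_polyC_leq1 _)).
- by rewrite hornerD hornerC addrC subrK.
- by rewrite mulr_gt0.
split => // rho rho0 rhor; rewrite /osculates p'.
apply: (@domination R a b) => //.
  by apply: subset_trans Bab; apply: le_ball; exact: ltW.
have := H _ rho0 rhor; rewrite (omegaE _ (ltW rho0)) -!EFinM lee_pdivrMl ?mulr_gt0//.
move/le_trans; apply; rewrite -EFinM lee_fin -{2}(prednK m0) exprS.
rewrite le_eqVlt; apply/orP; left; apply/eqP; ring.
Qed.

(** The ball of radius [2 * |z - x|] is used because [z] must lie inside an open ball. Doubling the
    radius costs a factor 2 for [w], by concavity, and [2 ^+ m] for the power. *)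
Lemma osculates_taylor f p x r K : abs_continuous_on a b f -> f x = p.[x] ->
  ball x r `<=` `]a, b[ -> 0 < K ->
  (forall rho, 0 < rho -> rho < r -> osculates f p x rho (K * (w rho * rho ^+ m))) ->
  forall z, 2 * `|z - x| < r ->
    `|f z - p.[z]| <= K * 2 * 2 ^+ m * (w `|z - x| * `|z - x| ^+ m).
Proof.
move=> fAC fx Bab K0 H z zr.
have [->|zx] := eqVneq z x.
  rewrite fx subrr normr0 mulr_ge0// ?mulr_ge0 ?exprn_ge0 ?(ltW K0)//.
  by rewrite subrr normr0 modulus0.
have d0 : 0 < `|z - x| by rewrite normr_gt0 subr_eq0.
set d := `|z - x| in zr d0 *.
have d20 : 0 < 2 * d by rewrite mulr_gt0.
apply: le_trans (osculates_bound fAC fx _ (H _ d20 zr) _) _.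
- by apply: subset_trans Bab; apply: le_ball; exact: ltW.
- by rewrite /ball/= distrC -/d; lra.
rewrite exprMn; have := modulus_double wP (ltW d0).
set e := d ^+ m; have e0 : 0 <= e by rewrite exprn_ge0// ltW.
have t0 : 0 <= K * 2 ^+ m * e by rewrite mulr_ge0// mulr_ge0 ?(ltW K0)// exprn_ge0.
move=> /(ler_wpM2l t0); lra.
Qed.

End TaylorPoints.

(** * Rescaled polynomials: a Markov inequality and a lower bound near a zero *)

Section Rescaling.
Variable R : realType.
Implicit Types (p d : {poly R}) (x l : R).

Definition rescale x l p : {poly R} := p \Po (l *: 'X + x%:P).

Lemma horner_rescale x l p s : (rescale x l p).[s] = p.[x + l * s].
Proof. by rewrite horner_comp !hornerE addrC. Qed.

Lemma size_rescale x l p n : (size p <= n)%N -> (size (rescale x l p) <= n)%N.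
Proof.
move=> pn; have [->|] := eqVneq p 0; first by rewrite /rescale comp_poly0 size_poly0.
rewrite -size_poly_gt0 => p0; apply: leq_trans (size_comp_poly_leq _ _) _.
have : (size (l *: 'X + x%:P)%R <= 2)%N.
  rewrite (leq_trans (size_polyD _ _))// geq_max (leq_trans (size_scale_leq _ _)) ?size_polyX//=.
  by rewrite (leq_trans (size_polyC_leq1 _)).
move: (_ + _ : {poly R}) => r.
case: (size p) p0 pn => [//|k] _ kn; case: (size r) => [|[|[|//]]] _ /=.
all: rewrite ?muln0 ?muln1; lia.
Qed.

Lemma deriv_rescale x l p : deriv (rescale x l p) = l *: rescale x l (deriv p).
Proof. by rewrite /rescale deriv_comp derivD derivC addr0 derivZ derivX -scalerAr mulr1. Qed.

Lemma derivn_rescale x l p k :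
  derivn k (rescale x l p) = l ^+ k *: rescale x l (derivn k p).
Proof.
elim: k => [|k IH]; first by rewrite !derivn0 expr0 scale1r.
by rewrite !derivnS IH derivZ deriv_rescale scalerA exprSr.
Qed.

(** A Markov inequality with unspecified constant: on the unit interval it is equivalence of norms,
    and rescaling produces the power of |y - x|. The factor [n.+1] rather than [n] keeps the
    constant positive when [n] is 0. *)
Lemma markov_endpoint n k : exists2 C : R, 0 < C & forall d x y e,
  (size d <= n)%N -> (forall s, 0 <= s <= 1 -> `|d.[x + (y - x) * s]| <= e) ->
  `|y - x| ^+ k * `|(derivn k d).[y]| <= C * e.
Proof.
have [C C0 HC] := @pnorm_le_horner R n.
exists (n.+1%:R ^+ k * C); first by rewrite mulr_gt0// exprn_gt0.
move=> d x y e dn H.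
have rn := size_rescale x (y - x) dn.
have -> : `|y - x| ^+ k * `|(derivn k d).[y]| = `|(derivn k (rescale x (y - x) d)).[1]|.
  by rewrite derivn_rescale hornerZ horner_rescale mulr1 (addrC x) subrK normrM normrX.
apply: le_trans (horner_pnorm _ _) _; first by rewrite normr1.
apply: le_trans (@pnorm_derivn R n.+1 k _ (leqW rn)) _; rewrite -mulrA.
apply: ler_wpM2l; first by rewrite exprn_ge0.
by apply: HC => // s s01; rewrite horner_rescale H.
Qed.

(** After division by the exact power of 'X - x, the cofactor stays above half of its nonzero value
    at [x]. The multiplicity is at most [n], so for |y - x| < 1 the power [n] gives a weaker
    bound. *)
Lemma horner_lower_bound p x n : p != 0 -> (size p <= n.+1)%N ->
  exists c del : R, [/\ 0 < c, 0 < del &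
    forall y, `|y - x| < del -> c * `|y - x| ^+ n <= `|p.[y]|].
Proof.
move=> p0 pn; have [j [q /(implyP)/(_ p0) qx pE]] := multiplicity_XsubC p x.
have q0 : q != 0 by apply: contraNneq p0 => q0; rewrite pE q0 mul0r.
have jn : (j <= n)%N.
  move: pn; rewrite pE size_Mmonic ?monic_exp ?monicXsubC// size_exp_XsubC addnS/=.
  have : (0 < size q)%N by rewrite lt0n size_poly_eq0.
  by move: (size q) => k k0 kj; rewrite -ltnS (leq_trans _ kj)// -add1n leq_add2r.
have qx0 : 0 < `|q.[x]| / 2 by rewrite divr_gt0// normr_gt0.
have := @continuous_horner R q x; move=> /cvgrPdist_lt => /(_ _ qx0).
move=> /nbhs_ballP[d /= d0 Hd].
exists (`|q.[x]| / 2), (Num.min d 1); split => //; first by rewrite lt_min d0 ltr01.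
move=> y; rewrite lt_min => /andP[yd y1].
rewrite pE hornerM horner_exp !hornerE normrM normrX.
apply: ler_pM; rewrite ?(ltW qx0) ?exprn_ge0//.
  have /Hd : ball x d y by rewrite /ball/= distrC.
  have := ler_distD 0 q.[x] q.[y]; have := lerB_dist q.[x] q.[y]; lra.
by apply: ler_wiXn2l => //; rewrite ltW.
Qed.

End Rescaling.

Section Isolated.
Variable R : realType.
Notation mu := (@lebesgue_measure R).

(** The set is countable: it is covered by pieces indexed by a radius 1 / (j + 1) and a rational
    centre, each of which contains at most one point. *)
Lemma isolated_negligible (A : set R) :
  (forall x, A x -> exists2 del : R, 0 < del & forall y, A y -> `|y - x| < del -> y = x) ->
  mu.-negligible A.
Proof.
move=> HA.
pose B (jq : nat * rat) := [set x | [/\ A x,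
  forall y, A y -> `|y - x| < 2 * jq.1.+1%:R^-1 -> y = x &
  `|x - ratr jq.2| < jq.1.+1%:R^-1]].
have Bsub jq (x y : R) : B jq x -> B jq y -> y = x.
  move=> [_ + xq] [Ay _ yq]; apply => //; apply: le_lt_trans (ler_distD (ratr jq.2) y x) _.
  by rewrite (distrC (ratr jq.2) x) mulr_natl mulr2n ltrD.
have Bn jq : mu.-negligible (B jq).
  have [[x Bx]|nB] := pselect (exists x, B jq x); last first.
    by apply: negligibleS (negligible_set0 _) => x Bx; apply: nB; exists x.
  exists [set x]; split => //; first exact: lebesgue_measure_set1.
  by move=> y By; exact: Bsub By.
pose F n := if @unpickle (nat * rat)%type n is Some jq then B jq else set0.
suff AF : A `<=` \bigcup_n F n.
  apply: negligibleS; first exact: AF.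
  apply: negligible_bigcup => n.
  by rewrite /F; case: unpickle => [jq|]; [exact: Bn|exact: negligible_set0].
move=> x Ax; have [del del0 Hx] := HA x Ax.
have del2 : 0 < del / 2 by rewrite divr_gt0.
have [j jd] : exists j : nat, j.+1%:R^-1 < del / 2.
  have [N _ HN] := near_infty_natSinv_lt (PosNum del2).
  by exists N; exact: (HN N (leqnn _)).
have [q xq] : exists q : rat, `|x - ratr q| < j.+1%:R^-1.
  have x1 : x < x + j.+1%:R^-1 by rewrite ltrDl invr_gt0.
  have [q] := rat_in_itvoo x1; rewrite in_itv/= => /andP[q1 q2]; exists q.
  by rewrite distrC gtr0_norm ?subr_gt0// ltrBlDl.
exists (pickle (j, q)) => //; rewrite /F pickleK; split => //= y Ay yx.
apply: Hx => //; apply: lt_trans yx _; by move: jd; rewrite ltr_pdivlMr// mulrC.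
Qed.

End Isolated.

(** * Points where the velocity of the Taylor polynomial vanishes *)

Section DegeneratePoints.
Variables (R : realType) (m : nat) (w : R -> R).
Hypotheses (m0 : (0 < m)%N) (wP : modulus w).
Notation mu := (@lebesgue_measure R).

(** One constant bounds the error and, through its inverse, the radius. The condition thus weakens
    as [K] grows, and integer values of [K] suffice. *)
Definition taylor_point (f : R -> R) (p : {poly R}) (K x : R) : Prop :=
  forall z, `|z - x| < K^-1 -> `|f z - p.[z]| <= K * (w `|z - x| * `|z - x| ^+ m).

Lemma taylor_pointW f p (K K' x : R) : 0 < K -> K <= K' -> taylor_point f p K x ->
  taylor_point f p K' x.
Proof.
move=> K0 KK' H z zx; apply: le_trans (H z _) _.
  by apply: lt_le_trans zx _; rewrite lef_pV2// posrE (lt_le_trans K0).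
by apply: ler_wpM2r => //; rewrite mulr_ge0 ?exprn_ge0// modulus_ge0.
Qed.

(** Every point between [x] and [y] lies within [K^-1] of both, so [p] and [q] approximate the same
    value of [f] there. *)
Lemma taylor_points_close f p q (K x y s : R) : 0 < K -> `|y - x| < K^-1 ->
  taylor_point f p K x -> taylor_point f q K y -> 0 <= s <= 1 ->
  `|(q - p).[x + (y - x) * s]| <= 2 * K * (w `|y - x| * `|y - x| ^+ m).
Proof.
move=> K0 yx Hp Hq /andP[s0 s1]; set z := x + _.
have D0 : 0 <= `|y - x| by [].
have zx : `|z - x| <= `|y - x|.
  by rewrite /z addrAC subrr add0r normrM (ger0_norm s0) ler_piMr.
have zy : `|z - y| <= `|y - x|.
  have -> : z - y = (y - x) * - (1 - s) by rewrite /z; ring.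
  by rewrite normrM normrN ler_piMr// ger0_norm ?subr_ge0// gerBl.
have E t : 0 <= t -> t <= `|y - x| -> K * (w t * t ^+ m) <= K * (w `|y - x| * `|y - x| ^+ m).
  move=> t0 tD; apply: ler_wpM2l; first exact: ltW.
  apply: ler_pM; [exact: modulus_ge0|exact: exprn_ge0|exact: modulus_le|].
  by rewrite lerXn2r// nnegrE.
have h1 := le_trans (Hp z (le_lt_trans zx yx)) (E _ (normr_ge0 _) zx).
have h2 := le_trans (Hq z (le_lt_trans zy yx)) (E _ (normr_ge0 _) zy).
rewrite hornerD hornerN.
have := ler_distD (f z) q.[z] p.[z]; rewrite (distrC q.[z] (f z)); lra.
Qed.

(* Such points are isolated for K fixed: if x and y are two of them, with
   polynomials p and q, then p'(y) = (p - q)'(y) is o(|y - x|^(m-1)), whereas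
   |p'(y)| >= c |y - x|^(m-1) because p' is nonzero of degree less than m. *)
Lemma degenerate_negligible f : mu.-negligible [set x | exists (p : {poly R}) (K : R),
  [/\ (size p <= m.+1)%N, 0 < K, taylor_point f p K x, (deriv p).[x] = 0 & deriv p != 0]].
Proof.
pose B (n : nat) := [set x | exists p : {poly R}, [/\ (size p <= m.+1)%N,
  taylor_point f p n.+1%:R x, (deriv p).[x] = 0 & deriv p != 0]].
have DB : [set x | exists (p : {poly R}) (K : R), [/\ (size p <= m.+1)%N, 0 < K, taylor_point f p K x,
    (deriv p).[x] = 0 & deriv p != 0]] `<=` \bigcup_n B n.
  move=> x [p [K [sp K0 Hp px p0]]].
  have [n nK] : exists n : nat, K <= n.+1%:R.
    exists (Num.truncn K); apply: ltW; exact: truncnS_gt.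
  by exists n => //; exists p; split => //; exact: taylor_pointW nK Hp.
apply: negligibleS; first exact: DB.
apply: negligible_bigcup => n; apply: isolated_negligible => x [p [sp Hp _ p0]].
have [C C0 HC] := @markov_endpoint R m.+1 1.
have sp' : (size (deriv p) <= m.-1.+1)%N.
  by rewrite prednK// (leq_trans (size_poly _ _))//; case: (size p) sp.
have [c [del [c0 del0 Hc]]] := horner_lower_bound x p0 sp'.
set K : R := n.+1%:R in Hp *.
have K0 : 0 < K by [].
have e0 : 0 < c / (C * (2 * K)) by rewrite divr_gt0// mulr_gt0// mulr_gt0.
have [del' del'0 Hw] := modulus_small wP e0.
exists (Num.min del (Num.min del' K^-1)).
  by rewrite !lt_min del0 del'0 invr_gt0.
move=> y [q [sq Hq qy _]]; rewrite !lt_min => /andP[yd /andP[yd' yK]].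
apply/eqP; apply: contraT => yx.
have D0 : 0 < `|y - x| by rewrite normr_gt0 subr_eq0.
have sqp : (size (q - p)%R <= m.+1)%N.
  by rewrite (leq_trans (size_polyD _ _))// geq_max sq size_polyN.
have := HC _ x y _ sqp (fun s s01 => taylor_points_close K0 yK Hp Hq s01).
rewrite expr1 derivn1 derivB hornerD hornerN qy sub0r normrN.
have := Hc y yd; have := Hw _ (ltW D0) yd'.
set D := `|y - x| in D0 *; set v := `|_.[y]|.
rewrite ltr_pdivlMr; last by rewrite mulr_gt0// mulr_gt0.
rewrite -{2}(prednK m0) exprS; set t := D ^+ _ => H1 H2 H3.
have t0 : 0 < t by rewrite exprn_gt0.
have := ler_wpM2l (ltW D0) H2 => /le_trans /(_ H3).
have -> : D * (c * t) = (D * t) * c by ring.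
have -> : C * (2 * K * (w D * (D * t))) = (D * t) * (w D * (C * (2 * K))) by ring.
by rewrite ler_pM2l ?mulr_gt0// leNgt H1.
Qed.

End DegeneratePoints.

(** * Height increments and the area swept by the Taylor polynomials *)

Section AreaEstimate.
Variables (R : realType) (a b : R).
Implicit Types (f g h F : R -> R) (p q : {poly R}).
Notation mu := (@lebesgue_measure R).

(** [2 * area p q] is the height of the horizontal lift of the plane curve [(p, q)], normalised to
    vanish at 0. *)
Definition area p q : {poly R} := prim (deriv p * q - p * deriv q).

Lemma deriv_area p q : deriv (area p q) = deriv p * q - p * deriv q.
Proof. exact: deriv_prim. Qed.

(* With al = f - p and be = g - q, the quantity on the left is the increment of
   a function with derivative 4 p' be - 4 al q' + 2 al' be - 2 al be', where
   |al|, |be| <= I and the integrals of |al'|, |be'| are at most I. *)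
Lemma area_estimate f g h p q (x rho I B z : R) :
  abs_continuous_on a b f -> abs_continuous_on a b g -> abs_continuous_on a b h ->
  {ae mu, forall t, t \in `]a, b[%R -> [/\ derivable f t 1, derivable g t 1,
     derivable h t 1 & derive1 h t = 2 * (derive1 f t * g t - f t * derive1 g t)]} ->
  f x = p.[x] -> g x = q.[x] -> ball x rho `<=` `]a, b[ ->
  osculates f p x rho I -> osculates g q x rho I ->
  0 <= B -> (forall t, a <= t -> t <= b -> `|(deriv p).[t]| <= B /\ `|(deriv q).[t]| <= B) ->
  x <= z -> ball x rho z ->
  `|h z - h x - 2 * ((area p q).[z] - (area p q).[x])
    - 2 * ((f z - p.[z]) * q.[z] - p.[z] * (g z - q.[z]))|
  <= 8 * I * B * (z - x) + 4 * I * I.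
Proof.
move=> fAC gAC hAC hD fx gx Bab Of Og B0 HB xz Bz.
have alI := osculates_bound fAC fx Bab Of.
have beI := osculates_bound gAC gx Bab Og.
have [F [Fm FI FD]] := Of; have [G [Gm GI GD]] := Og.
have zx : z - x < rho by move: Bz; rewrite /ball/= distrC ger0_norm// subr_ge0.
have inB t : x <= t -> t <= z -> ball x rho t.
  by move=> xt tz; rewrite /ball/= distrC ger0_norm ?subr_ge0//; lra.
have /= := Bab _ (inB x (lexx _) xz); rewrite in_itv/= => /andP[ax _].
have /= := Bab _ (inB z xz (lexx _)); rewrite in_itv/= => /andP[_ zb].
have I0 : 0 <= I by have := FI x x; rewrite subrr.
pose al y := f y - p.[y]; pose be y := g y - q.[y].
(* The last term is an integration by parts: it cancels the products of [al'] with [q] and of [be']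
   with [p], whose integrals would be of order [I] without a factor [z - x]. *)
pose v y := h y - 2 * (area p q).[y] - 2 * (al y * q.[y] - p.[y] * be y).
pose V y := (8 * I * B) * y + 2 * I * (F y + G y).
have vAC : abs_continuous_on x z v.
  have sub := abs_continuous_sub (ltW ax) (ltW zb).
  have N u : abs_continuous_on x z u -> abs_continuous_on x z (fun y => -2 * u y).
    by move=> uAC; apply: abs_continuousM => //; exact: abs_continuous_cst.
  have M1 u : abs_continuous_on x z u -> abs_continuous_on x z (fun y => -1 * u y).
    by move=> uAC; apply: abs_continuousM => //; exact: abs_continuous_cst.
  rewrite (_ : v = fun y => h y + -2 * (area p q).[y] + -2 * (al y * q.[y] + -1 * (p.[y] * be y))).
    apply: abs_continuousD; first apply: abs_continuousD.
    - exact: sub.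
    - by apply: N; exact: abs_continuous_horner.
    have alAC : abs_continuous_on x z al by apply: abs_continuous_Bhorner; exact: sub.
    have beAC : abs_continuous_on x z be by apply: abs_continuous_Bhorner; exact: sub.
    apply: N; apply: abs_continuousD; last apply: M1.
      exact: abs_continuousM alAC (abs_continuous_horner _ _ q).
    exact: abs_continuousM (abs_continuous_horner _ _ p) beAC.
  by apply/funext => y; rewrite /v; ring.
have -> : h z - h x - 2 * ((area p q).[z] - (area p q).[x])
    - 2 * ((f z - p.[z]) * q.[z] - p.[z] * (g z - q.[z])) = v z - v x.
  by rewrite /v /al /be fx gx; ring.
apply: (@le_trans _ _ (V z - V x)); last first.
  have -> : V z - V x = 8 * I * B * (z - x) + 2 * I * ((F z - F x) + (G z - G x)).
    by rewrite /V; ring.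
  have := ler_wpM2l I0 (FI x z); have := ler_wpM2l I0 (GI x z); lra.
apply: abs_continuous_dom => //.
  move=> s t _ st _; apply: lerD.
    by apply: ler_wpM2l => //; rewrite !mulr_ge0.
  by apply: ler_wpM2l; [rewrite mulr_ge0|apply: lerD; [exact: Fm|exact: Gm]].
have H := ae_and hD (ae_and FD GD).
apply: ae_imp H => t [Hh [HF HG]]; rewrite in_itv/= => /andP[xt tz].
have Bt := inB _ (ltW xt) (ltW tz).
have [ft Ft F'] := HF Bt; have [gt Gt G'] := HG Bt.
have [_ _ ht h'] := Hh (Bab _ Bt).
have sal := slope_on_Bhorner p ft; have sbe := slope_on_Bhorner q gt.
have svt := slope_onB (slope_onB (derivable_slope ht)
  (slope_onZ 2 (slope_on_horner setT (area p q) t)))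
  (slope_onZ 2 (slope_onB (slope_onM sal (slope_on_horner setT q t))
                          (slope_onM (slope_on_horner setT p t) sbe))).
have sVt := slope_onD (slope_onM (slope_on_cst setT (8 * I * B) t) (slope_on_horner setT 'X t))
  (slope_onZ (2 * I) (slope_onD (derivable_slope Ft) (derivable_slope Gt))).
have [vt v'] := slope_derive1 (svt : slope_on setT v t _).
have EV : (fun y => 8 * I * B * ('X).[y] + 2 * I * (F y + G y)) = V.
  by apply/funext => y; rewrite /V hornerX.
rewrite EV in sVt; have [Vt V'] := slope_derive1 sVt.
split => //; rewrite v' V' derivX !hornerE F' G' h' deriv_area.
have [Bp Bq] := HB t (ltW (lt_trans ax xt)) (ltW (lt_trans tz zb)).
have al_ := alI _ Bt; have be_ := beI _ Bt.
rewrite !hornerE; set P' := (deriv p).[t] in Bp *; set Q' := (deriv q).[t] in Bq *.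
set f' := derive1 f t; set g' := derive1 g t.
have -> : 2 * (f' * g t - f t * g') - 2 * (P' * q.[t] - p.[t] * Q') -
  2 * ((f' - P') * q.[t] + (f t - p.[t]) * Q' - (P' * (g t - q.[t]) + p.[t] * (g' - Q'))) =
  4 * (P' * be t) - 4 * (al t * Q') + 2 * ((f' - P') * be t) - 2 * (al t * (g' - Q')).
  by rewrite /al /be; ring.
have b1 : `|P' * be t| <= B * I by rewrite normrM ler_pM.
have b2 : `|al t * Q'| <= I * B by rewrite normrM ler_pM.
have b3 : `|(f' - P') * be t| <= `|f' - P'| * I by rewrite normrM ler_wpM2l.
have b4 : `|al t * (g' - Q')| <= I * `|g' - Q'| by rewrite normrM ler_wpM2r.
move: b1 b2 b3 b4; rewrite !ler_norml => /andP[? ?] /andP[? ?] /andP[? ?] /andP[? ?].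
apply/andP; split; lra.
Qed.

End AreaEstimate.

(** * Good points and their abundance *)

Section GoodPoints.
Variables (R : realType) (a b : R) (m : nat) (w : R -> R).
Hypotheses (m0 : (0 < m)%N) (wP : modulus w).
Variables (f g h : R -> R).
Implicit Types (p q : {poly R}) (K x : R).
Notation mu := (@lebesgue_measure R).

(* [good_area] carries no term of order eta (z - x) when p and q are constant;
   [good_speed] excludes the points where they have zero velocity at x without
   being constant. *)
Record good_point K x p q : Prop := GoodPoint {
  good_size_p : (size p <= m.+1)%N;
  good_size_q : (size q <= m.+1)%N;
  good_p : p.[x] = f x;
  good_q : q.[x] = g x;
  good_jet_p : forall k, `|(derivn k p).[x]| <= K;
  good_jet_q : forall k, `|(derivn k q).[x]| <= K;
  good_h : `|h x| <= K;
  good_taylor_p : taylor_point m w f p K x;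
  good_taylor_q : taylor_point m w g q K x;
  good_area : forall z (eta := w (z - x) * (z - x) ^+ m), x <= z -> z - x < K^-1 ->
    `|h z - h x - 2 * ((area p q).[z] - (area p q).[x])
      - 2 * ((f z - p.[z]) * q.[z] - p.[z] * (g z - q.[z]))|
    <= K * eta * ((if (deriv p == 0) && (deriv q == 0) then 0 else z - x) + eta);
  good_speed : [\/ deriv p = 0 /\ deriv q = 0, K^-1 <= `|(deriv p).[x]|
                 | K^-1 <= `|(deriv q).[x]| ]
}.

Lemma modulus_expr_ge0 t : 0 <= t -> 0 <= w t * t ^+ m.
Proof. by move=> t0; apply: mulr_ge0; [exact: modulus_ge0|exact: exprn_ge0]. Qed.

Lemma good_pointW K K' x p q : 0 < K -> K <= K' -> good_point K x p q ->
  good_point K' x p q.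
Proof.
move=> K0 KK' [sp sq px qx jp jq hx tp tq ar sp'].
have K'0 : 0 < K' by exact: lt_le_trans KK'.
have KV : K'^-1 <= K^-1 by rewrite lef_pV2.
split => //.
- by move=> k; exact: le_trans KK'.
- by move=> k; exact: le_trans KK'.
- exact: le_trans KK'.
- exact: taylor_pointW tp.
- exact: taylor_pointW tq.
- move=> z eta xz zx; apply: le_trans (ar z xz (lt_le_trans zx KV)) _.
  rewrite -/eta -(mulrA K) -(mulrA K'); apply: ler_wpM2r => //.
  have eta0 : 0 <= eta by apply: modulus_expr_ge0; rewrite subr_ge0.
  by apply: mulr_ge0 => //; apply: addr_ge0 => //; case: ifP; rewrite ?subr_ge0.
- by case: sp' => [?|H|H]; [constructor 1|constructor 2|constructor 3] => //; exact: le_trans H.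
Qed.

Lemma good_point_ae (omega : \bar R -> \bar R) :
  (forall s, 0 <= s -> omega s%:E = (w s)%:E) ->
  abs_continuous_on a b f -> abs_continuous_on a b g -> abs_continuous_on a b h ->
  {ae mu, forall t, t \in `]a, b[%R -> [/\ derivable f t 1, derivable g t 1,
     derivable h t 1 & derive1 h t = 2 * (derive1 f t * g t - f t * derive1 g t)]} ->
  {ae mu, forall t, t \in `[a, b]%R -> L1w_differentiable a b m.-1 omega (derive1 f) t} ->
  {ae mu, forall t, t \in `[a, b]%R -> L1w_differentiable a b m.-1 omega (derive1 g) t} ->
  {ae mu, forall x, x \in `[a, b]%R -> exists K p q, 0 < K /\ good_point K x p q}.
Proof.
move=> omegaE fAC gAC hAC hD hf hg.
have fD : {ae mu, forall t, t \in `]a, b[%R -> derivable f t 1}.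
  by apply: ae_imp hD => t Ht /Ht[ft _ _ _].
have gD : {ae mu, forall t, t \in `]a, b[%R -> derivable g t 1}.
  by apply: ae_imp hD => t Ht /Ht[_ gt _ _].
have nondeg u : {ae mu, forall x, ~ exists (p : {poly R}) (K : R), [/\ (size p <= m.+1)%N,
    0 < K, taylor_point m w u p K x, (deriv p).[x] = 0 & deriv p != 0]}.
  by apply: negligibleS (degenerate_negligible m0 wP u) => x /= /contrapT.
apply: ae_imp (ae_and (ae_and hf hg) (ae_and (nondeg f) (nondeg g))).
move=> x [[Hf Hg] [nf ng]] xab.
have [p [K1 [r1 [sp px K10 [r10 B1 O1]]]]] := L1w_osculates m0 omegaE fAC fD (Hf xab).
have [q [K2 [r2 [sq qx K20 [r20 B2 O2]]]]] := L1w_osculates m0 omegaE gAC gD (Hg xab).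
pose T1 := K1 * 2 * 2 ^+ m; pose T2 := K2 * 2 * 2 ^+ m.
have two0 : 0 < 2 ^+ m :> R by rewrite exprn_gt0.
have T10 : 0 < T1 by rewrite !mulr_gt0.
have T20 : 0 < T2 by rewrite !mulr_gt0.
pose I := T1 + T2.
have [Bp Bp0 HBp] := abs_continuous_bounded (abs_continuous_horner a b (deriv p)).
have [Bq Bq0 HBq] := abs_continuous_bounded (abs_continuous_horner a b (deriv q)).
pose B := Bp + Bq.
pose r := r1^-1 + r2^-1.
have r0 : 0 < r by rewrite addr_gt0// invr_gt0.
pose S (p : {poly R}) := \sum_(k < m.+1) `|(derivn k p).[x]|.
have S0 (u : {poly R}) : 0 <= S u by apply: sumr_ge0.
(* One constant meeting all requirements. The summand [2 * r] makes [K^-1] at most half of both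
   radii; the last two bound the speeds from below and are 0 where the speed vanishes. *)
pose K := S p + S q + `|h x| + I + 2 * r + 8 * I * B + 4 * I * I
  + `|(deriv p).[x]|^-1 + `|(deriv q).[x]|^-1.
have I0 : 0 < I by rewrite addr_gt0.
have B0 : 0 <= B by rewrite addr_ge0.
have IB0 : 0 <= 8 * I * B by rewrite !mulr_ge0// ltW.
have II0 : 0 <= 4 * I * I by rewrite !mulr_ge0// ltW.
have V0 (y : R) : 0 <= `|y|^-1 by rewrite invr_ge0.
have Sp := S0 p; have Sq := S0 q; have Vp := V0 (deriv p).[x]; have Vq := V0 (deriv q).[x].
have hx0 := normr_ge0 (h x).
have K0 : 0 < K by rewrite /K; lra.
have KV z : `|z - x| < K^-1 -> 2 * `|z - x| < r1 /\ 2 * `|z - x| < r2.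
  have E1 : r1^-1 <= r by rewrite lerDl invr_ge0 ltW.
  have E2 : r2^-1 <= r by rewrite lerDr invr_ge0 ltW.
  have D0 := normr_ge0 (z - x).
  move=> zK.
  have zr : `|z - x| * (2 * r) < 1.
    have rK : 2 * r <= K by rewrite /K; lra.
    apply: le_lt_trans (ler_wpM2l D0 rK) _.
    by move: zK; rewrite -ltr_pdivlMr// mul1r.
  have D1 := ler_wpM2l D0 E1; have D2 := ler_wpM2l D0 E2.
  by split; rewrite -[ltRHS]mul1r -ltr_pdivrMr//; lra.
have jets (u : {poly R}) k : (size u <= m.+1)%N -> `|(derivn k u).[x]| <= S u.
  move=> su; have [km|mk] := ltnP k m.+1.
    by rewrite /S (bigD1 (Ordinal km))//= lerDl; apply: sumr_ge0.
  by rewrite derivn_poly0 ?horner0 ?normr0// (leq_trans su).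
have K1I : K1 * 2 * 2 ^+ m <= I by rewrite /I /T1 lerDl ltW.
have K2I : K2 * 2 * 2 ^+ m <= I by rewrite /I /T2 lerDr ltW.
have IK : I <= K by rewrite /K; lra.
have taylor u (v : {poly R}) (K' r' : R) : K' * 2 * 2 ^+ m <= I -> abs_continuous_on a b u -> u x = v.[x] ->
    ball x r' `<=` `]a, b[ -> 0 < K' ->
    (forall rho, 0 < rho -> rho < r' -> osculates u v x rho (K' * (w rho * rho ^+ m))) ->
    (forall z, `|z - x| < K^-1 -> 2 * `|z - x| < r') -> taylor_point m w u v K x.
  move=> K'I uAC ux Bu K'0 Ou Hr' z zK.
  apply: le_trans (osculates_taylor wP uAC ux Bu K'0 Ou (Hr' z zK)) _.
  apply: ler_wpM2r; last exact: le_trans K'I IK.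
  exact: modulus_expr_ge0.
have tp : taylor_point m w f p K x.
  by apply: taylor K1I _ _ B1 _ O1 _ => // z /KV[].
have tq : taylor_point m w g q K x.
  by apply: taylor K2I _ _ B2 _ O2 _ => // z /KV[].
exists K, p, q; split => //; split => //.
- by move=> k; apply: le_trans (jets _ k sp) _; rewrite /K; lra.
- by move=> k; apply: le_trans (jets _ k sq) _; rewrite /K; lra.
- by rewrite /K; lra.
- move=> z eta; rewrite le_eqVlt => /predU1P[xz _|xz zK].
    subst z; have -> : eta = 0 by rewrite /eta subrr modulus0 ?mul0r.
    rewrite px qx (_ : h x - h x - _ - _ = 0); last by ring.
    by rewrite normr0 mulr0 mul0r.
  have zx0 : 0 < z - x by rewrite subr_gt0.
  have [R1 R2] : 2 * (z - x) < r1 /\ 2 * (z - x) < r2.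
    by have := KV z; rewrite gtr0_norm//; exact.
  have d20 : 0 < 2 * (z - x) by rewrite mulr_gt0.
  have eta0 : 0 <= eta by apply: modulus_expr_ge0; exact: ltW.
  pose J := w (2 * (z - x)) * (2 * (z - x)) ^+ m.
  have J0 : 0 <= J by apply: modulus_expr_ge0; exact: ltW.
  have Jeta : J <= 2 * 2 ^+ m * eta.
    rewrite /J /eta exprMn; have := modulus_double wP (ltW zx0).
    set e := (z - x) ^+ m; have e0 : 0 <= e by rewrite exprn_ge0// ltW.
    have t0 : 0 <= 2 ^+ m * e by rewrite mulr_ge0// ltW.
    by move=> /(ler_wpM2l t0); lra.
  have bnd K' : 0 < K' -> K' * 2 * 2 ^+ m <= I -> K' * J <= I * eta.
    move=> K'0 K'I; apply: le_trans (ler_wpM2l (ltW K'0) Jeta) _.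
    rewrite [leLHS](_ : _ = K' * 2 * 2 ^+ m * eta); last by ring.
    exact: ler_wpM2r.
  have oscW u (v : {poly R}) (rho I1 I2 : R) : I1 <= I2 -> osculates u v x rho I1 -> osculates u v x rho I2.
    by move=> I12 [F [F1 F2 F3]]; exists F; split => // s t; exact: le_trans I12.
  have Of := oscW _ _ _ _ _ (bnd _ K10 K1I) (O1 _ d20 R1).
  have Og := oscW _ _ _ _ _ (bnd _ K20 K2I) (O2 _ d20 R2).
  (* For constant [p] and [q] the speed bound in [area_estimate] can be taken to be 0, which removes
     the term linear in [z - x], as [good_area] demands. *)
  pose B' := if (deriv p == 0) && (deriv q == 0) then 0 else B.
  have B'0 : 0 <= B' by rewrite /B'; case: ifP.
  have HB' t : a <= t -> t <= b -> `|(deriv p).[t]| <= B' /\ `|(deriv q).[t]| <= B'.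
    rewrite /B'; case: ifP => [/andP[/eqP -> /eqP ->]|_] at_ tb.
      by rewrite horner0 normr0.
    split; first by apply: le_trans (HBp t at_ tb) _; rewrite lerDl.
    by apply: le_trans (HBq t at_ tb) _; rewrite lerDr.
  have Bab : ball x (2 * (z - x)) `<=` `]a, b[.
    by apply: subset_trans B1; apply: le_ball; exact: ltW.
  have Bz : ball x (2 * (z - x)) z by rewrite /ball/= distrC gtr0_norm//; lra.
  apply: le_trans (area_estimate fAC gAC hAC hD (esym px) (esym qx) Bab Of Og B'0 HB' (ltW xz) Bz) _.
  set L := if _ then _ else _.
  have -> : 8 * (I * eta) * B' * (z - x) = 8 * I * B * eta * L.
    by rewrite /L /B'; case: ifP => _; ring.
  have L0 : 0 <= L by rewrite /L; case: ifP => // _; exact: ltW.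
  have -> : 4 * (I * eta) * (I * eta) = 4 * I * I * (eta * eta) by ring.
  have -> : K * eta * (L + eta) = K * (eta * L) + K * (eta * eta) by ring.
  rewrite -(mulrA _ eta L); apply: lerD; apply: ler_wpM2r.
  - by rewrite mulr_ge0.
  - by rewrite /K; lra.
  - by rewrite mulr_ge0.
  - by rewrite /K; lra.
(* If both derivatives vanish at [x], they vanish identically, since [x] avoids the two negligible
   sets of degenerate points. *)
have [px0|px0] := eqVneq (deriv p).[x] 0; last first.
  constructor 2; rewrite -[leRHS]invrK lef_pV2 ?posrE ?invr_gt0 ?normr_gt0//.
  by rewrite /K; lra.
have [qx0|qx0] := eqVneq (deriv q).[x] 0; last first.
  constructor 3; rewrite -[leRHS]invrK lef_pV2 ?posrE ?invr_gt0 ?normr_gt0//.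
  by rewrite /K; lra.
constructor 1; split; apply/eqP; apply: contrapT => /negP d0.
  by apply: nf; exists p, K.
by apply: ng; exists q, K.
Qed.

End GoodPoints.

(** * Area on the unit interval *)

Section Flat.
Variable R : realType.
Implicit Types (p q r : {poly R}) (c : R).

Definition flat n c p := forall k, (k < n)%N -> (derivn k p).[c] = 0.

Lemma flatS n c p : flat n.+1 c p <-> p.[c] = 0 /\ flat n c (deriv p).
Proof.
split=> [H|[p0 H] [|k]]; last by rewrite derivSn; exact: H.
  by split=> [|k kn]; [exact: (H 0%N)|rewrite -derivSn; exact: H].
by [].
Qed.

Lemma flatW n k c p : (k <= n)%N -> flat n c p -> flat k c p.
Proof. by move=> kn H j jk; apply: H; exact: leq_trans kn. Qed.

Lemma flatD n c p q : flat n c p -> flat n c q -> flat n c (p + q).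
Proof. by move=> Hp Hq k kn; rewrite derivnD hornerD Hp// Hq// addr0. Qed.

Lemma flatZ n c l p : flat n c p -> flat n c (l *: p).
Proof. by move=> Hp k kn; rewrite derivnZ hornerZ Hp// mulr0. Qed.

Lemma flatMr n c p q : flat n c p -> flat n c (p * q).
Proof.
elim: n p q => [//|n IH] p q Hp; have /flatS[p0 Hp'] := Hp.
apply/flatS; rewrite hornerM p0 mul0r; split => //; rewrite derivM.
by apply: flatD; apply: IH => //; exact: flatW Hp.
Qed.

Lemma flatMl n c p q : flat n c q -> flat n c (p * q).
Proof. by rewrite mulrC; exact: flatMr. Qed.

Lemma flat_XsubC n c : flat n c (('X - c%:P) ^+ n).
Proof.
elim: n => [//|n IH]; apply/flatS; split.
  by rewrite horner_exp !hornerE subrr expr0n.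
by rewrite deriv_exp derivXsubC mul1r -mulr_natr; exact: flatMr.
Qed.

Lemma flat_horner n c p : flat n.+1 c p -> p.[c] = 0.
Proof. by move/flatS => []. Qed.

Lemma flat_horner_eq n c p q : flat n c p ->
  forall k, (k < n)%N -> (derivn k (q + p)).[c] = (derivn k q).[c].
Proof. by move=> Hp k kn; rewrite derivnD hornerD Hp// addr0. Qed.

End Flat.

Section UnitInterval.
Variable R : realType.
Implicit Types (p q r F G S T : {poly R}) (c d e : R).

Lemma prim_deriv p : prim (deriv p) = p - (p.[0])%:P.
Proof.
apply/polyP => -[|i]; rewrite coef_prim coefD coefN coefC /=.
  by rewrite invr0 mulr0 horner_coef0 subrr.
by rewrite subr0 coef_deriv -[X in X / _]mulr_natr mulfK// pnatr_eq0.
Qed.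

Lemma primB p q : prim (p - q) = prim p - prim q.
Proof. by rewrite -scaleN1r primD primZ scaleN1r. Qed.

(** Both [e q - p q] and [e q + p q] are nonnegative on the unit interval, and by the mean value
    theorem so are their primitives at 1. *)
Lemma prim_weighted_bound p q e : (forall s, 0 <= s <= 1 -> `|p.[s]| <= e) ->
  (forall s, 0 <= q.[s]) -> `|(prim (p * q)).[1]| <= e * (prim q).[1].
Proof.
move=> pe q0.
have nonneg r : (forall s, 0 <= s <= 1 -> 0 <= r.[s]) -> 0 <= (prim r).[1].
  by have [s /andP[s0 s1] ->] := prim_mvt r; apply; rewrite !ltW.
have H1 : 0 <= (prim (e *: q - p * q)).[1].
  apply: nonneg => s s01; rewrite !hornerE -mulrBl mulr_ge0// subr_ge0.
  by have := pe s s01; rewrite ler_norml => /andP[].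
have H2 : 0 <= (prim (e *: q + p * q)).[1].
  apply: nonneg => s s01; rewrite !hornerE -mulrDl mulr_ge0//.
  by have := pe s s01; rewrite ler_norml lerNl -subr_ge0 opprK addrC => /andP[].
rewrite primB primZ !hornerE in H1; rewrite primD primZ !hornerE in H2.
by rewrite ler_norml; apply/andP; split; lra.
Qed.

Definition unit_area F G : R := (area F G).[1].

Lemma unit_areaE F G : unit_area F G = (prim (deriv F * G - F * deriv G)).[1].
Proof. by []. Qed.

(* S and T vanish at 0, so integrating by parts leaves boundary terms at 1 only. *)
Lemma unit_area_perturb F G S T : S.[0] = 0 -> T.[0] = 0 ->
  unit_area (F + S) (G + T) = unit_area F G + (S.[1] * G.[1] - F.[1] * T.[1])
    + 2 * (prim (deriv F * T - S * deriv G)).[1] + unit_area S T.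
Proof.
move=> S0 T0; rewrite !unit_areaE !derivD.
have -> : (deriv F + deriv S) * (G + T) - (F + S) * (deriv G + deriv T) =
  (deriv F * G - F * deriv G) + deriv (S * G - F * T) +
  2 *: (deriv F * T - S * deriv G) + (deriv S * T - S * deriv T).
  by rewrite derivB !derivM -mul_polyC polyC_natr; ring.
have K r1 r2 r3 r4 : (prim (r1 + deriv r2 + 2 *: r3 + r4)).[1] =
    (prim r1).[1] + (r2.[1] - r2.[0]) + 2 * (prim r3).[1] + (prim r4).[1].
  by rewrite !primD primZ prim_deriv !hornerD hornerN hornerZ hornerC.
rewrite K (_ : _.[1] - _.[0] = S.[1] * G.[1] - F.[1] * T.[1])//.
by rewrite !hornerE S0 T0; ring.
Qed.

Lemma unit_area_bound n F G : (size F <= n)%N -> (size G <= n)%N ->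
  `|unit_area F G| <= 2 * n%:R * (pnorm F * pnorm G).
Proof.
move=> Fn Gn; rewrite unit_areaE; apply: le_trans (pnorm_prim _) _.
apply: le_trans (pnormB _ _) _.
have H1 := pnormM (deriv F) G; have H2 := pnormM F (deriv G).
have H3 := ler_wpM2r (pnorm_ge0 G) (pnorm_deriv Fn).
have H4 := ler_wpM2l (pnorm_ge0 F) (pnorm_deriv Gn).
lra.
Qed.

Lemma unit_areaC F G : unit_area G F = - unit_area F G.
Proof.
rewrite !unit_areaE (_ : _ - _ = -1 *: (deriv F * G - F * deriv G)).
  by rewrite primZ hornerZ mulN1r.
by rewrite scaleN1r; ring.
Qed.

Lemma unit_area_rescale x l p q :
  unit_area (rescale x l p) (rescale x l q) = (area p q).[x + l] - (area p q).[x].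
Proof.
rewrite unit_areaE.
have -> : deriv (rescale x l p) * rescale x l q - rescale x l p * deriv (rescale x l q)
  = deriv (rescale x l (area p q)).
  rewrite !deriv_rescale deriv_area /rescale rmorphB !rmorphM/= -!mul_polyC; ring.
by rewrite prim_deriv !hornerE !horner_rescale mulr0 mulr1 addr0.
Qed.

(** The root with the sign of [l] is taken. Then [l * s] is nonnegative, so the size of [s] is
    controlled by [d] and [k] alone, however large [l] is. *)
Lemma quadratic_root (k l d : R) : 0 < k -> 0 <= d ->
  exists2 s, k * s ^+ 2 + l * s = d & k * s ^+ 2 <= d.
Proof.
move=> k0 d0.
set D := l ^+ 2 + 4 * k * d.
have kd : 0 <= 4 * k * d by rewrite !mulr_ge0// ltW.
have D0 : 0 <= D by rewrite addr_ge0// sqr_ge0.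
have sD : `|l| <= Num.sqrt D by rewrite -sqrtr_sqr ler_wsqrtr// lerDl.
have sq := sqr_sqrtr D0.
have k2 : k != 0 by rewrite gt_eqF.
suff [s Hs ls] : exists2 s, k * s ^+ 2 + l * s = d & 0 <= l * s.
  by exists s => //; lra.
have [l0|l0] := leP 0 l.
  exists ((- l + Num.sqrt D) / (2 * k)).
    rewrite (_ : _ + _ = (Num.sqrt D ^+ 2 - l ^+ 2) / (4 * k)); last by field.
    by rewrite sq /D; field.
  rewrite mulr_ge0// divr_ge0//; last by rewrite mulr_ge0// ltW.
  by rewrite addrC subr_ge0; apply: le_trans sD; exact: ler_norm.
exists ((- l - Num.sqrt D) / (2 * k)).
  rewrite (_ : _ + _ = (Num.sqrt D ^+ 2 - l ^+ 2) / (4 * k)); last by field.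
  by rewrite sq /D; field.
rewrite (_ : l * _ = - l * ((l + Num.sqrt D) / (2 * k))); last by field.
apply: mulr_ge0; first by rewrite oppr_ge0 ltW.
apply: divr_ge0; last by rewrite mulr_ge0// ltW.
have := ler_norm (- l); rewrite normrN; lra.
Qed.

Lemma bump_exists n : exists z : {poly R}, [/\ flat n 0 z, flat n 1 z,
  forall s, 0 <= z.[s] & forall s, 0 < s < 1 -> 0 < z.[s]].
Proof.
pose y : {poly R} := ('X - 0%:P) ^+ n * ('X - 1%:P) ^+ n.
exists (y ^+ 2); split.
- by rewrite expr2; do 2 apply: flatMr; exact: flat_XsubC.
- by rewrite expr2; apply: flatMr; apply: flatMl; exact: flat_XsubC.
- by move=> s; rewrite horner_exp sqr_ge0.
move=> s /andP[s0 s1]; rewrite horner_exp lt0r sqr_ge0 andbT expf_neq0//.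
rewrite hornerM !horner_exp !hornerE subr0 mulf_neq0// expf_neq0//.
  by rewrite gt_eqF.
by rewrite subr_eq0 lt_eqF.
Qed.

Lemma prim_gt0 r : (forall s, 0 < s < 1 -> 0 < r.[s]) -> 0 < (prim r).[1].
Proof. by move=> H; have [s s01 ->] := prim_mvt r; exact: H. Qed.

(** The primitive of a bump, normalised to take the value 1 at 1. Multiplying by [th] kills the jet
    of a polynomial at 0 and keeps it at 1. *)
Lemma smoothstep_exists n : exists th : {poly R}, flat n.+1 0 th /\ flat n.+1 1 (th - 1).
Proof.
have [z [z0 z1 _ zp]] := bump_exists n.
have c0 := prim_gt0 zp; set c := (prim z).[1] in c0.
exists (c^-1 *: prim z); split; apply/flatS; split.
- by rewrite hornerZ prim0 mulr0.
- by rewrite derivZ deriv_prim; exact: flatZ.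
- by rewrite !hornerE mulVf ?subrr// gt_eqF.
by rewrite derivB -polyC1 derivC subr0 derivZ deriv_prim; exact: flatZ.
Qed.

(* S = s z and T = +-s X z sweep an area -+s^2 \int z^2, while their interaction
   with F and G is linear in s: s is a root of a quadratic equation. *)
Lemma area_correction_quadratic n : exists (N : nat) (C : R), 0 < C /\ forall F G d e,
  0 <= e -> `|d| <= e ^+ 2 -> exists S T, [/\ flat n.+1 0 S /\ flat n.+1 1 S,
    flat n.+1 0 T /\ flat n.+1 1 T, (size S <= N)%N /\ (size T <= N)%N,
    pnorm S <= C * e /\ pnorm T <= C * e &
    unit_area (F + S) (G + T) = unit_area F G + d].
Proof.
have [z [z0 z1 _ zp]] := bump_exists n.+1.
have k0 : 0 < (prim (z ^+ 2)).[1].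
  by apply: prim_gt0 => s /zp zs; rewrite horner_exp exprn_gt0.
set k := (prim (z ^+ 2)).[1] in k0.
(* This avoids a square root: [k^-1 <= B ^+ 2], so s^2 <= k^-1 e^2 implies |s| <= B e. *)
pose B := k^-1 + 1.
have kV0 : 0 < k^-1 by rewrite invr_gt0.
have B0 : 0 < B by rewrite addr_gt0.
have A0 : unit_area z ('X * z) = - k.
  rewrite unit_areaE derivM derivX.
  have -> : deriv z * ('X * z) - z * (1 * z + 'X * deriv z) = -1 *: z ^+ 2.
    by rewrite scaleN1r; ring.
  by rewrite primZ hornerZ mulN1r.
exists (maxn (size z) (size ('X * z)%R)), (B * (pnorm z + pnorm ('X * z) + 1)).
have pz := pnorm_ge0 z; have pXz := pnorm_ge0 ('X * z).
split; first by apply: mulr_gt0 => //; lra.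
move=> F G d e e0 de.
(* The pair [z], ['X * z] sweeps the negative area [- k]; this sign gives the swept area the sign of
   [d]. *)
pose sg : R := if 0 <= d then -1 else 1.
have sg2 : sg * sg = 1 by rewrite /sg; case: ifP; rewrite ?mulrNN mulr1.
have dE : `|d| = - sg * d.
  rewrite /sg; case: ifPn => [d0|]; first by rewrite opprK mul1r ger0_norm.
  by rewrite -ltNge mulN1r => /ltr0_norm.
pose l := 2 * (prim (deriv F * ('X * z) - sg *: (z * deriv G))).[1].
have [s Hs ks] := quadratic_root (- l) k0 (normr_ge0 d).
have sB : `|s| <= B * e.
  rewrite -(ler_pXn2r (n:=2))// ?nnegrE ?normr_ge0// ?mulr_ge0// ?(ltW B0)//.
  rewrite real_normK ?num_real// exprMn.
  have : s ^+ 2 <= k^-1 * e ^+ 2 by rewrite mulrC ler_pdivlMr// mulrC; exact: le_trans de.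
  move=> /le_trans; apply; apply: ler_wpM2r; first exact: sqr_ge0.
  by rewrite /B; have := sqr_ge0 (k^-1); rewrite sqrrD mulr1 expr1n; lra.
exists (s *: z), ((sg * s) *: ('X * z)).
have zn0 : flat n.+1 0 z by exact: flatW z0.
have zn1 : flat n.+1 1 z by exact: flatW z1.
have sgn : `|sg| = 1 by rewrite /sg; case: ifP; rewrite ?normrN1 ?normr1.
split.
- by split; exact: flatZ.
- by split; apply: flatZ; exact: flatMl.
- by split; rewrite (leq_trans (size_scale_leq _ _)) ?leq_maxl ?leq_maxr.
- have Be0 : 0 <= B * e by rewrite mulr_ge0// ltW.
  have H1 := ler_wpM2r pz sB; have H2 := ler_wpM2r pXz sB.
  have H3 := mulr_ge0 Be0 pz; have H4 := mulr_ge0 Be0 pXz.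
  by rewrite !pnormZ normrM sgn mul1r; split; lra.
have z00 := flat_horner z0; have z11 := flat_horner z1.
have S0 : (s *: z).[0] = 0 by rewrite hornerZ z00 mulr0.
have T0 : ((sg * s) *: ('X * z)).[0] = 0 by rewrite hornerZ hornerM hornerX mul0r mulr0.
rewrite unit_area_perturb//.
have -> : unit_area (s *: z) ((sg * s) *: ('X * z)) = - (sg * k) * s ^+ 2.
  rewrite unit_areaE !derivZ.
  have -> : (s *: deriv z) * ((sg * s) *: ('X * z)) - (s *: z) * ((sg * s) *: deriv ('X * z))
    = (sg * s ^+ 2) *: (deriv z * ('X * z) - z * deriv ('X * z)).
    by rewrite -!mul_polyC !polyCM; ring.
  by rewrite primZ hornerZ -unit_areaE A0; ring.
have -> : deriv F * ((sg * s) *: ('X * z)) - s *: z * deriv G =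
   (sg * s) *: (deriv F * ('X * z) - sg *: (z * deriv G)).
  rewrite scalerBr scalerA [sg * s * sg]mulrAC sg2 mul1r.
  by rewrite -scalerAr -scalerAl.
have S1 : (s *: z).[1] = 0 by rewrite hornerZ z11 mulr0.
have T1 : ((sg * s) *: ('X * z)).[1] = 0 by rewrite hornerZ hornerM z11 !mulr0.
rewrite S1 T1 mul0r mulr0 subrr addr0 primZ hornerZ.
have -> : 2 * (sg * s * (prim (deriv F * ('X * z) - sg *: (z * deriv G))).[1]) = sg * (l * s).
  by rewrite /l; ring.
rewrite dE in Hs; have : sg * (sg * d) = d by rewrite mulrA sg2 mul1r.
rewrite -addrA; move=> H; congr (_ + _).
have -> : sg * (l * s) + - (sg * k) * s ^+ 2 = - sg * (k * s ^+ 2 + - l * s) by ring.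
by rewrite Hs -[RHS]H; ring.
Qed.

(** Perturbing only [G] by [t *: z] leaves no quadratic term: the area changes by 2 t times the
    integral of F' z. As F' stays within c / 2 of a value of modulus at least [c], this integral is
    at least half of [c] times that of [z] in modulus, and the equation is solved for [t]. *)
Lemma area_correction_linear n : exists (N : nat) (C : R), 0 < C /\ forall F G c d e,
  0 < c -> 0 <= e -> `|d| <= c * e -> c <= `|(deriv F).[0]| ->
  (forall s, 0 <= s <= 1 -> `|(deriv F).[s] - (deriv F).[0]| <= c / 2) ->
  exists T, [/\ flat n.+1 0 T, flat n.+1 1 T, (size T <= N)%N, pnorm T <= C * e &
    unit_area F (G + T) = unit_area F G + d].
Proof.
have [z [z0 z1 zge0 zp]] := bump_exists n.+1.
have k0 := prim_gt0 zp; set k := (prim z).[1] in k0.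
have pz := pnorm_ge0 z.
exists (size z), ((pnorm z + 1) / k); split; first by rewrite divr_gt0// ltr_wpDl.
move=> F G c d e c0 e0 de cF Fc.
pose I := (prim (deriv F * z)).[1].
have IE : I = (deriv F).[0] * k + (prim ((deriv F - (deriv F).[0]%:P) * z)).[1].
  by rewrite mulrBl primB mul_polyC primZ hornerD hornerN hornerZ -/k -/I addrC subrK.
have Ib : c / 2 * k <= `|I|.
  have H : `|(prim ((deriv F - (deriv F).[0]%:P) * z)).[1]| <= c / 2 * k.
    apply: prim_weighted_bound => // s s01; rewrite !hornerE; exact: Fc.
  have := ler_wpM2r (ltW k0) cF.
  have := lerB_normD ((deriv F).[0] * k) (prim ((deriv F - (deriv F).[0]%:P) * z)).[1].
  rewrite -IE normrM (gtr0_norm k0); lra.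
have ck : 0 < c / 2 * k by rewrite mulr_gt0// divr_gt0.
have I0 : 0 < `|I| by exact: lt_le_trans Ib.
have In0 : I != 0 by rewrite -normr_gt0.
have zn0 : flat n.+1 0 z by exact: flatW z0.
have zn1 : flat n.+1 1 z by exact: flatW z1.
pose t := d / (2 * I).
exists (t *: z); split; try exact: flatZ.
- exact: size_scale_leq.
- rewrite pnormZ.
  have tk : `|t| * k <= e.
    rewrite /t normrM normfV normrM (ger0_norm (ler0n _ 2)) mulrAC ler_pdivrMr ?mulr_gt0//.
    have := ler_wpM2r (ltW k0) de; have := ler_wpM2l e0 Ib; lra.
  have te : `|t| <= e / k by rewrite ler_pdivlMr.
  have := ler_wpM2r pz te; have : 0 <= e / k by rewrite divr_ge0// ltW.
  have -> : (pnorm z + 1) / k * e = e / k * pnorm z + e / k by ring.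
  lra.
have z00 := flat_horner z0; have z11 := flat_horner z1.
have prim00 : prim (0 : {poly R}) = 0 by apply/polyP => i; rewrite coef_prim !coef0 mul0r.
have T0 : (t *: z).[0] = 0 by rewrite hornerZ z00 mulr0.
have T1 : (t *: z).[1] = 0 by rewrite hornerZ z11 mulr0.
have A00 : unit_area 0 (t *: z) = 0.
  by rewrite unit_areaE deriv0 !mul0r subr0 prim00 horner0.
have := @unit_area_perturb F G 0 (t *: z) (horner0 _) T0.
rewrite addr0 T1 A00 horner0 mul0r mulr0 subrr addr0 mul0r subr0 addr0 => ->.
rewrite -scalerAr primZ hornerZ -/I /t; congr (_ + _).
by field.
Qed.

End UnitInterval.

(** * Filling a gap *)

Section GapFilling.
Variable R : realType.
Implicit Types (p q r u v : {poly R}) (x l : R).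

Lemma pnorm_rescale_bound n r x l L K : (size r <= n)%N -> `|l| <= L ->
  (forall k, `|(derivn k r).[x]| <= K) ->
  pnorm (rescale x l r) <= n%:R * ((1 + L) ^+ n * K).
Proof.
move=> rn lL HK.
have L0 : 0 <= L by exact: le_trans lL.
rewrite (pnormE (size_rescale x l rn)).
apply: (@le_trans _ _ (\sum_(i < n) (1 + L) ^+ n * K)); last first.
  by rewrite sumr_const card_ord -[leLHS]mulr_natl.
apply: ler_sum => i _.
apply: (@le_trans _ _ (`|(derivn i (rescale x l r)).[0]|)).
  rewrite horner_coef0 coef_derivn addn0 ffactnn normrMn -[leRHS]mulr_natl.
  by rewrite ler_peMl// ler1n fact_gt0.
rewrite derivn_rescale hornerZ horner_rescale mulr0 addr0 normrM normrX.
apply: ler_pM => //.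
apply: (@le_trans _ _ ((1 + L) ^+ i)).
  by rewrite lerXn2r ?nnegrE//; lra.
by apply: ler_weXn2l; [lra|exact: ltnW].
Qed.

Lemma rescaleB x l p q : rescale x l (p - q) = rescale x l p - rescale x l q.
Proof. by rewrite /rescale rmorphB. Qed.

Lemma rescaleK x l r : l != 0 -> rescale x l (rescale (- (x / l)) l^-1 r) = r.
Proof.
move=> l0; rewrite /rescale -comp_polyA.
rewrite (_ : (l^-1 *: 'X + (- (x / l))%:P) \Po (l *: 'X + x%:P) = 'X) ?comp_polyXr//.
rewrite comp_polyD comp_polyZ comp_polyX comp_polyC scalerDr scalerA mulVf// scale1r.
by rewrite -mul_polyC -polyCM polyCN (mulrC x) addrK.
Qed.

Lemma horner_sub_bound r s : 0 <= s <= 1 -> `|r.[s] - r.[0]| <= pnorm (deriv r).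
Proof.
move=> /andP[s0 s1].
have [|c] := @MVT_segment R (horner r) (horner (deriv r)) 0 s s0.
- by apply: continuous_subspaceT => t; exact: continuous_horner.
rewrite in_itv/= => /andP[c0 cs] ->; rewrite normrM subr0 (ger0_norm s0).
apply: (@le_trans _ _ `|(deriv r).[c]|); first by rewrite ler_piMr.
by apply: horner_pnorm; rewrite ger0_norm//; exact: le_trans s1.
Qed.

Variables (a b : R) (m : nat) (w : R -> R).
Hypotheses (m0 : (0 < m)%N) (wP : modulus w) (ab : a <= b).
Variables (f g h : R -> R) (K : R).
Hypothesis K0 : 0 < K.
Let L := b - a.
Let eta l := w l * l ^+ m.
Let good x p q := good_point m w f g h K x p q.

Let L0 : 0 <= L. Proof. by rewrite subr_ge0. Qed.

(** Two kinds of bounds on the rescaled data: [B] comes from the jet bounds and the length of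
    [[a, b]], and holds on every gap; [CP] comes from the Taylor estimates, which compare the two
    nodes only if they are closer than [K^-1]. *)
Lemma gap_increment : exists (B CP : R), [/\ 0 < B, 0 < CP &
  forall x y p q p2 q2 (l := y - x), good x p q -> good y p2 q2 ->
  a <= x -> x < y -> y <= b ->
  [/\ [/\ pnorm (rescale x l p) <= B, pnorm (rescale x l (deriv p)) <= B &
          pnorm (rescale x l (deriv (deriv p))) <= B],
      [/\ pnorm (rescale x l q) <= B, pnorm (rescale x l (deriv q)) <= B &
          pnorm (rescale x l (deriv (deriv q))) <= B],
      pnorm (rescale x l (p2 - p)) <= B /\ pnorm (rescale x l (q2 - q)) <= B &
      l < K^-1 -> pnorm (rescale x l (p2 - p)) <= CP * eta l /\
                  pnorm (rescale x l (q2 - q)) <= CP * eta l]].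
Proof.
have [C C0 HC] := @pnorm_le_horner R m.+1.
pose B1 : R := m.+1%:R * ((1 + L) ^+ m.+1 * K).
have B10 : 0 < B1 by rewrite !mulr_gt0// exprn_gt0// ltr_pwDl.
exists (B1 + C * (B1 + B1)), (C * (2 * K)).
have C2 : 0 < C * (B1 + B1) by rewrite mulr_gt0// addr_gt0.
split; [lra|by rewrite !mulr_gt0|].
move=> x y p q p2 q2 l gx gy ax xy yb.
have l0 : 0 < l by rewrite subr_gt0.
have lL : `|l| <= L by rewrite gtr0_norm// /l /L; lra.
have sd r : (size r <= m.+1)%N -> (size (deriv r) <= m.+1)%N.
  by move=> rm; rewrite (leq_trans (size_poly _ _))// (leq_trans (leq_pred _)).
have bnd r : (size r <= m.+1)%N -> (forall k, `|(derivn k r).[x]| <= K) ->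
    [/\ pnorm (rescale x l r) <= B1, pnorm (rescale x l (deriv r)) <= B1 &
        pnorm (rescale x l (deriv (deriv r))) <= B1].
  move=> rm rK; split.
  - exact: pnorm_rescale_bound.
  - by apply: pnorm_rescale_bound lL _; [exact: sd|move=> k; rewrite -derivSn; exact: rK].
  - apply: pnorm_rescale_bound lL _; first exact/sd/sd.
    by move=> k; rewrite -!derivSn; exact: rK.
have diffB r r2 : (size r <= m.+1)%N -> (size r2 <= m.+1)%N ->
    (forall k, `|(derivn k r).[x]| <= K) -> (forall k, `|(derivn k r2).[y]| <= K) ->
    pnorm (rescale x l (r2 - r)) <= C * (B1 + B1).
  move=> rm r2m rK r2K; apply: HC.
    by apply: size_rescale; rewrite (leq_trans (size_polyD _ _))// geq_max size_polyN r2m.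
  move=> s s01; rewrite rescaleB hornerD hornerN.
  apply: le_trans (ler_normB _ _) _; apply: lerD.
    (* The jet of [r2] is bounded at [y], so the gap is traversed backwards from there. *)
    have -> : (rescale x l r2).[s] = (rescale y (- l) r2).[1 - s].
      by rewrite !horner_rescale /l; congr (r2.[_]); ring.
    apply: le_trans (horner_pnorm _ _) _.
      by move: s01 => /andP[? ?]; rewrite ger0_norm; lra.
    by apply: pnorm_rescale_bound => //; rewrite normrN.
  have [H _ _] := bnd _ rm rK; apply: le_trans H; apply: horner_pnorm.
  by move: s01 => /andP[? ?]; rewrite ger0_norm.
have close r r2 (u : R -> R) : (size r <= m.+1)%N -> (size r2 <= m.+1)%N ->
    taylor_point m w u r K x -> taylor_point m w u r2 K y -> l < K^-1 ->
    pnorm (rescale x l (r2 - r)) <= C * (2 * K) * eta l.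
  move=> rm r2m Hr Hr2 lK; rewrite -(mulrA C); apply: HC.
    by apply: size_rescale; rewrite (leq_trans (size_polyD _ _))// geq_max size_polyN r2m.
  have ln : `|y - x| = l by rewrite gtr0_norm.
  have lK' : `|y - x| < K^-1 by rewrite ln.
  move=> s s01; rewrite horner_rescale.
  by have := taylor_points_close wP K0 lK' Hr Hr2 s01; rewrite ln.
have W (z : R) : z <= B1 -> z <= B1 + C * (B1 + B1) by lra.
have [p_1 p_2 p_3] := bnd _ (good_size_p gx) (good_jet_p gx).
have [q_1 q_2 q_3] := bnd _ (good_size_q gx) (good_jet_q gx).
have dp := diffB _ _ (good_size_p gx) (good_size_p gy) (good_jet_p gx) (good_jet_p gy).
have dq := diffB _ _ (good_size_q gx) (good_size_q gy) (good_jet_q gx) (good_jet_q gy).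
split.
- by split; exact: W.
- by split; exact: W.
- by split; lra.
move=> lK; split; first exact: close (good_size_p gx) (good_size_p gy) (good_taylor_p gx) (good_taylor_p gy) lK.
exact: close (good_size_q gx) (good_size_q gy) (good_taylor_q gx) (good_taylor_q gy) lK.
Qed.

End GapFilling.

Section ModulusPower.
Variables (R : realType) (m : nat) (w : R -> R).
Hypothesis wP : modulus w.

Lemma modulus_expr_le l l' : 0 <= l -> l <= l' -> w l * l ^+ m <= w l' * l' ^+ m.
Proof.
move=> l0 ll'; apply: ler_pM; [exact: modulus_ge0|exact: exprn_ge0|exact: modulus_le|].
by rewrite lerXn2r// nnegrE; exact: le_trans ll'.
Qed.

Lemma modulus_expr_lin l L : (0 < m)%N -> 0 <= l -> l <= L ->
  w l * l ^+ m <= w l * (1 + L) ^+ m * l.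
Proof.
move=> m0 l0 lL; rewrite -mulrA; apply: ler_wpM2l; first exact: modulus_ge0.
rewrite -{1}(prednK m0) exprSr; apply: ler_wpM2r => //.
apply: (@le_trans _ _ ((1 + L) ^+ m.-1)).
  by rewrite lerXn2r ?nnegrE//; lra.
by apply: ler_weXn2l; [lra|exact: leq_pred].
Qed.

End ModulusPower.

(* Below the threshold r, the velocity at the left node controls the velocity on
   the whole gap; above it, eta is bounded below, so that any quantity bounded in
   terms of K is O(eta^2). *)
Lemma gap_correction (R : realType) (a b : R) (m : nat) (w : R -> R) (f g h : R -> R)
    (K : R) : (0 < m)%N -> modulus w -> a <= b -> 0 < K ->
  exists (N : nat) (C : R), 0 < C /\
  forall (x y : R) (p q p2 q2 : {poly R}) (l := y - x) (eta := w l * l ^+ m),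
  good_point m w f g h K x p q -> good_point m w f g h K y p2 q2 ->
  a <= x -> x < y -> y <= b -> exists A B : {poly R},
  [/\ flat m.+1 0 A /\ flat m.+1 0 B,
      flat m.+1 1 (A - rescale x l (p2 - p)) /\ flat m.+1 1 (B - rescale x l (q2 - q)),
      (size A <= N)%N /\ (size B <= N)%N,
      pnorm A <= C * eta /\ pnorm B <= C * eta &
      2 * unit_area (rescale x l p + A) (rescale x l q + B) = h y - h x].
Proof.
move=> m0 wP ab K0; pose L := b - a.
have L0 : 0 <= L by rewrite subr_ge0.
have [th [th0 th1]] := smoothstep_exists R m.
have thv1 : th.[1] = 1.
  by have := flat_horner th1; rewrite hornerD hornerN hornerC => /eqP; rewrite subr_eq0 => /eqP.
have thv0 : th.[0] = 0 := flat_horner th0.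
have [Nq [Cq [Cq0 HCq]]] := area_correction_quadratic R m.
have [Nl [Cl [Cl0 HCl]]] := area_correction_linear R m.
have [B [CP [B0 CP0 Hinc]]] := gap_increment m wP ab f g h K0.
pose Th := pnorm th + 1.
have Th0 : 0 < Th by rewrite ltr_wpDl// pnorm_ge0.
pose n1 := (m.+1 + size th)%N.
have [nn nnE] : exists nn : R, nn = n1%:R by exists n1%:R.
have nn0 : 0 <= nn by rewrite nnE.
pose Cs := CP * Th.
have Cs0 : 0 < Cs by rewrite mulr_gt0.
(* Below [r1], the second derivative of the Taylor polynomial changes the rescaled velocity by at
   most l / (4 K), a quarter of its lower bound l / K. *)
pose r1 := (4 * K * (B + 1))^-1.
have r10 : 0 < r1 by rewrite invr_gt0 !mulr_gt0// ltr_wpDl// ltW.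
pose Lm := (1 + L) ^+ m.
have Lm0 : 0 < Lm by rewrite exprn_gt0// ltr_pwDl.
pose D1 := nn * Cs * Lm.
have D10 : 0 <= D1 by rewrite !mulr_ge0// ltW.
(* When w(l) < [ep], the Hermite correction adds at most another quarter to the variation of the
   velocity. *)
pose ep := (4 * K * (D1 + 1))^-1.
have ep0 : 0 < ep by rewrite invr_gt0 !mulr_gt0// ltr_wpDl.
have [del del0 Hdel] := modulus_small wP ep0.
pose r := Num.min K^-1 (Num.min r1 del).
have r0 : 0 < r by rewrite !lt_min invr_gt0 K0 r10.
(* The lower bound of eta on gaps of length at least [r]. There the crude bound [E2] on the defect
   is at most [E2 / er ^+ 2] times eta^2. *)
pose er := w r * r ^+ m.
have er0 : 0 < er by rewrite mulr_gt0// ?exprn_gt0// modulus_gt0.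
pose C1 := Cs + B * Th / er.
have BTer : 0 < B * Th / er by rewrite divr_gt0// mulr_gt0.
pose E3 := K + 4 * B * Cs + 2 * nn * (Cs * Cs).
have E30 : 0 < E3.
  have t1 : 0 <= 4 * B * Cs by rewrite !mulr_ge0// ltW.
  have t2 : 0 <= 2 * nn * (Cs * Cs) by rewrite !mulr_ge0// ltW.
  by rewrite /E3; lra.
pose B2 := B + B * Th.
pose E2 := K + 2 * nn * (B2 * B2).
have E20 : 0 <= E2.
  have t1 : 0 <= B2 by rewrite addr_ge0 ?mulr_ge0// ltW.
  have t2 : 0 <= 2 * nn * (B2 * B2) by rewrite !mulr_ge0.
  by rewrite /E2; lra.
have E2er : 0 <= E2 / er ^+ 2 by rewrite divr_ge0// sqr_ge0.
(* The summand 1 ensures [Eq <= Eq ^+ 2], so a defect bounded by Eq e^2 is also bounded by (Eq e)^2,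
   the form needed for the quadratic correction. *)
pose Eq := E3 + E2 / er ^+ 2 + 1.
have Eq0 : 0 < Eq by rewrite /Eq; lra.
pose W := w L * Lm.
have W0 : 0 <= W by rewrite mulr_ge0 ?(ltW Lm0)// modulus_ge0.
(* Since eta <= [W] l, the defect [E3] eta (l + eta) is at most (l / K) ([El] eta), with l / K the
   lower bound of the rescaled velocity. *)
pose El := K * E3 * (1 + W).
have El0 : 0 < El by rewrite !mulr_gt0// ltr_pwDl.
pose C2 := Cq * Eq + Cl * El.
have C2q : Cq * Eq <= C2 by rewrite lerDl mulr_ge0// ltW.
have C2l : Cl * El <= C2 by rewrite lerDr mulr_ge0// ltW.
have C20 : 0 < C2 by rewrite addr_gt0// mulr_gt0.
exists (n1 + Nq + Nl)%N, (C1 + C2); split; first by rewrite addr_gt0// addr_gt0.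
move=> x y p q p2 q2 l e gx gy ax xy yb.
have l0 : 0 < l by rewrite subr_gt0.
have lL : l <= L by rewrite /l /L; lra.
have xl : x + l = y by rewrite /l addrC subrK.
have [[p_1 p_2 p_3] [q_1 q_2 q_3] [dp dq] dsm] := Hinc _ _ _ _ _ _ gx gy ax xy yb.
rewrite -/l in p_1 p_2 p_3 q_1 q_2 q_3 dp dq dsm.
set P := rescale x l p in p_1 *; set Q := rescale x l q in q_1 *.
set U := rescale x l (p2 - p) in dp dsm *; set V := rescale x l (q2 - q) in dq dsm *.
have e0 : 0 < e by rewrite mulr_gt0 ?exprn_gt0// modulus_gt0.
rewrite -/e in dsm.
(* Hermite interpolation: [P + UT] has the jet of [P] at 0 and that of the rescaled [p2] at 1, up to
   order [m]. *)
pose UT := U * th; pose VT := V * th.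
have sU : (size U <= m.+1)%N.
  apply: size_rescale; rewrite (leq_trans (size_polyD _ _))// geq_max size_polyN.
  by rewrite (good_size_p gx) (good_size_p gy).
have sV : (size V <= m.+1)%N.
  apply: size_rescale; rewrite (leq_trans (size_polyD _ _))// geq_max size_polyN.
  by rewrite (good_size_q gx) (good_size_q gy).
have sT (u : {poly R}) : (size u <= m.+1)%N -> (size (u * th)%R <= n1)%N.
  move=> su; rewrite (leq_trans (size_polyMleq _ _))// /n1.
  by rewrite (leq_trans (leq_pred _))// leq_add2r.
have sUT := sT _ sU; have sVT := sT _ sV.
have nT (u : {poly R}) c : pnorm u <= c -> pnorm (u * th) <= c * Th.
  move=> uc; apply: le_trans (pnormM _ _) _; apply: ler_pM; rewrite ?pnorm_ge0//.
  by rewrite lerDl.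
have UTB := nT _ _ dp; have VTB := nT _ _ dq; rewrite -/UT -/VT in UTB VTB.
have small : l < r -> pnorm UT <= Cs * e /\ pnorm VT <= Cs * e.
  rewrite !lt_min => /and3P[lK _ _]; have [dU dV] := dsm lK.
  by rewrite /Cs -mulrA (mulrC Th) mulrA; split; exact: nT.
have big : r <= l -> er <= e by move=> rl; apply: modulus_expr_le => //; exact: ltW.
have allC : pnorm UT <= C1 * e /\ pnorm VT <= C1 * e.
  have [/small[sU' sV']|/big rl] := ltP l r.
    have : 0 <= B * Th / er * e by rewrite mulr_ge0// ltW.
    by move=> h0; clear -sU' sV' h0; rewrite /C1; split; lra.
  have H : B * Th <= B * Th / er * e.
    by rewrite mulrAC ler_pdivlMr// ler_pM2l// mulr_gt0.
  have : 0 <= Cs * e by rewrite mulr_ge0// ltW.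
  by move=> h0; clear -UTB VTB H h0; rewrite /C1; split; lra.
pose F1 := P + UT; pose G1 := Q + VT.
pose d := (h y - h x) / 2 - unit_area F1 G1.
suff [S [T [[S0 S1] [T0 T1] [sS sT'] [nS nT'] ST]]] : exists S T,
  [/\ flat m.+1 0 S /\ flat m.+1 1 S, flat m.+1 0 T /\ flat m.+1 1 T,
      (size S <= Nq + Nl)%N /\ (size T <= Nq + Nl)%N,
      pnorm S <= C2 * e /\ pnorm T <= C2 * e &
      unit_area (F1 + S) (G1 + T) = unit_area F1 G1 + d].
  exists (UT + S), (VT + T); split.
  - by split; apply: flatD => //; exact: flatMl.
  - have E (u v : {poly R}) : u * th + v - u = u * (th - 1) + v by ring.
    by rewrite !E; split; apply: flatD => //; exact: flatMl.
  - have szD (u v : {poly R}) n n' : (size u <= n)%N -> (size v <= n')%N -> (size (u + v)%R <= n + n')%N.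
      move=> un vn; rewrite (leq_trans (size_polyD _ _))// geq_max.
      by rewrite (leq_trans un) ?leq_addr// (leq_trans vn)// leq_addl.
    by rewrite -addnA; split; exact: szD.
  - by have [x1 x2] := allC; clear -x1 x2 nS nT'; split; apply: le_trans (pnormD _ _) _; lra.
  by rewrite !addrA -/F1 -/G1 ST /d; field.
have quad : `|d| <= (Eq * e) ^+ 2 -> exists S T,
  [/\ flat m.+1 0 S /\ flat m.+1 1 S, flat m.+1 0 T /\ flat m.+1 1 T,
      (size S <= Nq + Nl)%N /\ (size T <= Nq + Nl)%N,
      pnorm S <= C2 * e /\ pnorm T <= C2 * e &
      unit_area (F1 + S) (G1 + T) = unit_area F1 G1 + d].
  move=> dE; have Ee : 0 <= Eq * e by rewrite mulr_ge0// ltW.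
  have [S [T [S0 T0 [sS sT'] [nS nT'] ST]]] := HCq F1 G1 d _ Ee dE.
  have HC : Cq * (Eq * e) <= C2 * e by rewrite mulrA ler_pM2r.
  exists S, T; split => //.
    by split; [exact: leq_trans sS (leq_addr _ _)|exact: leq_trans sT' (leq_addr _ _)].
  by split; [exact: le_trans nS HC|exact: le_trans nT' HC].
have EqEq : Eq <= Eq ^+ 2.
  have Eq1 : 1 <= Eq by clear -E30 E2er; rewrite /Eq; lra.
  by rewrite expr2 -[leLHS]mul1r ler_pM2r.
have [lr|rl] := ltP l r; last first.
  apply: quad.
  have dB : `|d| <= E2.
    have sF (u v : {poly R}) : (size u <= m.+1)%N -> (size v <= n1)%N -> (size (rescale x l u + v)%R <= n1)%N.
      move=> su sv; rewrite (leq_trans (size_polyD _ _))// geq_max sv andbT.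
      by rewrite (leq_trans (size_rescale _ _ su))// leq_addr.
    have H := unit_area_bound (sF _ _ (good_size_p gx) sUT) (sF _ _ (good_size_q gx) sVT).
    rewrite -/P -/Q -/F1 -/G1 -nnE in H.
    have F1B : pnorm F1 <= B2 by apply: le_trans (pnormD _ _) _; rewrite /B2 lerD.
    have G1B : pnorm G1 <= B2 by apply: le_trans (pnormD _ _) _; rewrite /B2 lerD.
    have FG : pnorm F1 * pnorm G1 <= B2 * B2 by rewrite ler_pM// pnorm_ge0.
    have n20 : 0 <= 2 * nn by rewrite mulr_ge0.
    have FG2 := ler_wpM2l n20 FG.
    have hx := good_h gx; have hy := good_h gy.
    rewrite !ler_norml in hx hy H *; move: hx hy H => /andP[u1 u2] /andP[u3 u4] /andP[u5 u6].
    by clear -u1 u2 u3 u4 u5 u6 FG2; rewrite /E2 /d; apply/andP; split; lra.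
  apply: le_trans dB _; rewrite exprMn.
  have er2 : 0 < er ^+ 2 by rewrite exprn_gt0.
  have ee : er ^+ 2 <= e ^+ 2 by apply: lerXn2r; [rewrite nnegrE ltW|rewrite nnegrE ltW|exact: big].
  apply: (@le_trans _ _ (E2 / er ^+ 2 * e ^+ 2)).
    by rewrite mulrAC ler_pdivlMr// ler_wpM2l.
  apply: ler_wpM2r; first exact: sqr_ge0.
  by apply: le_trans EqEq; clear -E30 E2er; rewrite /Eq; lra.
have [UTs VTs] := small lr.
move: lr; rewrite !lt_min => /and3P[lK lr1 ld].
pose Lam := if (deriv p == 0) && (deriv q == 0) then 0 else l.
have Lam0 : 0 <= Lam by rewrite /Lam; case: ifP => // _; exact: ltW.
have Laml : Lam <= l by rewrite /Lam; case: ifP => // _; exact: ltW.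
have dsmall : `|d| <= E3 * e * (Lam + e).
  have Xb := good_area gx (ltW xy) lK.
  rewrite -/l -/e -/Lam in Xb.
  have UT0 : UT.[0] = 0 by rewrite hornerM thv0 mulr0.
  have VT0 : VT.[0] = 0 by rewrite hornerM thv0 mulr0.
  have UT1 : UT.[1] = f y - p.[y].
    rewrite hornerM thv1 mulr1 horner_rescale mulr1 hornerD hornerN.
    by rewrite xl (good_p gy).
  have VT1 : VT.[1] = g y - q.[y].
    rewrite hornerM thv1 mulr1 horner_rescale mulr1 hornerD hornerN.
    by rewrite xl (good_q gy).
  have P1 : P.[1] = p.[y] by rewrite horner_rescale mulr1 xl.
  have Q1 : Q.[1] = q.[y] by rewrite horner_rescale mulr1 xl.
  have Ar : unit_area P Q = (area p q).[y] - (area p q).[x].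
    by rewrite unit_area_rescale xl.
  have dE := unit_area_perturb P Q UT0 VT0; rewrite -/F1 -/G1 UT1 VT1 P1 Q1 Ar in dE.
  set Y := (prim _).[1] in dE; set Z := unit_area UT VT in dE.
  set X := h y - _ - _ - _ in Xb.
  (* [UT] and [VT] take at 1 the Taylor errors of f and g at [y], so the boundary terms of
     [unit_area_perturb] are those subtracted in [good_area]. Only the interaction [Y] and the area
     [Z] of the correction remain. *)
  have dX : 2 * d = X - 4 * Y - 2 * Z by rewrite /d dE /X; field.
  have Zb : `|Z| <= 2 * nn * (Cs * Cs * (e * e)).
    apply: le_trans (unit_area_bound sUT sVT) _.
    rewrite -nnE; apply: ler_wpM2l; first by rewrite mulr_ge0.
    have -> : Cs * Cs * (e * e) = (Cs * e) * (Cs * e) by ring.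
    by rewrite ler_pM// pnorm_ge0.
  have Pd : pnorm (deriv P) <= Lam * B.
    rewrite deriv_rescale pnormZ (gtr0_norm l0) /Lam; case: ifP => [/andP[/eqP -> _]|_].
      by rewrite /rescale comp_poly0 pnorm0 mulr0 mul0r.
    by rewrite ler_pM2l.
  have Qd : pnorm (deriv Q) <= Lam * B.
    rewrite deriv_rescale pnormZ (gtr0_norm l0) /Lam; case: ifP => [/andP[_ /eqP ->]|_].
      by rewrite /rescale comp_poly0 pnorm0 mulr0 mul0r.
    by rewrite ler_pM2l.
  have Yb : `|Y| <= 2 * (Lam * B * (Cs * e)).
    apply: le_trans (pnorm_prim _) _; apply: le_trans (pnormB _ _) _.
    have y1 : pnorm (deriv P * VT) <= Lam * B * (Cs * e).
      by apply: le_trans (pnormM _ _) _; rewrite ler_pM// pnorm_ge0.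
    have y2 : pnorm (UT * deriv Q) <= Lam * B * (Cs * e).
      by rewrite mulrC; apply: le_trans (pnormM _ _) _; rewrite ler_pM// pnorm_ge0.
    by clear -y1 y2; lra.
  have e2 : 0 <= e * e by rewrite mulr_ge0// ltW.
  have eL : 0 <= e * Lam by rewrite mulr_ge0// ltW.
  have t0 : 0 <= K * (e * e) by rewrite mulr_ge0// ltW.
  have t1 : 0 <= K * (e * Lam) by rewrite mulr_ge0// ltW.
  have t2 : 0 <= B * Cs * (e * e) by rewrite mulr_ge0// mulr_ge0// ltW.
  have t3 : 0 <= nn * (Cs * Cs) * (e * Lam) by rewrite mulr_ge0// mulr_ge0// mulr_ge0// ltW.
  have -> : E3 * e * (Lam + e) = K * (e * Lam) + K * (e * e) + 4 * (B * Cs * (e * Lam))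
     + 4 * (B * Cs * (e * e)) + 2 * (nn * (Cs * Cs) * (e * Lam)) + 2 * (nn * (Cs * Cs) * (e * e)).
    by rewrite /E3; ring.
  have Xb' : `|X| <= K * (e * Lam) + K * (e * e).
    by have -> : K * (e * Lam) + K * (e * e) = K * e * (Lam + e) by ring.
  have Yb' : `|Y| <= 2 * (B * Cs * (e * Lam)).
    by have -> : 2 * (B * Cs * (e * Lam)) = 2 * (Lam * B * (Cs * e)) by ring.
  have Zb' : `|Z| <= 2 * (nn * (Cs * Cs) * (e * e)).
    by have -> : 2 * (nn * (Cs * Cs) * (e * e)) = 2 * nn * (Cs * Cs * (e * e)) by ring.
  move: Xb' Yb' Zb' t0 t1 t2 t3; rewrite !ler_norml.
  set k1 := K * (e * Lam); set k2 := K * (e * e); set k3 := B * Cs * _; set k4 := B * Cs * _.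
  set k5 := nn * _ * _; set k6 := nn * _ * _.
  move=> /andP[u1 u2] /andP[u3 u4] /andP[u5 u6] u7 u8 u9 u10; clear -dX u1 u2 u3 u4 u5 u6 u7 u8 u9 u10; apply/andP; split; lra.
(* The hypotheses of [area_correction_linear] with [c] equal to [l / K]. The Hermite correction is
   flat at 0, so the velocity there is l times that of [r'] at the node. *)
have lin_cond r' u : pnorm (rescale x l (deriv (deriv r'))) <= B ->
    (size (u * th)%R <= n1)%N -> pnorm (u * th) <= Cs * e -> K^-1 <= `|(deriv r').[x]| ->
    l / K <= `|(deriv (rescale x l r' + u * th)).[0]| /\
    forall s, 0 <= s <= 1 -> `|(deriv (rescale x l r' + u * th)).[s]
      - (deriv (rescale x l r' + u * th)).[0]| <= l / K / 2.
  move=> r''B su nu r'K.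
  have u0 : (deriv (u * th)).[0] = 0.
    have : flat m.+1 0 (u * th) by exact: flatMl.
    by move=> /flatS[_]; move: m0; case: (m) => // m' _ /flat_horner.
  split.
    rewrite derivD hornerD u0 addr0 deriv_rescale hornerZ horner_rescale mulr0 addr0.
    by rewrite normrM (gtr0_norm l0) ler_pM2l.
  move=> s s01; rewrite derivD !hornerD u0 addr0.
  have H1 := horner_sub_bound (deriv (rescale x l r')) s01.
  have H2 : pnorm (deriv (deriv (rescale x l r'))) <= l * l * B.
    rewrite deriv_rescale derivZ deriv_rescale scalerA pnormZ ger0_norm ?mulr_ge0 ?(ltW l0)//.
    by rewrite ler_pM2l// mulr_gt0.
  have H3 : `|(deriv (u * th)).[s]| <= nn * (Cs * e).
    apply: le_trans (horner_pnorm _ _) _.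
      by move: s01 => /andP[? ?]; rewrite ger0_norm.
    by apply: le_trans (pnorm_deriv su) _; rewrite -nnE; apply: ler_wpM2l.
  have H4 : l * l * B <= l / (4 * K).
    rewrite -mulrA; apply: ler_wpM2l; first exact: ltW.
    have B10 : 0 < B + 1 by rewrite ltr_wpDl// ltW.
    move: lr1; rewrite /r1 -[X in _ < X]mul1r ltr_pdivlMr; last by rewrite !mulr_gt0.
    move=> H; rewrite -[X in _ <= X]mul1r ler_pdivlMr; last by rewrite mulr_gt0.
    have lK4 : 0 <= l * (4 * K) by rewrite !mulr_ge0// ltW.
    clear -H lK4; lra.
  have H5 : nn * (Cs * e) <= l / (4 * K).
    have el := modulus_expr_lin wP m0 (ltW l0) lL.
    have wl := Hdel l (ltW l0) ld.
    have D1p : 0 < D1 + 1 by clear -D10; lra.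
    move: wl; rewrite /ep -[X in _ < X]mul1r ltr_pdivlMr; last by rewrite !mulr_gt0.
    move=> wl; rewrite ler_pdivlMr; last by rewrite mulr_gt0.
    have nC : 0 <= nn * Cs by rewrite mulr_ge0// ltW.
    have el2 := ler_wpM2l nC el.
    have w0 : 0 <= w l by apply: modulus_ge0 => //; exact: ltW.
    have wK : 0 <= w l * (4 * K) by rewrite !mulr_ge0// ltW.
    have wlD : (w l * (4 * K) * D1) * l <= 1 * l by apply: ler_wpM2r; [exact: ltW|clear -wl wK; lra].
    have K40 : 0 <= 4 * K by rewrite mulr_ge0// ltW.
    have el3 := ler_wpM2r K40 el2.
    have -> : nn * (Cs * e) * (4 * K) = nn * Cs * e * (4 * K) by ring.
    apply: le_trans el3 _; apply: le_trans (_ : _ <= (w l * (4 * K) * D1) * l) _; last by rewrite -[leRHS]mul1r.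
    by rewrite le_eqVlt; apply/orP; left; apply/eqP; rewrite /D1 /Lm; ring.
  have -> : (rescale x l r')^`().[s] + (deriv (u * th)).[s] - (rescale x l r')^`().[0] =
    ((rescale x l r')^`().[s] - (rescale x l r')^`().[0]) + (deriv (u * th)).[s] by ring.
  apply: le_trans (ler_normD _ _) _.
  have -> : l / K / 2 = l / (4 * K) + l / (4 * K) by field; rewrite gt_eqF.
  by clear -H1 H2 H3 H4 H5; lra.
have dlin : Lam <= l -> `|d| <= l / K * (El * e).
  move=> _.
  have eW : e <= W * l.
    apply: le_trans (modulus_expr_lin wP m0 (ltW l0) lL) _; apply: ler_wpM2r; first exact: ltW.
    apply: ler_wpM2r; first exact: ltW.
    by apply: modulus_le => //; exact: ltW.
  have E3e : 0 <= E3 * e by rewrite mulr_ge0// ltW.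
  have Lle : Lam + e <= l * (1 + W) by clear -eW Laml; lra.
  apply: le_trans dsmall _; apply: le_trans (ler_wpM2l E3e Lle) _.
  rewrite le_eqVlt; apply/orP; left; apply/eqP; rewrite /El; field.
  by rewrite gt_eqF.
have lK0 : 0 < l / K by rewrite divr_gt0.
have Ele : 0 <= El * e by rewrite mulr_ge0// ltW.
have HC : Cl * (El * e) <= C2 * e by rewrite mulrA ler_pM2r.
have C2e : 0 <= C2 * e by rewrite mulr_ge0// ltW.
have flat0 c : flat m.+1 c (0 : {poly R}) by move=> k _; rewrite derivn_poly0 ?size_poly0// horner0.
case: (good_speed gx) => [[p0 q0]|pK|qK].
- apply: quad; apply: le_trans dsmall _.
  rewrite /Lam p0 q0 eqxx/= add0r exprMn -mulrA -expr2.
  apply: ler_wpM2r; first exact: sqr_ge0.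
  by apply: le_trans EqEq; clear -E30 E2er; rewrite /Eq; lra.
- have [c1 c2] := lin_cond _ _ p_3 sUT UTs pK.
  have [T [T0 T1 sT' nT' ST]] := HCl F1 G1 _ _ _ lK0 Ele (dlin Laml) c1 c2.
  exists 0, T; split => //.
  + by rewrite size_poly0; split => //; exact: leq_trans sT' (leq_addl _ _).
  + by rewrite pnorm0; split => //; exact: le_trans nT' HC.
  by rewrite addr0.
(* The roles of the two components are exchanged; the area is antisymmetric, so the defect changes
   sign. *)
have [c1 c2] := lin_cond _ _ q_3 sVT VTs qK.
have dn : `|- d| <= l / K * (El * e) by rewrite normrN; exact: dlin.
have [S [S0 S1 sS nS ST]] := HCl G1 F1 _ _ _ lK0 Ele dn c1 c2.
exists S, 0; split => //.
+ by rewrite size_poly0; split => //; exact: leq_trans sS (leq_addl _ _).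
+ by rewrite pnorm0; split => //; exact: le_trans nS HC.
by rewrite addr0 unit_areaC ST (unit_areaC F1) opprD !opprK.
Qed.

Section GapFill.
Variables (R : realType) (a b : R) (m : nat) (w : R -> R).
Hypotheses (m0 : (0 < m)%N) (wP : modulus w) (ab : a <= b).
Variables (f g h : R -> R) (K : R).
Hypothesis K0 : 0 < K.
Implicit Types (F A r : {poly R}).

(** Scaling back to the gap divides the derivative of order m + 1 by l^(m+1), while the correction
    has size w(l) l^m: this leaves w(l) / l. The Taylor polynomial itself does not contribute, its
    degree being at most [m]. *)
Lemma gap_fill : exists2 M : R, 0 < M & forall (x y : R) (p q p2 q2 : {poly R}),
  good_point m w f g h K x p q -> good_point m w f g h K y p2 q2 -> a <= x -> x < y -> y <= b -> exists u v : {poly R},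
  [/\ forall k, (k <= m)%N -> (derivn k u).[x] = (derivn k p).[x] /\
                              (derivn k v).[x] = (derivn k q).[x],
      forall k, (k <= m)%N -> (derivn k u).[y] = (derivn k p2).[y] /\
                              (derivn k v).[y] = (derivn k q2).[y],
      2 * ((area u v).[y] - (area u v).[x]) = h y - h x &
      forall t, x <= t -> t <= y ->
        (y - x) * `|(derivn m.+1 u).[t]| <= M * w (y - x) /\
        (y - x) * `|(derivn m.+1 v).[t]| <= M * w (y - x)].
Proof.
have [N [C [C0 HC]]] := gap_correction f g h m0 wP ab K0.
exists (N.+1%:R ^+ m.+1 * C); first by rewrite mulr_gt0// exprn_gt0.
move=> x y p q p2 q2 gx gy ax xy yb.
have [A [B [[A0 B0] [A1 B1] [sA sB] [nA nB] AB]]] := HC _ _ _ _ _ _ gx gy ax xy yb.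
set l := y - x in A1 B1 nA nB AB *.
have l0 : 0 < l by rewrite subr_gt0.
have ln0 : l != 0 by rewrite gt_eqF.
have xl : x + l = y by rewrite /l addrC subrK.
pose un F := rescale (- (x / l)) l^-1 F.
have unK F : rescale x l (un F) = F by exact: rescaleK.
have dun F k (t : R) : (derivn k (un F)).[t] = l^-1 ^+ k * (derivn k F).[(t - x) / l].
  rewrite derivn_rescale hornerZ horner_rescale; congr (_ * _.[_]); field.
  by rewrite ln0.
have jet0 r A' k : flat m.+1 0 A' -> (k <= m)%N ->
    (derivn k (un (rescale x l r + A'))).[x] = (derivn k r).[x].
  move=> HA km; rewrite dun subrr mul0r (flat_horner_eq _ HA)//.
  rewrite derivn_rescale hornerZ horner_rescale mulr0 addr0 mulrA -exprMn mulVf//.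
  by rewrite expr1n mul1r.
have jet1 r r2 A' k : flat m.+1 1 (A' - rescale x l (r2 - r)) -> (k <= m)%N ->
    (derivn k (un (rescale x l r + A'))).[y] = (derivn k r2).[y].
  move=> HA km; rewrite dun -/l divff//.
  have -> : rescale x l r + A' = rescale x l r2 + (A' - rescale x l (r2 - r)).
    by rewrite rescaleB; ring.
  rewrite (flat_horner_eq _ HA)//.
  rewrite derivn_rescale hornerZ horner_rescale mulr1 mulrA -exprMn mulVf//.
  by rewrite expr1n mul1r xl.
have top r A' (t : R) : (size r <= m.+1)%N -> (size A' <= N)%N -> pnorm A' <= C * (w l * l ^+ m) ->
    x <= t -> t <= y ->
    l * `|(derivn m.+1 (un (rescale x l r + A'))).[t]| <= N.+1%:R ^+ m.+1 * C * w l.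
  move=> sr sA' nA' xt ty; rewrite dun derivnD hornerD.
  rewrite derivn_rescale (derivn_poly0 sr) hornerZ /rescale comp_poly0 horner0 mulr0 add0r.
  rewrite normrM normrX normfV (gtr0_norm l0).
  have s1 : `|(t - x) / l| <= 1.
    rewrite normrM normfV (gtr0_norm l0) ler_pdivrMr// mul1r ger0_norm ?subr_ge0//.
    by rewrite lerD2r.
  have H := horner_pnorm (derivn m.+1 A') s1.
  have H2 := le_trans H (pnorm_derivn m.+1 (leqW sA')).
  have N0 : 0 <= N.+1%:R ^+ m.+1 :> R by rewrite exprn_ge0.
  have H3 := le_trans H2 (ler_wpM2l N0 nA').
  rewrite mulrA exprS mulrA divff// mul1r.
  have lm : 0 <= l^-1 ^+ m by rewrite exprn_ge0// invr_ge0 ltW.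
  apply: le_trans (ler_wpM2l lm H3) _.
  rewrite le_eqVlt; apply/orP; left; apply/eqP.
  have lme : l^-1 ^+ m * l ^+ m = 1 by rewrite -exprMn mulVf// expr1n.
  rewrite -[RHS]mulr1 -lme; ring.
exists (un (rescale x l p + A)), (un (rescale x l q + B)); split.
- by move=> k km; split; exact: jet0.
- by move=> k km; split; exact: jet1.
- rewrite -AB -[in RHS](unK (rescale x l p + A)) -[in RHS](unK (rescale x l q + B)).
  by rewrite unit_area_rescale xl.
by move=> t xt ty; split; apply: top => //; [exact: good_size_p gx|exact: good_size_q gx].
Qed.

End GapFill.

(** * Interpolation at finitely many points *)

Section Splice.
Variable R : realType.
Implicit Types (c t : R) (f g : R -> R).

Definition splice c f g t : R := if t <= c then f t else g t.

Lemma splice_le c f g t : t <= c -> splice c f g t = f t.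
Proof. by rewrite /splice => ->. Qed.

Lemma splice_ge c f g t : f c = g c -> c <= t -> splice c f g t = g t.
Proof.
by rewrite /splice => fg ct; case: ifPn => // tc; rewrite (_ : t = c)//; apply/eqP; rewrite eq_le tc.
Qed.

(** Away from [A] the condition is vacuous. Hence a piece of a glued function imposes nothing at
    points at a positive distance from its domain. *)
Lemma slope_on_far (A : set R) f t l (d : R) : 0 < d ->
  (forall y, A y -> d <= `|y - t|) -> slope_on A f t l.
Proof. by move=> d0 Ad e e0; exists d => // y /Ad; rewrite leNgt => /negP. Qed.

Lemma slope_splice c f g f' g' : f c = g c -> f' c = g' c ->
  (forall t, t <= c -> slope_on setT f t (f' t)) ->
  (forall t, c <= t -> slope_on setT g t (g' t)) ->
  forall t, slope_on setT (splice c f g) t (splice c f' g' t).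
Proof.
move=> fg fg' Hf Hg t.
have -> : setT = [set y | y <= c] `|` [set y | c <= y].
  by apply/seteqP; split => // y _; case: (leP y c) => [yc|/ltW cy]; [left|right].
apply: slope_onU.
  have [tc|ct] := leP t c; last first.
    apply: (@slope_on_far _ _ _ _ (t - c)); first by rewrite subr_gt0.
    by move=> y /= yc; rewrite distrC ger0_norm; lra.
  rewrite splice_le//; apply: (@slope_on_eq R _ f) => //.
    by move=> y /= yc; rewrite splice_le.
  exact: slope_onW (Hf t tc).
have [ct|tc] := leP c t; last first.
  apply: (@slope_on_far _ _ _ _ (c - t)); first by rewrite subr_gt0.
  by move=> y /= cy; rewrite ger0_norm; lra.
rewrite splice_ge//; apply: (@slope_on_eq R _ g) => //.
  by move=> y /= cy; rewrite splice_ge.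
exact: slope_onW (Hg t ct).
Qed.

End Splice.

Section Components.
Variables (R : realType) (m : nat) (w : R -> R) (a b M0 M1 : R).
Hypothesis wP : modulus w.
Hypotheses (M00 : 0 <= M0) (M10 : 0 <= M1).
Variable J : R -> {poly R}.
Implicit Types (x y t : R) (s : seq R) (F : nat -> R -> R).

Definition jet_derivs F := forall k t, (k < m)%N -> slope_on setT (F k) t (F k.+1 t).

(* The last clause makes the interpolants extendable to the left: it compares
   the value at t with that at a node before t. *)
Definition interpolates x s F := [/\ jet_derivs F,
  forall z k, z \in x :: s -> (k <= m)%N -> F k z = (derivn k (J z)).[z],
  forall k t, (k <= m)%N -> t <= x -> F k t = (derivn k (J x)).[t],
  forall t t', t <= t' -> t' <= b -> `|F m t - F m t'| <= (M0 + 2 * M1) * w (t' - t) &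
  forall t, x <= t -> t <= b -> exists z, [/\ z \in x :: s, x <= z, z <= t &
    `|F m z - F m t| <= M1 * w (t - z)] ].

Lemma derivn_const (p : {poly R}) t t' : (size p <= m.+1)%N ->
  (derivn m p).[t] = (derivn m p).[t'].
Proof.
move=> sp; have : (size (derivn m p) <= 1)%N.
  elim: m p sp => [//|n IH] p sp; rewrite derivSn; apply: IH.
  by rewrite (leq_trans (size_poly _ _))//; case: (size p) sp.
by move=> /size1_polyC ->; rewrite !hornerC.
Qed.

Lemma interpolates1 x : (size (J x) <= m.+1)%N ->
  interpolates x [::] (fun k => horner (derivn k (J x))).
Proof.
move=> sJ; split => //.
- by move=> k t km; rewrite derivnS; exact: slope_on_horner.
- by move=> z k; rewrite inE => /eqP ->.
- move=> t t' tt' _; rewrite (derivn_const t t' sJ) subrr normr0.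
  apply: mulr_ge0; first by rewrite addr_ge0// mulr_ge0.
  by apply: modulus_ge0 => //; rewrite subr_ge0.
- move=> t xt _; exists x; rewrite mem_head lexx; split => //.
  rewrite (derivn_const x t sJ) subrr normr0; apply: mulr_ge0 => //.
  by apply: modulus_ge0 => //; rewrite subr_ge0.
Qed.

(** Constants do not accumulate as nodes are added: for [t < x < t'], the oscillation is at most
    [M1] from [t] to [x], [M0] from [x] to the node [z] found before [t'], and [M1] from [z] to
    [t'], each times [w (t' - t)]. To the left of [y] the derivative of order [m] is constant. *)
Lemma interpolates_cons y x s F (B : {poly R}) :
  y < x -> x <= b -> (size (J y) <= m.+1)%N ->
  (forall z, z \in x :: s -> x <= z) ->
  (forall z, z \in x :: s ->
     `|(derivn m (J x)).[x] - (derivn m (J z)).[z]| <= M0 * w (z - x)) ->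
  (forall k, (k <= m)%N -> (derivn k B).[y] = (derivn k (J y)).[y]) ->
  (forall k, (k <= m)%N -> (derivn k B).[x] = (derivn k (J x)).[x]) ->
  (forall t, y <= t -> t <= x -> (x - y) * `|(derivn m.+1 B).[t]| <= M1 * w (x - y)) ->
  interpolates x s F ->
  interpolates y (x :: s)
    (fun k => splice y (horner (derivn k (J y))) (splice x (horner (derivn k B)) (F k))).
Proof.
move=> yx xb sJ sx HM0 By Bx HM1 [Fd Fn Fl Fh FL].
set F' := fun k => _.
have xy0 : 0 < x - y by rewrite subr_gt0.
have match1 k : (k <= m)%N -> horner (derivn k B) x = F k x.
  by move=> km; rewrite Bx// (Fl k x km).
have match2 k : (k <= m)%N ->
    horner (derivn k (J y)) y = splice x (horner (derivn k B)) (F k) y.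
  by move=> km; rewrite splice_le ?By// ltW.
have F'l k t : t <= y -> F' k t = (derivn k (J y)).[t] by move=> ty; rewrite /F' splice_le.
have F'm k t : (k <= m)%N -> y <= t -> t <= x -> F' k t = (derivn k B).[t].
  by move=> km yt tx; rewrite /F' splice_ge ?match2// splice_le.
have F'r k t : (k <= m)%N -> x <= t -> F' k t = F k t.
  move=> km xt; rewrite /F' splice_ge ?match2//; last exact: le_trans (ltW yx) xt.
  by rewrite splice_ge ?match1.
have gap t t' : y <= t -> t <= t' -> t' <= x ->
    `|(derivn m B).[t] - (derivn m B).[t']| <= M1 * w (t' - t).
  move=> yt; rewrite le_eqVlt => /predU1P[<- _|tt' t'x].
    by rewrite !subrr normr0 modulus0// mulr0.
  have [|c] := @MVT_segment R (horner (derivn m B)) (horner (derivn m.+1 B)) t t' (ltW tt').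
  - by apply: continuous_subspaceT => r; exact: continuous_horner.
  rewrite in_itv/= => /andP[tc ct'] E; rewrite distrC E normrM.
  have tt0 : 0 < t' - t by rewrite subr_gt0.
  rewrite (gtr0_norm tt0) -(ler_pM2l xy0) mulrA.
  apply: le_trans (ler_wpM2r (ltW tt0) (HM1 c (le_trans yt tc) (le_trans ct' t'x))) _.
  (* The derivative of order m + 1 is at most [M1] times w(x - y) / (x - y). As [w s / s] is
     nonincreasing, the bound over the whole gap yields the bound over its subintervals. *)
  have : (t' - t) * w (x - y) <= (x - y) * w (t' - t) by apply: modulus_scale => //; lra.
  by move=> /(ler_wpM2l M10); lra.
have left t t' : t <= t' -> t' <= x -> `|F' m t - F' m t'| <= M1 * w (t' - t).
  move=> tt' t'x; have w0 : 0 <= M1 * w (t' - t).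
    by rewrite mulr_ge0// modulus_ge0// subr_ge0.
  have [yt|/ltW ty] := leP y t.
    by rewrite !F'm//; [exact: gap|exact: le_trans tt'|exact: le_trans t'x].
  rewrite (F'l m t)// (derivn_const t y sJ) -By//.
  have [yt'|/ltW t'y] := leP y t'; last first.
    by rewrite (F'l m t')// (derivn_const t' y sJ) -By// subrr normr0.
  rewrite F'm//; apply: le_trans (gap _ _ (lexx _) yt' t'x) _.
  by apply: ler_wpM2l => //; apply: modulus_le => //; lra.
split.
- move=> k t km; rewrite /F'; apply: slope_splice.
  + exact/match2/ltnW.
  + exact: match2.
  + by move=> r _; rewrite derivnS; exact: slope_on_horner.
  move=> r _; apply: slope_splice.
  + exact/match1/ltnW.
  + exact: match1.
  + by move=> r' _; rewrite derivnS; exact: slope_on_horner.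
  by move=> r' _; exact: Fd.
- move=> z k; rewrite inE => /predU1P[->|zs] km; first by rewrite F'l.
  have [zx|xz] := leP z x; last by rewrite F'r ?(ltW xz)// Fn.
  have -> : z = x.
    by apply/eqP; rewrite eq_le zx sx.
  by rewrite F'r// Fn// mem_head.
- by move=> k t _; exact: F'l.
- move=> t t' tt' t'b.
  change (`|F' m t - F' m t'| <= (M0 + 2 * M1) * w (t' - t)).
  have W r : 0 <= r -> r <= t' - t -> w r <= w (t' - t) by move=> ? ?; exact: modulus_le.
  have w0 : 0 <= w (t' - t) by rewrite modulus_ge0// subr_ge0.
  have Mw0 : 0 <= M0 * w (t' - t) by rewrite mulr_ge0.
  have Mw1 : 0 <= M1 * w (t' - t) by rewrite mulr_ge0.
  have [t'x|xt'] := leP t' x.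
    by apply: le_trans (left _ _ tt' t'x) _; lra.
  have [xt|tx] := leP x t.
    by rewrite !F'r ?(ltW xt')//; exact: Fh.
  have [z [zs xz zt' Hz]] := FL t' (ltW xt') t'b.
  have h1 := left t x (ltW tx) (lexx _).
  have h2 := HM0 z zs.
  rewrite -(Fn x m (mem_head _ _) (leqnn _)) -(Fn z m zs (leqnn _)) in h2.
  rewrite (F'r m x (leqnn _) (lexx _)) in h1; have E' := F'r m t' (leqnn _) (ltW xt').
  have v1 : w (x - t) <= w (t' - t) by apply: W; lra.
  have v2 : w (z - x) <= w (t' - t) by apply: W; lra.
  have v3 : w (t' - z) <= w (t' - t) by apply: W; lra.
  have u1 := ler_wpM2l M10 v1; have u2 := ler_wpM2l M00 v2; have u3 := ler_wpM2l M10 v3.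
  have := ler_distD (F m x) (F' m t) (F m t'); have := ler_distD (F m z) (F m x) (F m t').
  by rewrite E'; lra.
move=> t yt tb; have [xt|tx] := leP x t.
  have [z [zs xz zt Hz]] := FL t xt tb; exists z; split => //.
  + by rewrite inE zs orbT.
  + exact: le_trans (ltW yx) xz.
  by rewrite !F'r.
exists y; rewrite mem_head lexx; split => //.
by apply: left => //; exact: ltW.
Qed.

End Components.

Section MeanValue.
Variable R : realType.

Lemma slope_mvt (f f' : R -> R) (u v : R) : u <= v ->
  (forall t, u <= t -> t <= v -> slope_on setT f t (f' t)) ->
  exists2 c, u <= c <= v & f v - f u = f' c * (v - u).
Proof.
move=> uv H.
have D t : u <= t -> t <= v -> is_derive t 1 f (f' t).
  by move=> ut tv; apply: slope_derive; exact: H.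
have [||c] := @MVT_segment R f f' u v uv.
- by move=> t; rewrite in_itv/= => /andP[ut tv]; apply: D; exact: ltW.
- apply: derivable_within_continuous => t; rewrite in_itv/= => /andP[ut tv].
  by have := D t ut tv => dt; exact: ex_derive.
by rewrite in_itv/= => cuv E; exists c.
Qed.

End MeanValue.

(** * A priori bounds for jets on the interval *)

Section Bounds.
Variables (R : realType) (a b : R) (m : nat) (w : R -> R).
Hypotheses (ab : a < b) (wP : modulus w).
Implicit Types (f : R -> R) (F : nat -> R -> R).

Definition bounded_by (C : R) f := forall t, a <= t -> t <= b -> `|f t| <= C.

Definition holder (C : R) f := forall t t', a <= t -> t <= b -> a <= t' -> t' <= b ->
  `|f t - f t'| <= C * w `|t - t'|.

(** A quantitative derivative: for fixed [C] it is preserved by pointwise limits of [f] and [f'],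
    and it ignores values outside [[a, b]]. *)
Definition first_order (C : R) f (f' : R -> R) := forall t t', a <= t -> t <= b -> a <= t' -> t' <= b ->
  `|f t' - f t - f' t * (t' - t)| <= C * (w `|t' - t| * `|t' - t|).

(** By concavity [s <= lip_ratio * w s] up to the length of the interval, which turns Lipschitz
    bounds into bounds by [w]. *)
Definition lip_ratio : R := (b - a) / w (b - a).

Lemma lip_ratio_ge0 : 0 <= lip_ratio.
Proof.
have ba0 : 0 < b - a by rewrite subr_gt0.
by apply: divr_ge0; [exact: ltW|apply: modulus_ge0 => //; exact: ltW].
Qed.

Lemma dist_modulus t t' : a <= t -> t <= b -> a <= t' -> t' <= b ->
  `|t - t'| <= lip_ratio * w `|t - t'|.
Proof.
move=> at_ tb at' t'b; have ba0 : 0 < b - a by rewrite subr_gt0.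
by apply: modulus_lin => //; rewrite ler_norml; apply/andP; split; lra.
Qed.

Lemma slope_lipschitz f (f' : R -> R) (C : R) : 0 <= C ->
  (forall t, slope_on setT f t (f' t)) -> bounded_by C f' ->
  forall t t', a <= t -> t <= b -> a <= t' -> t' <= b -> `|f t - f t'| <= C * `|t - t'|.
Proof.
move=> C0 Hf Hb t t'; wlog tt' : t t' / t <= t'.
  move=> W at_ tb at' t'b; have [tt'|/ltW t't] := leP t t'; first exact: W.
  by rewrite distrC (distrC t); exact: W.
move=> at_ tb at' t'b; have [c /andP[tc ct'] E] := slope_mvt tt' (fun r _ _ => Hf r).
rewrite distrC E normrM distrC; apply: ler_wpM2r => //; apply: Hb.
  exact: le_trans tc.
exact: le_trans t'b.
Qed.

Lemma slope_holder f (f' : R -> R) (C : R) : 0 <= C ->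
  (forall t, slope_on setT f t (f' t)) -> bounded_by C f' -> holder (C * lip_ratio) f.
Proof.
move=> C0 Hf Hb t t' at_ tb at' t'b.
apply: le_trans (slope_lipschitz C0 Hf Hb at_ tb at' t'b) _.
by rewrite -mulrA; apply: ler_wpM2l => //; exact: dist_modulus.
Qed.

Lemma slope_bounded f (f' : R -> R) (C B x0 : R) : 0 <= C -> a <= x0 -> x0 <= b -> `|f x0| <= B ->
  (forall t, slope_on setT f t (f' t)) -> bounded_by C f' ->
  bounded_by (B + C * (b - a)) f.
Proof.
move=> C0 ax xb fB Hf Hb t at_ tb.
have H := slope_lipschitz C0 Hf Hb at_ tb ax xb.
have d : `|t - x0| <= b - a by rewrite ler_norml; apply/andP; split; lra.
have := ler_wpM2l C0 d; have := ler_normD (f t - f x0) (f x0); rewrite subrK; lra.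
Qed.

Lemma slope_first_order f (f' : R -> R) (C : R) : 0 <= C ->
  (forall t, slope_on setT f t (f' t)) -> holder C f' -> first_order C f f'.
Proof.
move=> C0 Hf Hh t t' at_ tb at' t'b.
suff [c [ac cb ct E]] : exists c, [/\ a <= c, c <= b, `|c - t| <= `|t' - t| &
    f t' - f t = f' c * (t' - t)].
  rewrite E -mulrBl normrM mulrA; apply: ler_wpM2r => //.
  apply: le_trans (Hh c t ac cb at_ tb) _; apply: ler_wpM2l => //.
  exact: modulus_le.
have [tt'|/ltW t't] := leP t t'.
  have [c /andP[tc ct'] E] := slope_mvt tt' (fun r _ _ => Hf r); exists c; split => //.
  - exact: le_trans tc.
  - exact: le_trans t'b.
  - by rewrite !ger0_norm ?subr_ge0//; lra.
have [c /andP[tc ct'] E] := slope_mvt t't (fun r _ _ => Hf r); exists c; split => //.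
- exact: le_trans tc.
- exact: le_trans tb.
- by rewrite !ler0_norm ?subr_le0//; lra.
by rewrite -opprB E; ring.
Qed.

(** Descending induction on the order, with [j] bounding [m - k]: a bound on the next derivative and
    on one value gives a bound on the function, and its Lipschitz estimate gives the bound by
    [w]. *)
Lemma jet_bounds (K M : R) : 0 <= K -> 0 <= M -> exists2 C : R, 0 < C & forall F x0,
  a <= x0 -> x0 <= b -> jet_derivs m F -> (forall k, (k <= m)%N -> `|F k x0| <= K) ->
  holder M (F m) -> [/\ forall k, (k <= m)%N -> bounded_by C (F k),
    forall k, (k <= m)%N -> holder C (F k) &
    forall k, (k < m)%N -> first_order C (F k) (F k.+1)].
Proof.
move=> K0 M0.
have ba0 : 0 < b - a by rewrite subr_gt0.
have lr0 := lip_ratio_ge0.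
suff [C C0 HC] : exists2 C : R, 0 < C & forall F x0,
  a <= x0 -> x0 <= b -> jet_derivs m F -> (forall k, (k <= m)%N -> `|F k x0| <= K) ->
  holder M (F m) -> forall k, (k <= m)%N -> bounded_by C (F k) /\ holder C (F k).
  exists C => // F x0 ax xb Fd FK FM; split.
  - by move=> k km; have [] := HC F x0 ax xb Fd FK FM k km.
  - by move=> k km; have [] := HC F x0 ax xb Fd FK FM k km.
  move=> k km; apply: slope_first_order; [exact: ltW|by move=> t; exact: Fd|].
  by have [] := HC F x0 ax xb Fd FK FM k.+1 km.
suff H j : exists2 C : R, 0 < C & forall F x0,
  a <= x0 -> x0 <= b -> jet_derivs m F -> (forall k, (k <= m)%N -> `|F k x0| <= K) ->
  holder M (F m) -> forall k, (k <= m)%N -> (m - k <= j)%N -> bounded_by C (F k) /\ holder C (F k).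
  have [C C0 HC] := H m; exists C => // F x0 ax xb Fd FK FM k km.
  by apply: (HC F x0) => //; exact: leq_subr.
elim: j => [|j [C C0 IH]].
  have w0 : 0 <= w (b - a) by rewrite modulus_ge0// ltW.
  have Mw : 0 <= M * w (b - a) by rewrite mulr_ge0.
  exists (K + M * w (b - a) + M + 1); first by lra.
  move=> F x0 ax xb Fd FK FM k km; rewrite leqn0 subn_eq0 => mk.
  have -> : k = m by apply/eqP; rewrite eqn_leq km.
  split => [t at_ tb|t t' at_ tb at' t'b].
    have H := FM t x0 at_ tb ax xb.
    have : w `|t - x0| <= w (b - a).
      by apply: modulus_le => //; rewrite ler_norml; apply/andP; split; lra.
    move=> /(ler_wpM2l M0); have := FK m (leqnn _).
    have := ler_normD (F m t - F m x0) (F m x0); rewrite subrK; lra.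
  apply: le_trans (FM _ _ at_ tb at' t'b) _; apply: ler_wpM2r; first exact: modulus_ge0.
  lra.
exists (K + C * (1 + (b - a) + lip_ratio)).
  by rewrite ltr_wpDl// mulr_gt0//; lra.
have CL : 0 <= C * (b - a) by rewrite mulr_ge0// ltW.
have Cl : 0 <= C * lip_ratio by rewrite mulr_ge0// ltW.
move=> F x0 ax xb Fd FK FM k km mkj.
have [mk|mk] := leqP (m - k) j.
  have [H1 H2] := IH F x0 ax xb Fd FK FM k km mk; split => [t at_ tb|t t' at_ tb at' t'b].
    by apply: le_trans (H1 t at_ tb) _; lra.
  apply: le_trans (H2 _ _ at_ tb at' t'b) _; apply: ler_wpM2r; first exact: modulus_ge0.
  lra.
have km' : (k < m)%N by rewrite -subn_gt0; exact: leq_ltn_trans mk.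
have [H1 _] := IH F x0 ax xb Fd FK FM k.+1 km' ltac:(lia).
have Hs t : slope_on setT (F k) t (F k.+1 t) by exact: Fd.
split => [t at_ tb|t t' at_ tb at' t'b].
  by apply: le_trans (slope_bounded (ltW C0) ax xb (FK k km) Hs H1 at_ tb) _; lra.
apply: le_trans (slope_holder (ltW C0) Hs H1 at_ tb at' t'b) _; apply: ler_wpM2r.
  exact: modulus_ge0.
lra.
Qed.

End Bounds.

Section FiniteInterpolation.
Variables (R : realType) (a b : R) (m : nat) (w : R -> R).
Hypotheses (m0 : (0 < m)%N) (wP : modulus w) (ab : a < b).
Variables (f g h : R -> R) (K : R) (pp qq : R -> {poly R}).
Hypothesis K0 : 0 < K.
Let good x := [/\ a <= x, x <= b & good_point m w f g h K x (pp x) (qq x)].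

(** For nodes closer than [K^-1], the Markov inequality of order [m] applies to the difference of
    the Taylor polynomials, whose derivatives of order [m] are constant. For distant nodes the jet
    bound 2 K suffices, because w(l) >= w(K^-1). *)
Lemma node_holder : exists2 M0 : R, 0 < M0 & forall x z, good x -> good z -> x <= z ->
  `|(derivn m (pp x)).[x] - (derivn m (pp z)).[z]| <= M0 * w (z - x) /\
  `|(derivn m (qq x)).[x] - (derivn m (qq z)).[z]| <= M0 * w (z - x).
Proof.
have [C C0 HC] := @markov_endpoint R m.+1 m.
have KV : 0 < K^-1 by rewrite invr_gt0.
have wK := modulus_gt0 wP KV.
have c0 : 0 < 2 * K / w K^-1 by rewrite divr_gt0// mulr_gt0.
have C2K : 0 < C * (2 * K) by rewrite !mulr_gt0.
exists (C * (2 * K) + 2 * K / w K^-1); first by rewrite addr_gt0.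
suff H (r r2 : {poly R}) (u : R -> R) x z : x < z -> (size r <= m.+1)%N -> (size r2 <= m.+1)%N ->
    taylor_point m w u r K x -> taylor_point m w u r2 K z ->
    `|(derivn m r).[x]| <= K -> `|(derivn m r2).[z]| <= K ->
    `|(derivn m r).[x] - (derivn m r2).[z]| <= (C * (2 * K) + 2 * K / w K^-1) * w (z - x).
  move=> x z [_ _ gx] [_ _ gz]; rewrite le_eqVlt => /predU1P[<-|xz].
    by rewrite !subrr !normr0 modulus0// !mulr0.
  split.
    exact: H xz (good_size_p gx) (good_size_p gz) (good_taylor_p gx) (good_taylor_p gz) (good_jet_p gx m) (good_jet_p gz m).
  exact: H xz (good_size_q gx) (good_size_q gz) (good_taylor_q gx) (good_taylor_q gz) (good_jet_q gx m) (good_jet_q gz m).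
move=> xz sr sr2 tr tr2 jr jr2; set l := z - x.
have l0 : 0 < l by rewrite subr_gt0.
have wl := modulus_gt0 wP l0.
have [lK|Kl] := ltP l K^-1; last first.
  have wKl : w K^-1 <= w l by apply: modulus_le => //; exact: ltW.
  have : 2 * K <= 2 * K / w K^-1 * w l by rewrite mulrAC ler_pdivlMr// ler_wpM2l// mulr_ge0// ltW.
  have : 0 <= C * (2 * K) * w l by rewrite mulr_ge0// ltW.
  by have := ler_normB (derivn m r).[x] (derivn m r2).[z]; lra.
have ln : `|z - x| = l by rewrite gtr0_norm.
have lK' : `|z - x| < K^-1 by rewrite ln.
have sd : (size (r2 - r)%R <= m.+1)%N.
  by rewrite (leq_trans (size_polyD _ _))// geq_max size_polyN sr2.
have := HC _ x z _ sd (fun s s01 => taylor_points_close wP K0 lK' tr tr2 s01).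
rewrite ln derivnB hornerD hornerN (derivn_const z x sr) distrC.
have lm : 0 < l ^+ m by rewrite exprn_gt0.
have -> : C * (2 * K * (w l * l ^+ m)) = l ^+ m * (C * (2 * K) * w l) by ring.
rewrite ler_pM2l// => /le_trans; apply; apply: ler_wpM2r; first exact: ltW.
by rewrite lerDl ltW.
Qed.

(** Induction on the nodes, adding each new one to the left. The height is built along with the
    plane curve as the lift that starts at the right value; the area identity of [gap_fill] makes it
    arrive at the next one. *)
Lemma finite_interpolation : exists2 M : R, 0 < M & forall x s,
  path <%R x s -> (forall z, z \in x :: s -> good z) ->
  exists (F G : nat -> R -> R) (H : R -> R), [/\
    jet_derivs m F /\ jet_derivs m G,
    holder a b w M (F m) /\ holder a b w M (G m),
    (forall z k, z \in x :: s -> (k <= m)%N -> F k z = (derivn k (pp z)).[z] /\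
                                             G k z = (derivn k (qq z)).[z]),
    (forall z, z \in x :: s -> H z = h z) &
    forall t, slope_on setT H t (2 * (F 1%N t * G 0%N t - F 0%N t * G 1%N t))].
Proof.
have [M0 M00 HM0] := node_holder.
have [M1 M10 HM1] := gap_fill m0 wP (ltW ab) f g h K0.
exists (M0 + 2 * M1); first by rewrite addr_gt0// mulr_gt0.
suff IH s x : path <%R x s -> (forall z, z \in x :: s -> good z) ->
  exists (F G : nat -> R -> R) (H : R -> R), [/\
    interpolates m w b M0 M1 pp x s F, interpolates m w b M0 M1 qq x s G,
    (forall z, z \in x :: s -> H z = h z),
    (forall t, t <= x -> H t = h x + 2 * ((area (pp x) (qq x)).[t] - (area (pp x) (qq x)).[x])) &
    forall t, slope_on setT H t (2 * (F 1%N t * G 0%N t - F 0%N t * G 1%N t))].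
  move=> x s ps gs; have [F [G [H [[F1 F2 _ F4 _] [G1 G2 _ G4 _] Hz _ Hs]]]] := IH s x ps gs.
  have hold (E : R -> R) : (forall t t', t <= t' -> t' <= b ->
      `|E t - E t'| <= (M0 + 2 * M1) * w (t' - t)) -> holder a b w (M0 + 2 * M1) E.
    move=> HE t t' _ tb _ t'b; have [tt'|/ltW t't] := leP t t'.
      by rewrite [`|t - t'|]distrC [`|t' - t|]ger0_norm ?subr_ge0//; exact: HE.
    by rewrite distrC [`|t - t'|]ger0_norm ?subr_ge0//; exact: HE.
  exists F, G, H; split => //; first by split; exact: hold.
  by move=> z k zs km; split; [exact: F2|exact: G2].
have areaS c (p q : {poly R}) t (y : R) : slope_on setT (fun t => c + 2 * ((area p q).[t] - (area p q).[y])) t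
    (2 * ((derivn 1%N p).[t] * (derivn 0%N q).[t] - (derivn 0%N p).[t] * (derivn 1%N q).[t])).
  have := slope_onD (slope_on_cst setT c t)
    (slope_onZ 2 (slope_onB (slope_on_horner setT (area p q) t) (slope_on_cst setT (area p q).[y] t))).
  by rewrite add0r subr0 deriv_area !hornerE.
elim: s x => [|x s IH] y.
  move=> _ gs; have [_ _ gy] := gs y (mem_head _ _).
  exists (fun k => horner (derivn k (pp y))), (fun k => horner (derivn k (qq y))),
    (fun t => h y + 2 * ((area (pp y) (qq y)).[t] - (area (pp y) (qq y)).[y])).
  split => //.
  - by apply: interpolates1; [exact: wP|exact: ltW|exact: ltW|exact: good_size_p gy].
  - by apply: interpolates1; [exact: wP|exact: ltW|exact: ltW|exact: good_size_q gy].
  by move=> z; rewrite inE => /eqP ->; rewrite subrr mulr0 addr0.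
move=> /= /andP[yx ps] gs.
have gs' z : z \in x :: s -> good z by move=> zs; apply: gs; rewrite inE zs orbT.
have [ay yb gy] := gs y (mem_head _ _).
have [ax xb gx] := gs' x (mem_head _ _).
have [F [G [H [iF iG Hz Hl Hs]]]] := IH x ps gs'.
have xs z : z \in x :: s -> x <= z.
  rewrite inE => /predU1P[->//|zs]; apply: ltW.
  by move: ps => /(order_path_min lt_trans)/allP; apply.
have [u [v [By Bx uv top]]] := HM1 y x _ _ _ _ gy gx ay yx xb.
have nF z : z \in x :: s -> `|(derivn m (pp x)).[x] - (derivn m (pp z)).[z]| <= M0 * w (z - x).
  by move=> zs; have [] := HM0 x z (gs' _ (mem_head _ _)) (gs' z zs) (xs z zs).
have nG z : z \in x :: s -> `|(derivn m (qq x)).[x] - (derivn m (qq z)).[z]| <= M0 * w (z - x).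
  by move=> zs; have [] := HM0 x z (gs' _ (mem_head _ _)) (gs' z zs) (xs z zs).
have iF' := interpolates_cons wP (ltW M00) (ltW M10) yx xb (good_size_p gy) xs nF
  (fun k km => (By k km).1) (fun k km => (Bx k km).1) (fun t yt tx => (top t yt tx).1) iF.
have iG' := interpolates_cons wP (ltW M00) (ltW M10) yx xb (good_size_q gy) xs nG
  (fun k km => (By k km).2) (fun k km => (Bx k km).2) (fun t yt tx => (top t yt tx).2) iG.
(* [Ha] lifts the polynomials to the left of the new node and [Hb] lifts the curve in the gap; they
   agree at [y], and [Hb] meets the earlier height at [x]. *)
pose Ha t := h y + 2 * ((area (pp y) (qq y)).[t] - (area (pp y) (qq y)).[y]).
pose Hb t := h y + 2 * ((area u v).[t] - (area u v).[y]).
have Hbx : Hb x = H x by rewrite /Hb uv Hz ?mem_head// addrC subrK.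
have Hay : Ha y = Hb y by rewrite /Ha /Hb !subrr.
have Hay' : Ha y = splice x Hb H y by rewrite splice_le// ltW.
have [_ Fn Fl _ _] := iF; have [_ Gn Gl _ _] := iG.
have F01 k : (k <= m)%N -> (derivn k u).[x] = F k x /\ (derivn k v).[x] = G k x.
  by move=> km; have [-> ->] := Bx k km; rewrite Fn ?mem_head// Gn ?mem_head.
do 3 eexists; split; [exact: iF'|exact: iG'| | |].
- instantiate (1 := splice y Ha (splice x Hb H)).
  move=> z; rewrite inE => /predU1P[->|zs]; first by rewrite splice_le// /Ha subrr mulr0 addr0.
  by rewrite splice_ge//; [rewrite splice_ge ?xs//; exact: Hz|rewrite (le_trans (ltW yx))// xs].
- by move=> t ty; rewrite splice_le.
have [u0 v0] := F01 0%N (leq0n _); have [u1 v1] := F01 1%N m0.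
have [yu0 yv0] := By 0%N (leq0n _); have [yu1 yv1] := By 1%N m0.
move=> t; pose phi (A B C D : R -> R) r := 2 * (A r * B r - C r * D r).
have -> : 2 * (splice y (horner (derivn 1%N (pp y))) (splice x (horner (derivn 1%N u)) (F 1%N)) t *
    splice y (horner (derivn 0%N (qq y))) (splice x (horner (derivn 0%N v)) (G 0%N)) t -
    splice y (horner (derivn 0%N (pp y))) (splice x (horner (derivn 0%N u)) (F 0%N)) t *
    splice y (horner (derivn 1%N (qq y))) (splice x (horner (derivn 1%N v)) (G 1%N)) t) =
  splice y (phi (horner (derivn 1%N (pp y))) (horner (derivn 0%N (qq y)))
              (horner (derivn 0%N (pp y))) (horner (derivn 1%N (qq y))))
    (splice x (phi (horner (derivn 1%N u)) (horner (derivn 0%N v))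
                 (horner (derivn 0%N u)) (horner (derivn 1%N v)))
      (phi (F 1%N) (G 0%N) (F 0%N) (G 1%N))) t.
  by rewrite /splice /phi; case: ifP => // _; case: ifP.
apply: slope_splice => //.
- by rewrite splice_le ?(ltW yx)// /phi yu0 yv0 yu1 yv1.
- by move=> r _; exact: areaS.
move=> r _; apply: slope_splice => //.
- by rewrite /phi u0 v0 u1 v1.
- by move=> r' _; exact: areaS.
Qed.

End FiniteInterpolation.

(** * Interpolation on an arbitrary set *)

Section UltraLimit.
Variable R : realType.

(** Compactness of a segment gives a cluster point, and along an ultrafilter a cluster point is a
    limit. *)
Lemma ultra_bounded_cvg (I : Type) (U : set_system I) (u : I -> R) (C : R) :
  UltraFilter U -> (\forall i \near U, `|u i| <= C) -> exists l : R, u i @[i --> U] --> l.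
Proof.
move=> UU uC.
have [|p [_ clp]] := @segment_compact R (- C) C (u i @[i --> U]) _.
  by near_simpl; apply: filterS uC => i; rewrite /= in_itv/= ler_norml.
exists p => V Vp; have [//|nV] := in_ultra_setVsetC (u @^-1` V) UU.
by have [y [nVy Vy]] := clp (~` V) V nV Vp.
Qed.

Lemma cvg_norm_le (I : Type) (U : set_system I) (u : I -> R) (l C : R) :
  ProperFilter U -> u i @[i --> U] --> l -> (\forall i \near U, `|u i| <= C) -> `|l| <= C.
Proof.
move=> UU ul uC; have unl : `|u i| @[i --> U] --> `|l| by exact: cvg_norm.
exact: cvgr_to_le unl uC.
Qed.

End UltraLimit.

Section Interpolation.
Variables (R : realType) (a b : R) (m : nat) (w : R -> R).
Hypotheses (m0 : (0 < m)%N) (wP : modulus w) (ab : a < b).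

Definition contact (F G : nat -> R -> R) t :=
  2 * (F 1%N t * G 0%N t - F 0%N t * G 1%N t).

Record admissible (C : R) (F G : nat -> R -> R) (H : R -> R) : Prop := Admissible {
  adm_bF : forall k, (k <= m)%N -> bounded_by a b C (F k);
  adm_bG : forall k, (k <= m)%N -> bounded_by a b C (G k);
  adm_bH : bounded_by a b C H;
  adm_hF : forall k, (k <= m)%N -> holder a b w C (F k);
  adm_hG : forall k, (k <= m)%N -> holder a b w C (G k);
  adm_hH : holder a b w C H;
  adm_oF : forall k, (k < m)%N -> first_order a b w C (F k) (F k.+1);
  adm_oG : forall k, (k < m)%N -> first_order a b w C (G k) (G k.+1);
  adm_oH : first_order a b w C H (contact F G)
}.

Variables (f g h : R -> R) (K : R) (pp qq : R -> {poly R}).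
Hypothesis K0 : 0 < K.
Let good x := [/\ a <= x, x <= b & good_point m w f g h K x (pp x) (qq x)].

Definition matches (F G : nat -> R -> R) (H : R -> R) z :=
  [/\ F 0%N z = f z, G 0%N z = g z & H z = h z].

Lemma holderW (C C' : R) (F : R -> R) : C <= C' -> holder a b w C F -> holder a b w C' F.
Proof.
move=> CC' HF t t' at_ tb at' t'b; apply: le_trans (HF _ _ at_ tb at' t'b) _.
by apply: ler_wpM2r => //; exact: modulus_ge0.
Qed.

Lemma first_orderW (C C' : R) (F F' : R -> R) : C <= C' ->
  first_order a b w C F F' -> first_order a b w C' F F'.
Proof.
move=> CC' HF t t' at_ tb at' t'b; apply: le_trans (HF _ _ at_ tb at' t'b) _.
by apply: ler_wpM2r => //; rewrite mulr_ge0// modulus_ge0.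
Qed.

Lemma bounded_byW (C C' : R) (F : R -> R) : C <= C' ->
  bounded_by a b C F -> bounded_by a b C' F.
Proof. by move=> CC' HF t at_ tb; exact: le_trans (HF t at_ tb) CC'. Qed.

Lemma holderM (C : R) (F G : R -> R) : 0 <= C -> bounded_by a b C F -> bounded_by a b C G ->
  holder a b w C F -> holder a b w C G -> holder a b w (2 * C * C) (fun t => F t * G t).
Proof.
move=> C0 bF bG hF hG t t' at_ tb at' t'b.
have -> : F t * G t - F t' * G t' = (F t - F t') * G t + F t' * (G t - G t') by ring.
apply: le_trans (ler_normD _ _) _; rewrite !normrM.
have h1 : `|F t - F t'| * `|G t| <= C * w `|t - t'| * C.
  by apply: ler_pM => //; [exact: hF|exact: bG].
have h2 : `|F t'| * `|G t - G t'| <= C * (C * w `|t - t'|).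
  by apply: ler_pM => //; [exact: bF|exact: hG].
lra.
Qed.

Lemma holderB (C : R) (F G : R -> R) : holder a b w C F -> holder a b w C G ->
  holder a b w (2 * C) (fun t => F t - G t).
Proof.
move=> hF hG t t' at_ tb at' t'b.
have -> : F t - G t - (F t' - G t') = (F t - F t') - (G t - G t') by ring.
apply: le_trans (ler_normB _ _) _.
have := hF _ _ at_ tb at' t'b; have := hG _ _ at_ tb at' t'b; lra.
Qed.

Lemma holderZ (c C : R) (F : R -> R) : holder a b w C F ->
  holder a b w (`|c| * C) (fun t => c * F t).
Proof.
move=> hF t t' at_ tb at' t'b; rewrite -mulrBr normrM -mulrA.
by apply: ler_wpM2l => //; exact: hF.
Qed.

Lemma admissible_finite : exists2 C : R, 0 < C & forall s : seq R,
  (forall z, z \in s -> good z) -> exists F G H, admissible C F G H /\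
    forall z, z \in s -> matches F G H z.
Proof.
have [M M0 HM] := finite_interpolation m0 wP ab f g h pp qq K0.
have [C C0 HC] := jet_bounds m ab wP (ltW K0) (ltW M0).
(* The constant of [contact F G]: 2 C^2 for each product, doubled by the difference and again by the
   leading factor 2. *)
pose C1 := 2 * (2 * (2 * C * C)).
have CC : 0 < C * C by rewrite mulr_gt0.
have C10 : 0 < C1 by rewrite /C1; lra.
have lr0 := lip_ratio_ge0 ab wP.
have ba0 : 0 < b - a by rewrite subr_gt0.
pose C2 := C + C1 + C1 * lip_ratio a b w + (K + C1 * (b - a)).
have c1 : 0 <= C1 * lip_ratio a b w by rewrite mulr_ge0// ltW.
have c2 : 0 <= C1 * (b - a) by rewrite mulr_ge0// ltW.
have CC2 : C <= C2 by have := K0; rewrite /C2; lra.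
have C1C2 : C1 <= C2 by have := K0; rewrite /C2; lra.
have C20 : 0 < C2 by exact: lt_le_trans CC2.
exists C2 => // s gs.
case sE : (sort <=%R (undup s)) => [|x s'].
  have s0 z : z \in s = false by rewrite -mem_undup -(mem_sort <=%R) sE.
  have Cw r : 0 <= C2 * w `|r| by apply: mulr_ge0; [exact: ltW|exact: modulus_ge0].
  exists (fun _ _ => 0), (fun _ _ => 0), (fun=> 0); split; last by move=> z; rewrite s0.
  split.
  - by move=> k _ t * /=; rewrite normr0 ltW.
  - by move=> k _ t * /=; rewrite normr0 ltW.
  - by move=> t * /=; rewrite normr0 ltW.
  - by move=> k _ t t' * /=; rewrite subrr normr0.
  - by move=> k _ t t' * /=; rewrite subrr normr0.
  - by move=> t t' * /=; rewrite subrr normr0.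
  - by move=> k _ t t' * /=; rewrite mul0r !subrr normr0 mulrA mulr_ge0.
  - by move=> k _ t t' * /=; rewrite mul0r !subrr normr0 mulrA mulr_ge0.
  - by move=> t t' * /=; rewrite /contact !mul0r subrr mulr0 mul0r !subrr normr0 mulrA mulr_ge0.
have ss z : (z \in x :: s') = (z \in s) by rewrite -sE mem_sort mem_undup.
have ps : path <%R x s'.
  have : sorted <%R (sort <=%R (undup s)) by rewrite sort_lt_sorted undup_uniq.
  by rewrite sE.
have gs' z : z \in x :: s' -> good z by rewrite ss; exact: gs.
have [F [G [H [[dF dG] [hF hG] FG Hz Hs]]]] := HM x s' ps gs'.
have [ax xb gx] := gs' x (mem_head _ _).
have FxK k : (k <= m)%N -> `|F k x| <= K.
  by move=> km; have [-> _] := FG x k (mem_head _ _) km; exact: good_jet_p gx k.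
have GxK k : (k <= m)%N -> `|G k x| <= K.
  by move=> km; have [_ ->] := FG x k (mem_head _ _) km; exact: good_jet_q gx k.
have [F1 F2 F3] := HC F x ax xb dF FxK hF.
have [G1 G2 G3] := HC G x ax xb dG GxK hG.
have hphi : holder a b w C1 (contact F G).
  rewrite (_ : C1 = `|2| * (2 * (2 * C * C))); last by rewrite ger0_norm.
  by apply: holderZ; apply: holderB; apply: holderM;
    first [exact: ltW|exact: F1|exact: G1|exact: F2|exact: G2].
have bphi : bounded_by a b C1 (contact F G).
  move=> t at_ tb; rewrite /contact normrM ger0_norm//.
  have h1 : `|F 1%N t * G 0%N t| <= C * C by rewrite normrM ler_pM//; [exact: F1|exact: G1].
  have h2 : `|F 0%N t * G 1%N t| <= C * C by rewrite normrM ler_pM//; [exact: F1|exact: G1].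
  by have := ler_normB (F 1%N t * G 0%N t) (F 0%N t * G 1%N t); rewrite /C1; lra.
have HxK : `|H x| <= K by rewrite Hz ?mem_head//; exact: good_h gx.
exists F, G, H; split; last first.
  move=> z; rewrite -ss => zs; have [_ _ gz] := gs' z zs.
  rewrite /matches; have [-> ->] := FG z 0%N zs (leq0n _); rewrite !derivn0 Hz//.
  by split; [exact: good_p gz|exact: good_q gz|].
split.
- by move=> k km; apply: bounded_byW CC2 _; exact: F1.
- by move=> k km; apply: bounded_byW CC2 _; exact: G1.
- have H1 := slope_bounded (ltW C10) ax xb HxK Hs bphi.
  by apply: bounded_byW H1; rewrite /C2; lra.
- by move=> k km; apply: holderW CC2 _; exact: F2.
- by move=> k km; apply: holderW CC2 _; exact: G2.
- have H1 := slope_holder ab wP (ltW C10) Hs bphi.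
  by apply: holderW H1; have := K0; rewrite /C2; lra.
- by move=> k km; apply: first_orderW CC2 _; exact: F3.
- by move=> k km; apply: first_orderW CC2 _; exact: G3.
by apply: first_orderW C1C2 _; exact: slope_first_order (ltW C10) Hs hphi.
Qed.

(* Every condition in [admissible] and [matches] is closed under pointwise
   convergence, and C does not depend on the finite set. *)
Lemma admissible_interpolation : exists C F G H, 0 < C /\ admissible C F G H /\
  forall z, good z -> matches F G H z.
Proof.
have [C C0 HC] := admissible_finite.
have /choice[T HT] (s : seq R) : exists T : (nat -> R -> R) * (nat -> R -> R) * (R -> R),
    (forall z, z \in s -> good z) -> admissible C T.1.1 T.1.2 T.2 /\
    forall z, z \in s -> matches T.1.1 T.1.2 T.2 z.
  have [gs|ngs] := pselect (forall z, z \in s -> good z).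
    by have [F [G [H HFGH]]] := HC s gs; exists (F, G, H).
  by exists (fun _ _ => 0, fun _ _ => 0, fun=> 0).
(* Lists of good points directed by inclusion: along an ultrafilter finer than this filter, each
   good point eventually belongs to the list and is therefore matched in the limit. *)
pose base (s : seq R) := [set s' : seq R | {subset s <= s'} /\ forall z, z \in s' -> good z].
pose Fil : set_system (seq R) := [set P | exists2 s, forall z, z \in s -> good z & base s `<=` P].
have FilP : ProperFilter Fil.
  apply: Build_ProperFilter_ex.
    by move=> P [s gs sP]; exists s; apply: sP; split.
  split.
  - by exists [::].
  - move=> P Q [s gs sP] [s' gs' sQ]; exists (s ++ s').
      by move=> z; rewrite mem_cat => /orP[/gs|/gs'].
    move=> t [st gt]; split; [apply: sP|apply: sQ]; split => // z zs; apply: st.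
      by rewrite mem_cat zs.
    by rewrite mem_cat zs orbT.
  - by move=> P Q PQ [s gs sP]; exists s => //; exact: subset_trans PQ.
have [U [UU FilU]] := ultraFilterLemma FilP.
have Uadm : \forall s \near U, admissible C (T s).1.1 (T s).1.2 (T s).2.
  by apply: FilU; exists [::] => // s [_ /HT[]].
have Umatch z : good z -> \forall s \near U, matches (T s).1.1 (T s).1.2 (T s).2 z.
  move=> gz; apply: FilU; exists [:: z]; first by move=> y; rewrite inE => /eqP ->.
  by move=> s [zs /HT[_]]; apply; apply: zs; rewrite mem_head.
pose lim_of (u : seq R -> R) := get (fun l : R => u s @[s --> U] --> l).
have limP u : (\forall s \near U, `|u s| <= C) -> u s @[s --> U] --> lim_of u.
  by move=> /(ultra_bounded_cvg UU)[l ul]; apply: (@getPex _ (fun l : R => u s @[s --> U] --> l)); exists l.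
pose F k t := lim_of (fun s => (T s).1.1 k t).
pose G k t := lim_of (fun s => (T s).1.2 k t).
pose H t := lim_of (fun s => (T s).2 t).
have cF k t : (k <= m)%N -> a <= t -> t <= b -> (T s).1.1 k t @[s --> U] --> F k t.
  by move=> km at_ tb; apply: limP; apply: filterS Uadm => s /adm_bF; apply.
have cG k t : (k <= m)%N -> a <= t -> t <= b -> (T s).1.2 k t @[s --> U] --> G k t.
  by move=> km at_ tb; apply: limP; apply: filterS Uadm => s /adm_bG; apply.
have cH t : a <= t -> t <= b -> (T s).2 t @[s --> U] --> H t.
  by move=> at_ tb; apply: limP; apply: filterS Uadm => s /adm_bH; apply.
have cphi t : a <= t -> t <= b -> contact (T s).1.1 (T s).1.2 t @[s --> U] --> contact F G t.
  move=> at_ tb; apply: cvgM; first exact: cvg_cst.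
  by apply: cvgB; apply: cvgM; [exact: cF|exact: cG|exact: cF|exact: cG].
have first (u v : seq R -> R -> R) (u0 v0 : R -> R) :
    (forall t, a <= t -> t <= b -> u s t @[s --> U] --> u0 t) ->
    (forall t, a <= t -> t <= b -> v s t @[s --> U] --> v0 t) ->
    (\forall s \near U, first_order a b w C (u s) (v s)) -> first_order a b w C u0 v0.
  move=> cu cv Huv t t' at_ tb at' t'b.
  apply: (cvg_norm_le (u := fun s => u s t' - u s t - v s t * (t' - t)) (U := U)).
    apply: cvgB; first by apply: cvgB; exact: cu.
    by apply: cvgM; [exact: cv|exact: cvg_cst].
  by apply: filterS Huv => s; apply.
have hold (u : seq R -> R -> R) (u0 : R -> R) :
    (forall t, a <= t -> t <= b -> u s t @[s --> U] --> u0 t) ->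
    (\forall s \near U, holder a b w C (u s)) -> holder a b w C u0.
  move=> cu Hu t t' at_ tb at' t'b.
  apply: (cvg_norm_le (u := fun s => u s t - u s t') (U := U)).
    by apply: cvgB; exact: cu.
  by apply: filterS Hu => s; apply.
exists C, F, G, H; split => //; split; last first.
  move=> z gz; have [az zb _] := gz; have Uz := Umatch z gz.
  have E (u : seq R -> R) l l' : u s @[s --> U] --> l -> (\forall s \near U, u s = l') -> l = l' :> R.
    move=> ul ul'; apply/eqP; rewrite -subr_eq0 -normr_le0.
    apply: (cvg_norm_le (u := fun s => u s - l') (U := U)).
      by apply: cvgB => //; exact: cvg_cst.
    by apply: filterS ul' => s ->; rewrite subrr normr0.
  split.
  - by apply: E (cF 0%N z (leq0n _) az zb) _; apply: filterS Uz => s [].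
  - by apply: E (cG 0%N z (leq0n _) az zb) _; apply: filterS Uz => s [].
  - by apply: E (cH z az zb) _; apply: filterS Uz => s [].
split.
- by move=> k km t at_ tb; apply: cvg_norm_le (cF k t km at_ tb) _; apply: filterS Uadm => s /adm_bF; apply.
- by move=> k km t at_ tb; apply: cvg_norm_le (cG k t km at_ tb) _; apply: filterS Uadm => s /adm_bG; apply.
- by move=> t at_ tb; apply: cvg_norm_le (cH t at_ tb) _; apply: filterS Uadm => s /adm_bH; apply.
- move=> k km; apply: hold (fun t => cF k t km) _.
  by apply: filterS Uadm => s /adm_hF/(_ k km).
- move=> k km; apply: hold (fun t => cG k t km) _.
  by apply: filterS Uadm => s /adm_hG/(_ k km).
- by apply: hold cH _; apply: filterS Uadm => s /adm_hH.
- move=> k km; apply: first (fun t => cF k t (ltnW km)) (fun t => cF k.+1 t km) _.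
  by apply: filterS Uadm => s /adm_oF/(_ k km).
- move=> k km; apply: first (fun t => cG k t (ltnW km)) (fun t => cG k.+1 t km) _.
  by apply: filterS Uadm => s /adm_oG/(_ k km).
by apply: first cH cphi _; apply: filterS Uadm => s /adm_oH.
Qed.

End Interpolation.

(** * Extension to the line *)

Section SmoothOn.
Variables (R : realType) (a b : R) (w : R -> R).
Hypotheses (ab : a < b) (wP : modulus w).
Implicit Types (f g : R -> R).

(* C^{n,w} on [a, b], with derivatives defined by first-order expansions so that
   the values of f outside [a, b] do not matter. *)
Fixpoint smooth_on n f : Prop :=
  (exists C, bounded_by a b C f /\ holder a b w C f) /\
  if n is n'.+1 then
    exists f', (exists C, first_order a b w C f f') /\ smooth_on n' f'
  else True.

Lemma smooth_on_bounds n f : smooth_on n f ->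
  exists C, bounded_by a b C f /\ holder a b w C f.
Proof. by case: n => [|n] []. Qed.

Lemma smooth_onW n f : smooth_on n.+1 f -> smooth_on n f.
Proof.
elim: n f => [|n IH] f [Cf [f' [Of f's]]]; first by split.
by split => //; exists f'; split => //; exact: IH.
Qed.

Lemma bounded_by_ge0 C f : bounded_by a b C f -> 0 <= C.
Proof. by move=> /(_ a (lexx _) (ltW ab)); exact: le_trans. Qed.

Lemma smooth_onB n f g : smooth_on n f -> smooth_on n g -> smooth_on n (fun t => f t - g t).
Proof.
elim: n f g => [|n IH] f g [[C [bf hf]] Of] [[D [bg hg]] Og].
all: have C0 := bounded_by_ge0 bf; have D0 := bounded_by_ge0 bg.
all: have bh : exists C, bounded_by a b C (fun t => f t - g t) /\ holder a b w C (fun t => f t - g t).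
1,3: exists (2 * (C + D)); split; last first.
1,3: apply: holderB => //; [apply: holderW hf|apply: holderW hg] => //; lra.
1,2: by move=> t at_ tb; apply: le_trans (ler_normB _ _) _;
  have := bf t at_ tb; have := bg t at_ tb; lra.
  by split.
split => //; have [f' [[C' o_f] sf]] := Of; have [g' [[D' o_g] sg]] := Og.
exists (fun t => f' t - g' t); split; last exact: IH.
exists (C' + D') => t t' at_ tb at' t'b.
have -> : f t' - g t' - (f t - g t) - (f' t - g' t) * (t' - t) =
  (f t' - f t - f' t * (t' - t)) - (g t' - g t - g' t * (t' - t)) by ring.
apply: le_trans (ler_normB _ _) _; rewrite mulrDl; apply: lerD.
  exact: o_f.
exact: o_g.
Qed.

Lemma smooth_onZ n c f : smooth_on n f -> smooth_on n (fun t => c * f t).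
Proof.
elim: n f => [|n IH] f [[C [bf hf]] Of].
all: have bh : exists C, bounded_by a b C (fun t => c * f t) /\ holder a b w C (fun t => c * f t).
1,3: exists (`|c| * C); split; last exact: holderZ.
1,2: by move=> t at_ tb; rewrite normrM ler_wpM2l// bf.
  by split.
split => //; have [f' [[C' o_f] sf]] := Of.
exists (fun t => c * f' t); split; last exact: IH.
exists (`|c| * C') => t t' at_ tb at' t'b.
have -> : c * f t' - c * f t - c * f' t * (t' - t) = c * (f t' - f t - f' t * (t' - t)) by ring.
by rewrite normrM -mulrA; apply: ler_wpM2l => //; exact: o_f.
Qed.

Lemma smooth_onM n f g : smooth_on n f -> smooth_on n g -> smooth_on n (fun t => f t * g t).
Proof.
elim: n f g => [|n IH] f g sf sg.
all: have [C [bf hf]] := smooth_on_bounds sf; have [D [bg hg]] := smooth_on_bounds sg.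
all: have C0 := bounded_by_ge0 bf; have D0 := bounded_by_ge0 bg.
all: have CD : C <= C + D by lra.
all: have DC : D <= C + D by lra.
all: have bh : exists C, bounded_by a b C (fun t => f t * g t) /\ holder a b w C (fun t => f t * g t).
1,3: exists (2 * (C + D) * (C + D)); split; last first.
1,3: apply: holderM; [lra|exact: bounded_byW bf|exact: bounded_byW bg|exact: holderW hf|exact: holderW hg].
1,2: move=> t at_ tb; rewrite normrM; apply: (@le_trans _ _ (C * D));
  [by apply: ler_pM => //; [exact: bf|exact: bg]|nra].
  by split.
split => //; have [_ [f' [[C' o_f] sf']]] := sf; have [_ [g' [[D' o_g] sg']]] := sg.
have [E [bf' _]] := smooth_on_bounds sf'.
have E0 := bounded_by_ge0 bf'.
(* The product rule, with its sum written as a difference so that [smooth_onB] and [smooth_onZ]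
   apply. *)
exists (fun t => f' t * g t - -1 * (f t * g' t)); split; last first.
  apply: smooth_onB; first by apply: IH => //; exact: smooth_onW sg.
  by apply: smooth_onZ; apply: IH => //; exact: smooth_onW sf.
exists (`|C'| * D + C * `|D'| + E * D) => t t' at_ tb at' t'b.
have -> : f t' * g t' - f t * g t - (f' t * g t - -1 * (f t * g' t)) * (t' - t) =
  (f t' - f t - f' t * (t' - t)) * g t' + f t * (g t' - g t - g' t * (t' - t)) +
  f' t * (t' - t) * (g t' - g t) by ring.
have e0 : 0 <= w `|t' - t| * `|t' - t| by rewrite mulr_ge0// modulus_ge0.
set e := w _ * _ in e0 *.
apply: le_trans (ler_normD _ _) _; apply: le_trans (lerD (ler_normD _ _) (lexx _)) _.
rewrite !normrM.
have h1 : `|f t' - f t - f' t * (t' - t)| * `|g t'| <= `|C'| * e * D.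
  apply: ler_pM => //; last exact: bg.
  by apply: le_trans (o_f _ _ at_ tb at' t'b) _; apply: ler_wpM2r => //; exact: ler_norm.
have h2 : `|f t| * `|g t' - g t - g' t * (t' - t)| <= C * (`|D'| * e).
  apply: ler_pM => //; first exact: bf.
  by apply: le_trans (o_g _ _ at_ tb at' t'b) _; apply: ler_wpM2r => //; exact: ler_norm.
have h3 : `|f' t| * `|t' - t| * `|g t' - g t| <= E * `|t' - t| * (D * w `|t' - t|).
  apply: ler_pM => //.
    by apply: ler_wpM2r => //; exact: bf'.
  exact: hg.
have h4 : E * `|t' - t| * (D * w `|t' - t|) = E * D * e by rewrite /e; ring.
lra.
Qed.

Lemma first_order_slope C f f' t : first_order a b w C f f' -> a <= t -> t <= b ->
  slope_on `[a, b] f t (f' t).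
Proof.
move=> o_f at_ tb e e0.
have C10 : 0 < `|C| + 1 by rewrite ltr_wpDl.
have eC : 0 < e / (`|C| + 1) by rewrite divr_gt0.
have [d d0 Hd] := modulus_small wP eC.
exists d => // y; rewrite /= in_itv/= => /andP[ay yb] yt.
apply: le_trans (o_f t y at_ tb ay yb) _; rewrite mulrA; apply: ler_wpM2r => //.
have := Hd _ (normr_ge0 _) yt; rewrite ltr_pdivlMr// => H.
have w0 : 0 <= w `|y - t| by apply: modulus_ge0.
have : C * w `|y - t| <= (`|C| + 1) * w `|y - t|.
  by apply: ler_wpM2r => //; apply: le_trans (ler_norm _) _; rewrite lerDl.
lra.
Qed.

Lemma first_order_interior C f f' F t : first_order a b w C f f' -> a < t -> t < b ->
  (forall y, a <= y -> y <= b -> F y = f y) -> slope_on setT F t (f' t).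
Proof.
move=> o_f at_ tb Ff.
have -> : setT = `[a, b] `|` ~` `[a, b] by rewrite setUv.
apply: slope_onU.
  apply: (@slope_on_eq R _ f) (first_order_slope o_f (ltW at_) (ltW tb)) => [|y].
    by rewrite /= in_itv/= !ltW.
  by rewrite /= in_itv/= => /andP[? ?]; rewrite Ff.
apply: (@slope_on_far R _ _ _ _ (Num.min (t - a) (b - t))).
  by rewrite lt_min !subr_gt0 at_.
move=> y /= /negP; rewrite in_itv/= negb_and -!ltNge ge_min => /orP[ya|yb]; apply/orP.
  by left; rewrite distrC ger0_norm; lra.
by right; rewrite ger0_norm; lra.
Qed.

Lemma first_order_lipschitz C B f f' : bounded_by a b B f' -> first_order a b w C f f' ->
  abs_continuous_on a b f.
Proof.
move=> bf' o_f.
have B0 := bounded_by_ge0 bf'.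
have ba0 : 0 < b - a by rewrite subr_gt0.
pose M := `|C| * w (b - a) + B + 1.
have w0 : 0 <= w (b - a) by apply: modulus_ge0 => //; exact: ltW.
have Cw : 0 <= `|C| * w (b - a) by rewrite mulr_ge0.
have M0 : 0 < M by rewrite /M; lra.
have lip t t' : a <= t -> t <= b -> a <= t' -> t' <= b -> `|f t' - f t| <= M * `|t' - t|.
  move=> at_ tb at' t'b.
  have d : `|t' - t| <= b - a by rewrite ler_norml; apply/andP; split; lra.
  rewrite -[f t' - f t](subrK (f' t * (t' - t))); apply: le_trans (ler_normD _ _) _.
  have h1 := o_f t t' at_ tb at' t'b.
  have h2 : C * (w `|t' - t| * `|t' - t|) <= `|C| * w (b - a) * `|t' - t|.
    rewrite mulrA; apply: ler_wpM2r => //; apply: (@le_trans _ _ (`|C| * w `|t' - t|)).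
      by apply: ler_wpM2r; [exact: modulus_ge0|exact: ler_norm].
    by apply: ler_wpM2l => //; exact: modulus_le.
  have h3 : `|f' t * (t' - t)| <= B * `|t' - t| by rewrite normrM ler_wpM2r// bf'.
  have := normr_ge0 (t' - t); rewrite /M; lra.
move=> e e0; exists (e / M); first by rewrite divr_gt0.
move=> n u v uv _ s; apply: le_lt_trans (_ : _ <= M * \sum_(i < n) (v i - u i)) _.
  rewrite mulr_sumr; apply: ler_sum => i _; have [au uv' vb] := uv i.
  rewrite -[X in _ <= _ * X]ger0_norm ?subr_ge0//; apply: lip => //.
    exact: le_trans vb.
  exact: le_trans uv'.
by move: s; rewrite ltr_pdivlMr// mulrC.
Qed.

(** The derivative is extended first, then integrated: inside [[a, b]] the given function is kept,
    outside it is continued by primitives of [p] and [q]. The extension is polynomial there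
    precisely so that these primitives are explicit; at order 0 it is constant. *)
Lemma smooth_extension n f : smooth_on n f -> exists (F : nat -> R -> R) (p q : {poly R}) (C : R),
  [/\ jet_derivs n F, (forall t, a <= t -> t <= b -> F 0%N t = f t),
     forall t t', `|F n t - F n t'| <= C * w `|t - t'|,
     forall t, t <= a -> F 0%N t = p.[t] & forall t, b <= t -> F 0%N t = q.[t] ].
Proof.
elim: n f => [|n IH] f [].
  move=> [C [bf hf]] _; exists (fun _ => f \o clamp a b), (f a)%:P, (f b)%:P, C.
  have ab' := ltW ab.
  split => //.
  - by move=> t at_ tb /=; rewrite clamp_id.
  - move=> t t' /=; have /andP[? ?] := clamp_itv ab' t; have /andP[? ?] := clamp_itv ab' t'.
    apply: (@le_trans _ _ (C * w `|clamp a b t - clamp a b t'|)); first exact: hf.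
    apply: ler_wpM2l; first exact: bounded_by_ge0 bf.
    by apply: modulus_le => //; exact: clamp_dist.
  - move=> t ta; rewrite hornerC /= /clamp min_l; last exact: le_trans ab'.
    by rewrite max_l.
  by move=> t bt; rewrite hornerC /= /clamp min_r// max_r.
move=> _ [f' [[C' o_f] sf']].
have [F [p [q [C [Fd Ff FC Fp Fq]]]]] := IH f' sf'.
pose p1 := prim p + (f a - (prim p).[a])%:P.
pose q1 := prim q + (f b - (prim q).[b])%:P.
have p1a : p1.[a] = f a by rewrite /p1 hornerD hornerC addrC subrK.
have q1b : q1.[b] = f b by rewrite /q1 hornerD hornerC addrC subrK.
have dp : deriv p1 = p by rewrite derivD derivC addr0 deriv_prim.
have dq : deriv q1 = q by rewrite derivD derivC addr0 deriv_prim.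
pose F0 t := if t <= a then p1.[t] else if t <= b then f t else q1.[t].
have F0l t : t <= a -> F0 t = p1.[t] by rewrite /F0 => ->.
have F0m t : a <= t -> t <= b -> F0 t = f t.
  move=> at_ tb; rewrite /F0 tb; case: ifPn => // ta.
  by have -> : t = a by apply/eqP; rewrite eq_le at_ ta.
have F0r t : b <= t -> F0 t = q1.[t].
  move=> bt; have [tb|tb] := leP t b.
    by have -> : t = b; [apply/eqP; rewrite eq_le bt tb|rewrite F0m ?q1b// ltW].
  by rewrite /F0 leNgt (lt_trans ab tb) /= leNgt tb.
have F0s t : slope_on setT F0 t (F 0%N t).
  have -> : setT = [set y | y <= a] `|` (`[a, b] `|` [set y | b <= y]).
    apply/seteqP; split => // y _; have [ya|/ltW ay] := leP y a; first by left.
    by right; have [yb|/ltW yb] := leP y b; [left; rewrite /= in_itv/= ay|right].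
  apply: slope_onU; last apply: slope_onU.
  - have [ta|at_] := leP t a.
      rewrite Fp// -dp; apply: (@slope_on_eq R _ (horner p1)) => //.
        by move=> y /= ya; rewrite F0l.
      exact: slope_on_horner.
    apply: (@slope_on_far R _ _ _ _ (t - a)); first by rewrite subr_gt0.
    by move=> y /= ya; rewrite distrC ger0_norm; lra.
  - have [ta|at_] := ltP t a.
      apply: (@slope_on_far R _ _ _ _ (a - t)); first by rewrite subr_gt0.
      by move=> y; rewrite /= in_itv/= => /andP[ay _]; rewrite ger0_norm; lra.
    have [tb|bt] := leP t b; last first.
      apply: (@slope_on_far R _ _ _ _ (t - b)); first by rewrite subr_gt0.
      by move=> y; rewrite /= in_itv/= => /andP[_ yb]; rewrite distrC ger0_norm; lra.
    rewrite Ff//; apply: (@slope_on_eq R _ f) (first_order_slope o_f at_ tb) => [|y].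
      by rewrite /= in_itv/= at_ tb.
    by rewrite /= in_itv/= => /andP[? ?]; rewrite F0m.
  have [bt|tb] := leP b t.
    rewrite Fq// -dq; apply: (@slope_on_eq R _ (horner q1)) => //.
      by move=> y /= yb; rewrite F0r.
    exact: slope_on_horner.
  apply: (@slope_on_far R _ _ _ _ (b - t)); first by rewrite subr_gt0.
  by move=> y /= yb; rewrite ger0_norm; lra.
exists (fun k => if k is k'.+1 then F k' else F0), p1, q1, C; split => //.
by case=> [|k] t //; rewrite ltnS => kn; exact: Fd.
Qed.

Lemma jet_derivs_class_Cw m (omega : \bar R -> \bar R) (F : nat -> R -> R) (C : R) :
  (forall s, 0 <= s -> omega s%:E = (w s)%:E) -> jet_derivs m F ->
  (forall t t', `|F m t - F m t'| <= C * w `|t - t'|) -> class_Cw m omega (F 0%N).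
Proof.
move=> omegaE Fd FC.
have E k : (k <= m)%N -> derive1n k (F 0%N) = F k.
  elim: k => [//|k IH] km; rewrite derive1nS IH; last exact: ltnW.
  by apply/funext => t; have [_ ->] := slope_derive1 (Fd k t km).
split; first split.
- by move=> k x km; rewrite E; [have [] := slope_derive1 (Fd k x km)|exact: ltnW].
- rewrite E// => x; apply/cvgrPdist_lt => e e0.
  have C10 : 0 < `|C| + 1 by rewrite ltr_wpDl.
  have eC : 0 < e / (`|C| + 1) by rewrite divr_gt0.
  have [d d0 Hd] := modulus_small wP eC.
  apply/nbhs_ballP; exists d => //= y; rewrite /ball/= => xy.
  apply: le_lt_trans (FC x y) _.
  have := Hd _ (normr_ge0 _) xy; rewrite ltr_pdivlMr// => H.
  have w0 : 0 <= w `|x - y| by apply: modulus_ge0.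
  have : C * w `|x - y| <= (`|C| + 1) * w `|x - y|.
    by apply: ler_wpM2r => //; apply: le_trans (ler_norm _) _; rewrite lerDl.
  lra.
apply: le_lt_trans (ltry C); apply: ge_ereal_sup => _ [[x y] /= xy <-].
have d0 : 0 < `|x - y| by rewrite normr_gt0 subr_eq0.
have wd : 0 < w `|x - y| by exact: modulus_gt0.
rewrite (E m (leqnn _)) omegaE// inver (gt_eqF wd).
by rewrite -EFinM lee_fin ler_pdivrMr//; exact: FC.
Qed.

End SmoothOn.

(** * Horizontal curves *)

Section Curves.
Variables (R : realType) (a b : R) (m : nat) (w : R -> R) (omega : \bar R -> \bar R).
Hypotheses (m0 : (0 < m)%N) (wP : modulus w) (ab : a < b).
Hypothesis omegaE : forall s, 0 <= s -> omega s%:E = (w s)%:E.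
Notation mu := (@lebesgue_measure R).

Lemma smooth_on_jets C (F : nat -> R -> R) :
  (forall k, (k <= m)%N -> bounded_by a b C (F k)) ->
  (forall k, (k <= m)%N -> holder a b w C (F k)) ->
  (forall k, (k < m)%N -> first_order a b w C (F k) (F k.+1)) ->
  forall j k, (k + j <= m)%N -> smooth_on a b w j (F k).
Proof.
move=> bF hF oF; elim=> [|j IH] k kj; split => //.
- by exists C; rewrite addn0 in kj; split; [exact: bF|exact: hF].
- have km : (k <= m)%N by rewrite (leq_trans _ kj)// leq_addr.
  by exists C; split; [exact: bF|exact: hF].
exists (F k.+1); split; last by apply: IH; rewrite addSnnS.
by exists C; apply: oF; rewrite (leq_trans _ kj)// addnS ltnS leq_addr.
Qed.

(** The height is of order [m] because its derivative [contact F G] is of order [m.-1]. The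
    components are extended to the line independently, so the extended curve need not be horizontal
    outside [[a, b]]. *)
Lemma admissible_curve C F G H : admissible a b m w C F G H ->
  exists Gam : R -> heis R, [/\ curve_Cw a b m omega Gam, horizontal a b Gam &
    forall t, a <= t -> t <= b -> Gam t = (F 0%N t, G 0%N t, H t)].
Proof.
move=> [bF bG bH hF hG hH oF oG oH].
have sF := smooth_on_jets bF hF oF; have sG := smooth_on_jets bG hG oG.
have sH : smooth_on a b w m H.
  have [m' mE] : exists m', m = m'.+1 by exists m.-1; rewrite prednK.
  rewrite mE; split; first by exists C.
  exists (contact F G); split; first by exists C.
  apply: smooth_onZ; apply: (smooth_onB ab wP); apply: (smooth_onM ab wP).
  - by apply: sF; rewrite mE.
  - by apply: sG; rewrite mE.
  - by apply: sF; rewrite mE.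
  - by apply: sG; rewrite mE.
have [F1 [_ [_ [C1 [dF1 eF1 hF1 _ _]]]]] := smooth_extension ab wP (sF m 0%N (leqnn _)).
have [G1 [_ [_ [C2 [dG1 eG1 hG1 _ _]]]]] := smooth_extension ab wP (sG m 0%N (leqnn _)).
have [H1 [_ [_ [C3 [dH1 eH1 hH1 _ _]]]]] := smooth_extension ab wP sH.
pose Gam t : heis R := (F1 0%N t, G1 0%N t, H1 0%N t).
have fx : heis_x \o Gam = F1 0%N by [].
have gy : heis_y \o Gam = G1 0%N by [].
have hz : heis_z \o Gam = H1 0%N by [].
have AC u v v0 c : first_order a b w c v v0 -> (exists d, bounded_by a b d v0) ->
    (forall t, a <= t -> t <= b -> u t = v t) -> abs_continuous_on a b u.
  move=> ov [d bv] uv; have vAC := first_order_lipschitz ab wP bv ov.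
  move=> e /vAC[del del0 Hdel]; exists del => // n s t st tr sl.
  rewrite (eq_bigr (fun i => `|v (t i) - v (s i)|)); first exact: Hdel.
  move=> i _; have [as_ st' tb] := st i.
  by rewrite !uv//; [exact: le_trans tb|exact: le_trans st'].
have bc : bounded_by a b (2 * (C * C + C * C)) (contact F G).
  move=> t at_ tb.
  rewrite /contact normrM ger0_norm//; apply: ler_wpM2l => //.
  apply: le_trans (ler_normB _ _) _; apply: lerD; rewrite normrM; apply: ler_pM => //;
    by [apply: bF|apply: bG].
exists Gam; split.
- exists Gam; rewrite fx gy hz; split => //.
  + exact: (jet_derivs_class_Cw wP omegaE dF1 hF1).
  + exact: (jet_derivs_class_Cw wP omegaE dG1 hG1).
  + exact: (jet_derivs_class_Cw wP omegaE dH1 hH1).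
- split.
  + by rewrite fx; apply: AC (oF 0%N m0) _ eF1; exists C; exact: bF.
  + by rewrite gy; apply: AC (oG 0%N m0) _ eG1; exists C; exact: bG.
  + by rewrite hz; apply: AC oH _ eH1; exists (2 * (C * C + C * C)).
  (* The new curve satisfies the horizontality equation at every interior point, so the exceptional
     set is empty. *)
  apply: (@negligibleS _ _ _ _ set0); last exact: negligible_set0.
  move=> t /= nt; apply: nt; rewrite in_itv/= => /andP[at_ tb]; rewrite fx gy hz.
  have [dx ->] := slope_derive1 (first_order_interior wP (oF 0%N m0) at_ tb eF1).
  have [dy ->] := slope_derive1 (first_order_interior wP (oG 0%N m0) at_ tb eG1).
  have [dz ->] := slope_derive1 (first_order_interior wP oH at_ tb eH1).
  split => //; exists (F 1%N t), (G 1%N t).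
  rewrite /heis_X /heis_Y /heis_x /heis_y /Gam /= eF1 ?ltW// eG1 ?ltW//.
  have E (x1 y1 z1 x2 y2 z2 c d : R) : c *: ((x1, y1, z1) : R^o * R^o * R^o) + d *: ((x2, y2, z2) : R^o * R^o * R^o)
    = (c * x1 + d * x2, c * y1 + d * y2, c * z1 + d * z2) by [].
  by rewrite E /contact; congr (_, _, _); ring.
by move=> t at_ tb; rewrite /Gam eF1// eG1// eH1.
Qed.

Lemma good_set_curve (f g h : R -> R) (K : R) : 0 < K ->
  exists Gam : R -> heis R, [/\ curve_Cw a b m omega Gam, horizontal a b Gam &
    forall t p q, a <= t -> t <= b -> good_point m w f g h K t p q ->
      Gam t = (f t, g t, h t)].
Proof.
move=> K0.
(* One pair of polynomials is selected at each point; the default [(0, 0)] at the other points is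
   harmless because interpolation is claimed only where the selected pair is good. *)
have /choice[pq Hpq] (t : R) : exists pq : {poly R} * {poly R},
    (exists p q, good_point m w f g h K t p q) -> good_point m w f g h K t pq.1 pq.2.
  have [[p [q gt]]|ng] := pselect (exists p q, good_point m w f g h K t p q).
    by exists (p, q).
  by exists (0, 0).
have [C [F [G [H [C0 [adm HE]]]]]] := admissible_interpolation m0 wP ab f g h
  (fun t => (pq t).1) (fun t => (pq t).2) K0.
have [Gam [c1 c2 c3]] := admissible_curve adm; exists Gam; split => //.
move=> t p q at_ tb gt; rewrite c3//.
have [|-> -> ->//] := HE t; split => //; apply: Hpq; by exists p, q.
Qed.

End Curves.

(** * Sets of disagreement and conclusion *)

Section Measure.
Variables (R : realType) (a b : R).
Hypothesis ab : a <= b.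
Notation mu := (@lebesgue_measure R).

(** After composition with [clamp] the components are continuous on the line, so the curves differ
    on the trace on [[a, b]] of an open set. *)
Lemma measurable_neq (G1 G2 : R -> heis R) :
  abs_continuous_on a b (heis_x \o G1) -> abs_continuous_on a b (heis_y \o G1) ->
  abs_continuous_on a b (heis_z \o G1) -> abs_continuous_on a b (heis_x \o G2) ->
  abs_continuous_on a b (heis_y \o G2) -> abs_continuous_on a b (heis_z \o G2) ->
  measurable [set t | t \in `[a, b]%R /\ G1 t <> G2 t].
Proof.
move=> x1 y1 z1 x2 y2 z2.
pose N (u : heis R -> R) := [set t | u (G1 (clamp a b t)) - u (G2 (clamp a b t)) != 0].
have mN u : abs_continuous_on a b (u \o G1) -> abs_continuous_on a b (u \o G2) -> measurable (N u).
  move=> u1 u2; apply: open_measurable.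
  apply: (@open_comp _ _ (fun t => u (G1 (clamp a b t)) - u (G2 (clamp a b t))) [set x | x != 0]); last exact: open_neq.
  move=> t _; apply: (@continuousB _ _ _ ((u \o G1) \o clamp a b) ((u \o G2) \o clamp a b)).
    exact: abs_continuous_clamp.
  exact: abs_continuous_clamp.
have -> : [set t | t \in `[a, b]%R /\ G1 t <> G2 t] =
    `[a, b] `&` (N heis_x `|` N heis_y `|` N heis_z).
  apply/seteqP; split => [t /= [tab neq]|t /= [tab nE]]; split => //; move: (tab); rewrite in_itv/= => /andP[at_ tb].
    rewrite /N /= clamp_id//; apply: contrapT => H; apply: neq.
    move: H => /not_orP[/not_orP[/negP + /negP +] /negP]; rewrite !negbK !subr_eq0.
    case: (G1 t) => [[? ?] ?]; case: (G2 t) => [[? ?] ?].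
    by rewrite /heis_x /heis_y /heis_z/= => /eqP -> /eqP -> /eqP ->.
  move=> E; move: nE; rewrite /N /= clamp_id// E !subrr eqxx.
  by case=> [[]|].
by apply: measurableI => //; apply: measurableU; [apply: measurableU|]; exact: mN.
Qed.

(** If every set had measure at least [eps], so would their upper limit, by continuity from above in
    a bounded interval. *)
Lemma exists_small_measure (D : nat -> set R) (eps : R) : 0 < eps ->
  (forall n, measurable (D n)) -> (forall n, D n `<=` `[a, b]) ->
  mu.-negligible (lim_sup_set D) -> exists n, (mu (D n) < eps%:E)%E.
Proof.
move=> eps0 mD Dab nD; apply: contrapT => H.
have Dn n : (eps%:E <= mu (D n))%E.
  by rewrite leNgt; apply/negP => Hn; apply: H; exists n.
have mU n : measurable (\bigcup_(j >= n) D j) by exact: bigcup_measurable.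
have U0 : (mu (\bigcup_(j >= 0%N) D j) < +oo)%E.
  apply: (@le_lt_trans _ _ (mu `[a, b])).
    apply: le_measure; [by rewrite inE; exact: mU|by rewrite inE; exact: measurable_itv|].
    by apply: bigcup_sub => j _; exact: Dab.
  by rewrite lebesgue_measure_itv/=; case: ifP; rewrite ?ltry// -EFinB ltry.
have mL : measurable (lim_sup_set D) by exact: bigcapT_measurable.
have cv := lim_sup_set_cvg mu D mD U0.
rewrite [X in _ --> X](_ : _ = 0%E) in cv; last by apply/negligibleP.
have : (eps%:E <= 0 :> \bar R)%E.
  apply: cvge_to_ge cv _; apply: nearW => n /=; apply: le_trans (Dn n) _.
  apply: le_measure; [by rewrite inE; exact: mD|by rewrite inE; exact: mU|].
  by move=> t Dt; exists n => /=.
by rewrite leNgt lte_fin eps0.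
Qed.

End Measure.

Theorem theorem4p9 (R : realType) (m : nat) (a b : R)
    (omega : \bar R -> \bar R) (G : R -> heis R)
    (hm : (0 < m)%N) (hab : a <= b)
    (homega : modulus_of_continuity omega)
    (hG : horizontal a b G)
    (hf : {ae @lebesgue_measure R, forall t, t \in `[a, b]%R ->
            L1w_differentiable a b m.-1 omega ((heis_x \o G)^`()) t})
    (hg : {ae @lebesgue_measure R, forall t, t \in `[a, b]%R ->
            L1w_differentiable a b m.-1 omega ((heis_y \o G)^`()) t}) :
  lusin_property a b m omega G.
Proof.
have [wP omegaE] := modulus_of_continuity_fine homega.
set w := fun s => _ in wP omegaE.
move=> eps eps0; have [AB|] := leP b a.
  have aE t : t \in `[a, b]%R -> t = a.
    by rewrite in_itv/= => /andP[at_ tb]; apply/eqP; rewrite eq_le at_ (le_trans tb AB).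
  have cstC (k : R) : class_Cw m omega (fun=> k).
    apply: (@jet_derivs_class_Cw R w wP m omega (fun j t => if j is 0%N then k else 0) 0 omegaE).
      by move=> [|j] t _; exact: slope_on_cst.
    by move=> t t'; rewrite subrr normr0 mul0r.
  (* Here the interval is reduced to a point, where the constant curve agrees with [G]. *)
  exists (fun=> G a); split.
  - by exists (fun=> G a); split => //; exact: cstC.
  - split; [exact: abs_continuous_cst|exact: abs_continuous_cst|exact: abs_continuous_cst|].
    apply: (@negligibleS _ _ _ _ set0); last exact: negligible_set0.
    by move=> t /= nt; apply: nt; rewrite in_itv/= => /andP[at_ tb]; have := lt_trans at_ tb; rewrite ltNge AB.
  rewrite (_ : [set t | _] = set0) ?measure0 ?lte_fin//.
  by apply/seteqP; split => // t /= [/aE ->].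
move=> ab.
have [xAC yAC zAC hor] := hG.
set f := heis_x \o G in hf xAC hor; set g := heis_y \o G in hg yAC hor.
set h := heis_z \o G in zAC hor.
have hD : {ae @lebesgue_measure R, forall t, t \in `]a, b[%R -> [/\ derivable f t 1, derivable g t 1,
     derivable h t 1 & derive1 h t = 2 * (derive1 f t * g t - f t * derive1 g t)]}.
  apply: ae_imp hor => t Ht /Ht[ft gt ht [c [d E]]]; split => //.
  have [-> -> ->] : [/\ derive1 f t = c, derive1 g t = d &
      derive1 h t = c * (2 * heis_y (G t)) + d * - (2 * heis_x (G t))].
    have E' (x1 y1 z1 x2 y2 z2 c0 d0 : R) : c0 *: ((x1, y1, z1) : R^o * R^o * R^o) + d0 *: ((x2, y2, z2) : R^o * R^o * R^o)
      = (c0 * x1 + d0 * x2, c0 * y1 + d0 * y2, c0 * z1 + d0 * z2) by [].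
    move: E; rewrite /heis_X /heis_Y E' => -[-> -> ->].
    by split; rewrite ?mulr1 ?mulr0 ?addr0 ?add0r.
  by rewrite /f /g /=; ring.
have good := good_point_ae hm wP omegaE xAC yAC zAC hD hf hg.
have /choice[Gam HGam] (n : nat) := @good_set_curve R a b m w omega hm wP ab omegaE f g h n.+1%:R (ltr0Sn _ n).
pose D n := [set t | t \in `[a, b]%R /\ Gam n t <> G t].
have [n Hn] : exists n, (lebesgue_measure (D n) < eps%:E)%E.
  apply: (@exists_small_measure R a b) => //.
  - move=> n; have [_ [x1 y1 z1 _] _] := HGam n.
    exact: measurable_neq.
  - by move=> n t [].
  (* A point that is good with constant [K] is good with [j.+1] for all [j >= Num.truncn K], so it
     lies in finitely many sets [D j]. The upper limit therefore consists of exceptional points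
     only. *)
  apply: negligibleS good => t /= Dt Ht.
  have [n _ nK] : exists2 n : nat, True & forall j, (n <= j)%N -> ~ D j t.
    have tab : t \in `[a, b]%R by have [j _ []] := Dt 0%N I.
    have [K [p [q [K0 gt]]]] := Ht tab.
    exists (Num.truncn K) => // j nj [_]; apply.
    have Kj : K <= j.+1%:R.
      apply: ltW; apply: lt_le_trans (truncnS_gt _) _; by rewrite ler_nat.
    have [_ _ HE] := HGam j; move: tab; rewrite in_itv/= => /andP[at_ tb].
    rewrite (HE t p q at_ tb (good_pointW wP K0 Kj gt)) /f /g /h /=.
    by case: (G t) => [[]].
  by have [j /= nj Dj] := Dt n I; exact: nK Dj.
by have [c1 c2 _] := HGam n; exists (Gam n).
Qed.
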